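(* Any $\mathrm{SU}(3)$-invariant steady Laplacian soliton (with principal orbit $\mathrm{SU}(3)/T^2$) satisfies exactly one of the following: (i) It is asymptotically conical (generically with rate $-1$) with asymptotic cone the torsion-free cone over the standard $\mathrm{SU}(3)$-invariant nearly Kähler structure on $\mathrm{SU}(3)/T^2$. (ii) It has infinite forward existence time (and therefore it gives rise to a metrically-complete end), and as $t\to\infty$ one variable $f_k$ has a finite positive limit while the other two grow exponentially, with ratio $f_i/f_j\to1$. (iii) It has a finite forward maximal existence time $t_*$ (and therefore it is metrically incomplete). As $t\to t_*$, its smallest variable $f_k\to0$ with $f_k=O(\sqrt{t_*-t})$.
   Context: An $\mathrm{SU}(3)$-invariant steady Laplacian soliton on $I\times \mathrm{SU}(3)/T^2$ is (up to discrete symmetries) given by functions $f_1,f_2,f_3:I\to(0,\infty)$, $u:I\to\mathbb{R}$ satisfying $2(f_1f_2f_3)'=\sum_i f_i^2$, $\;(\tau_i-uf_i^2)'=0$ for $i=1,2,3$, and $\sum_i\tau_i=u\sum_i f_i^2$, where $\tau_i:=(f_i^2)'+\frac{f_i^2}{f_1f_2f_3}\bigl(2f_i^2-\sum_jf_j^2\bigr)$. It corresponds to a closed invariant $G_2$-structure $\varphi$ with metric $dt^2+\sum f_i^2g_i$ ($g_i$ the invariant metrics on the irreducible summands of the isotropy representation) and $X=u\,\partial_t$ with $\Delta_\varphi\varphi=\mathcal{L}_X\varphi$. Solutions are considered on their maximal forward interval of existence in $t$; $\{i,j,k\}=\{1,2,3\}$. The torsion-free cone is $f_1=f_2=f_3=\frac12t$.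 Asymptotically conical to it with rate $\nu<0$ means that the solution exists for all large $t$ and, after a translation in $t$, $f_i=\frac12t+O(t^{1+\nu})$ as $t\to\infty$ (with corresponding decay of derivatives). ''Generically'' rate $-1$: the rate is $-1$ except for static solutions (all $\tau_i=0$, $u=0$), which have rate $-4$. *)

(* Defs.v *)
From Stdlib Require Import Reals.
From Coquelicot Require Import Coquelicot.
Open Scope R_scope.

Inductive I3 : Set := i1 | i2 | i3.

Definition next (i : I3) : I3 :=
  match i with i1 => i2 | i2 => i3 | i3 => i1 end.

Definition sum3 (g : I3 -> R) : R := g i1 + g i2 + g i3.
Definition prod3 (g : I3 -> R) : R := g i1 * g i2 * g i3.

Definition in_interval (a T : Rbar) (t : R) : Prop := Rbar_lt a t /\ Rbar_lt t T.

Definition tau (f : I3 -> R -> R) (i : I3) (t : R) : R :=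
  Derive (fun s => f i s ^ 2) t
  + f i t ^ 2 / prod3 (fun j => f j t)
    * (2 * f i t ^ 2 - sum3 (fun j => f j t ^ 2)).

(** Values outside the open interval (a, T) are irrelevant.  Only the
    derivatives occurring in the equations are required to exist: the constants
    c_i = tau_i - u f_i^2 turn the system into a first-order one with
    u = - (1/3) sum_i c_i / f_i^2, so that f and u are automatically smooth. *)
Definition steady_soliton (f : I3 -> R -> R) (u : R -> R) (a T : Rbar) : Prop :=
  Rbar_lt a T /\
  forall t : R, in_interval a T t ->
    (forall i, 0 < f i t) /\
    (forall i, ex_derive (f i) t) /\
    2 * Derive (fun s => prod3 (fun i => f i s)) t = sum3 (fun i => f i t ^ 2) /\
    (forall i, is_derive (fun s => tau f i s - u s * f i s ^ 2) t 0) /\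
    sum3 (fun i => tau f i t) = u t * sum3 (fun i => f i t ^ 2).

Definition forward_maximal (f : I3 -> R -> R) (u : R -> R) (a T : Rbar) : Prop :=
  forall (T' : Rbar) (g : I3 -> R -> R) (w : R -> R),
    Rbar_lt T T' -> steady_soliton g w a T' ->
    ~ (forall t : R, in_interval a T t -> (forall i, g i t = f i t) /\ w t = u t).

Definition static (f : I3 -> R -> R) (u : R -> R) (a T : Rbar) : Prop :=
  forall t : R, in_interval a T t -> (forall i, tau f i t = 0) /\ u t = 0.

(** Rate nu: f_i (t + c) = t/2 + O(t^(1+nu)), and the m-th derivative of the
    difference is O(t^(1+nu-m)) for every m. *)
Definition AC_with_rate (f : I3 -> R -> R) (T : Rbar) (nu : R) : Prop :=
  nu < 0 /\ T = p_infty /\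
  exists c : R, forall (i : I3) (m : nat), exists K : R,
    Rbar_locally p_infty (fun t =>
      ex_derive_n (fun s => f i (s + c) - s / 2) m t /\
      Rabs (Derive_n (fun s => f i (s + c) - s / 2) m t)
        <= K * Rpower t (1 + nu - INR m)).

Definition grows_exponentially (h : R -> R) : Prop :=
  exists lambda C1 C2 : R, 0 < lambda /\ 0 < C1 /\
    Rbar_locally p_infty (fun t =>
      C1 * exp (lambda * t) <= h t <= C2 * exp (lambda * t)).

Definition sum3C (g : I3 -> C) : C := (g i1 + g i2 + g i3)%C.

Definition det3 (A : I3 -> I3 -> C) : C :=
  sum3C (fun k => A i1 k * (A i2 (next k) * A i3 (next (next k))
                          - A i2 (next (next k)) * A i3 (next k)))%C.

Definition SU3 (A : I3 -> I3 -> C) : Prop :=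
  (forall j, sum3C (fun l => Cconj (A l j) * A l j)%C = RtoC 1) /\
  (forall j k, j <> k -> sum3C (fun l => Cconj (A l j) * A l k)%C = RtoC 0) /\
  det3 A = RtoC 1.

(** For a curve A in SU(3) with velocity A', omega = A^* A'.  Its three
    off-diagonal entries are the components, in the three summands of the
    isotropy representation, of the velocity of the projected curve A T^2. *)
Definition omega (A A' : I3 -> I3 -> C) (j k : I3) : C :=
  sum3C (fun l => Cconj (A l j) * A' l k)%C.

(** The normalisation g_i = 4 |omega_jk|^2 makes dt^2 + (t^2/4) (g_1 + g_2 + g_3)
    Ricci-flat: on SU(3)/T^2, sum |omega_jk|^2 is -1/12 of the Killing form
    and has Einstein constant 5. *)
Definition g_norm2 (i : I3) (A A' : I3 -> I3 -> C) : R :=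
  4 * Cmod (omega A A' (next i) (next (next i))) ^ 2.

Definition speed (f : I3 -> R -> R) (r r' : R)
  (A A' : I3 -> I3 -> C) : R :=
  sqrt (r' ^ 2 + sum3 (fun i => f i r ^ 2 * g_norm2 i A A')).

(** The end t -> T is complete for dt^2 + sum_i f_i^2 g_i when every C^1 curve
    (r, A T^2) running out of it has infinite length.  As SU(3)/T^2 is compact,
    a curve runs out of the end exactly when r -> T.  Every C^1 curve in
    SU(3)/T^2 lifts to a C^1 curve A in SU(3). *)
Definition complete_end (f : I3 -> R -> R) (a T : Rbar) : Prop :=
  forall (r r' : R -> R) (A A' : R -> I3 -> I3 -> C),
    (forall s : R, 0 <= s ->
       in_interval a T (r s) /\ SU3 (A s) /\
       is_derive r s (r' s) /\ continuous r' s /\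
       forall j k,
         is_derive (K := R_AbsRing) (V := C_R_NormedModule)
           (fun x => A x j k) s (A' s j k) /\
         continuous (U := C_R_NormedModule) (fun x => A' x j k) s) ->
    is_lim r p_infty T ->
    is_lim (fun b => RInt (fun s => speed f (r s) (r' s) (A s) (A' s)) 0 b)
      p_infty p_infty.

Definition asymptotically_conical
  (f : I3 -> R -> R) (u : R -> R) (a T : Rbar) : Prop :=
  (static f u a T /\ AC_with_rate f T (-4)) \/
  (~ static f u a T /\ AC_with_rate f T (-1) /\
   forall nu : R, AC_with_rate f T nu -> -1 <= nu).

Definition exponential_end (f : I3 -> R -> R) (a T : Rbar) : Prop :=
  T = p_infty /\ complete_end f a T /\
  exists i j k : I3, i <> j /\ j <> k /\ k <> i /\
    (exists l : R, 0 < l /\ is_lim (f k) p_infty l) /\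
    grows_exponentially (f i) /\ grows_exponentially (f j) /\
    is_lim (fun t => f i t / f j t) p_infty 1.

Definition finite_time_end (f : I3 -> R -> R) (a T : Rbar) : Prop :=
  ~ complete_end f a T /\
  exists tstar : R, T = Finite tstar /\
  exists k : I3,
    at_left tstar (fun t => forall i, f k t <= f i t) /\
    filterlim (f k) (at_left tstar) (locally 0) /\
    exists K : R, at_left tstar (fun t => Rabs (f k t) <= K * sqrt (tstar - t)).

(* Main.v *)
(** The constants [c_i = tau_i - u f_i^2] add up to [0] and turn the system into
    a first-order one, with [u = - (1/3) sum c_i / f_i^2] and volume
    [p = f_1 f_2 f_3], [p' = (sum f_i^2) / 2].  The sign of [f_i^2 - f_j^2] changes at
    most once, so the order of the three functions is eventually constant; call
    them [x >= y >= z], with constants [a, b, c].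

    For the smallest one, [2 z z' >= z - C] with [C = |a| + |b| + |c|].

    - If the maximal time [T] is finite, Picard-Lindelof forces the solution out
      of every compact box.  While [z] is bounded below, so are the growth rates
      of [ln (x / z)] and [ln p] above; hence [z] is not bounded below, and
      [(z^2)' >= - C] gives [z^2 <= C (T - t)].
    - If [T] is infinite and [z > C] at some time, [z] grows linearly, and so does
      [x].  Since [(z^2 (x^2 - y^2))' = (a - b) z^2 + O(t)], the differences stay
      bounded (they are [O(t^-3)] when [c_i = 0]), and do not tend to zero unless
      [a = b]; the mean of [x, y, z] has velocity [1/2 + O(t^-2)].  The estimates
      pass to the derivatives by bootstrapping the equation.
    - If [T] is infinite and [z <= C] throughout, [p] grows exponentially, which
      makes [x / y - 1] decay exponentially.  Then [z' = (z + c/3) / z] up to an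
      exponentially small error; the rest point [- c/3] is repelling, so the
      bounded function [z] converges to it exponentially, and
      [(ln p)' = 1 / z + ...] integrates to the exact exponential rate. *)

Require Import Defs.
From Stdlib Require Import Reals Lra Psatz List Classical.
From Coquelicot Require Import Coquelicot.
Open Scope R_scope.

(** * Comparison lemmas *)

(** The formula for [u] comes from summing [tau_i / f_i^2]: the derivatives give [2 p' / p], the
    remaining terms [- (sum f_j^2) / p], and the volume equation cancels them, so
    [sum c_i / f_i^2 + 3 u = 0].

    Maximality speaks of extensions as solitons. Leaving a box therefore needs an actual extension:
    Picard iteration for a field truncated to a box, hence globally Lipschitz, an existence time
    uniform over the box, and a passage from the first-order system back to the soliton equations.

    The threshold [C] leaves no intermediate behaviour: once [z > C], [z] increases and never
    returns, so for infinite [T] either the growth is linear or [z] is trapped for ever.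

    The conical rate also bounds all derivatives, and estimates cannot be differentiated; hence the
    symbol classes, closed under the operations that build the field. Two-sided exponential bounds
    with a single rate need [ln p - t / l] bounded, so [z] must approach its limit [l] integrably
    fast; its mere convergence would not suffice.

    The three cases exclude each other because the third has finite [T], and a finite limit of one
    function contradicts linear growth. *)

Lemma Derive_eq (h : R -> R) (t d : R) : is_derive h t d -> Derive h t = d.
Proof. apply is_derive_unique. Qed.

Lemma derive_nonneg_le (h h' : R -> R) (s t : R) :
  s <= t -> (forall r, s <= r <= t -> is_derive h r (h' r)) ->
  (forall r, s <= r <= t -> 0 <= h' r) -> h s <= h t.
Proof.
  intros hst hd hp.
  destruct (MVT_gen h s t h') as [c [hc e]].
  - intros r. rewrite Rmin_left, Rmax_right by lra. intros; apply hd; lra.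
  - intros r. rewrite Rmin_left, Rmax_right by lra. intros.
    apply continuity_pt_filterlim, (ex_derive_continuous h); eexists; apply hd; lra.
  - rewrite Rmin_left, Rmax_right in hc by lra.
    specialize (hp c hc). nra.
Qed.

Lemma derive_bound_le (h h' : R -> R) (k s t : R) :
  s <= t -> (forall r, s <= r <= t -> is_derive h r (h' r)) ->
  (forall r, s <= r <= t -> h' r <= k) -> h t <= h s + k * (t - s).
Proof.
  intros hst hd hp.
  assert (H : k * s - h s <= k * t - h t).
  { apply (derive_nonneg_le (fun r => k * r - h r) (fun r => k - h' r)); auto.
    - intros r hr. auto_derive. eexists; apply hd; auto.
      change (Derive (fun x => h x) r) with (Derive h r).
      rewrite (is_derive_unique _ _ _ (hd r hr)). ring.
    - intros r hr. specialize (hp r hr). lra. }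
  lra.
Qed.

Lemma derive_zero_const (h : R -> R) (s t : R) :
  s <= t -> (forall r, s <= r <= t -> is_derive h r 0) -> h s = h t.
Proof.
  intros hst hd. apply Rle_antisym.
  - apply (derive_nonneg_le h (fun _ => 0)); auto; intros; lra.
  - generalize (derive_bound_le h (fun _ => 0) 0 s t hst hd). intros H.
    enough (h t <= h s + 0 * (t - s)) by lra. apply H; intros; lra.
Qed.

(** Integrating factor: [D] times the exponential of minus the integral of [E] is nondecreasing on
    [[s, t]]. The larger open interval [(lo, hi)] gives that integral a two-sided derivative at the
    endpoints too. *)
Lemma linear_comparison_nonneg (D D' E : R -> R) (lo hi s t : R) :
  lo < s -> s <= t -> t < hi ->
  (forall r, lo < r < hi -> is_derive D r (D' r)) ->
  (forall r, lo < r < hi -> continuous E r) ->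
  (forall r, s <= r <= t -> E r * D r <= D' r) ->
  0 <= D s -> 0 <= D t.
Proof.
  intros h1 h2 h3 hD hE hineq h0.
  assert (hI : forall r, lo < r < hi -> is_derive (fun r => RInt E s r) r (E r)).
  { intros r hr. apply is_derive_RInt with s.
    - assert (he : 0 < Rmin (r - lo) (hi - r)) by (apply Rmin_pos; lra).
      exists (mkposreal _ he). intros y hy.
      apply RInt_correct, ex_RInt_continuous. intros w hw.
      apply hE.
      unfold ball in hy; simpl in hy; unfold AbsRing_ball, abs, minus, plus, opp in hy; simpl in hy.
      generalize (Rmin_l (r - lo) (hi - r)) (Rmin_r (r - lo) (hi - r)); intros.
      apply Rabs_def2 in hy.
      unfold Rmin, Rmax in hw; destruct (Rle_dec s y); lra.
    - apply hE; auto. }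
  assert (H : D s * exp (- RInt E s s) <= D t * exp (- RInt E s t)).
  { apply (derive_nonneg_le (fun r => D r * exp (- RInt E s r))
            (fun r => (D' r - E r * D r) * exp (- RInt E s r))); auto.
    - intros r hr.
      assert (hr' : lo < r < hi) by lra.
      specialize (hI r hr'). specialize (hD r hr').
      evar_last.
      { apply (is_derive_mult D (fun r => exp (- RInt E s r))).
        - apply hD.
        - apply (is_derive_comp exp (fun r => - RInt E s r)).
          + apply is_derive_exp.
          + apply (is_derive_opp (fun r => RInt E s r)). apply hI.
        - intros; apply Rmult_comm. }
      unfold plus, mult, opp, scal; simpl. unfold mult; simpl. ring.
    - intros r hr. apply Rmult_le_pos; [|left; apply exp_pos].
      specialize (hineq r hr). lra. }
  generalize (exp_pos (- RInt E s s)) (exp_pos (- RInt E s t)); intros.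
  assert (0 <= D t * exp (- RInt E s t)) by nra.
  destruct (Rle_lt_dec 0 (D t)); auto. nra.
Qed.

(** Apply the previous comparison to [D - D s * exp (k * (r - s))]: since [k <= E] and the
    subtracted term is nonnegative, its derivative is at most [E] times that term. *)
Lemma linear_comparison_exp (D D' E : R -> R) (k lo hi s t : R) :
  lo < s -> s <= t -> t < hi ->
  (forall r, lo < r < hi -> is_derive D r (D' r)) ->
  (forall r, lo < r < hi -> continuous E r) ->
  (forall r, s <= r <= t -> E r * D r <= D' r) ->
  (forall r, s <= r <= t -> k <= E r) ->
  0 <= D s -> D s * exp (k * (t - s)) <= D t.
Proof.
  intros h1 h2 h3 hD hE hineq hk h0.
  enough (0 <= D t - D s * exp (k * (t - s))) by lra.
  apply (linear_comparison_nonneg (fun r => D r - D s * exp (k * (r - s)))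
    (fun r => D' r - D s * (k * exp (k * (r - s)))) E lo hi s t); auto.
  - intros r hr. specialize (hD r hr). auto_derive.
    + eexists; apply hD.
    + change (Derive (fun x => D x) r) with (Derive D r).
      rewrite (is_derive_unique _ _ _ hD). ring_simplify. reflexivity.
  - intros r hr. specialize (hineq r hr). specialize (hk r hr).
    generalize (exp_pos (k * (r - s))); intros. 
    assert (0 <= D s * exp (k * (r - s))) by (apply Rmult_le_pos; lra).
    nra.
  - replace (s - s) with 0 by ring. rewrite Rmult_0_r, exp_0. lra.
Qed.

(** The witness is an informative [{l | ...}] rather than an [exists], so that [geometric_limit] can
    be projected at each time to define the Picard limit as a function. *)
Lemma limit_of_trapped (A : Type) (P : A -> Prop) (lo hi : A -> R) (a0 : A) :
  P a0 -> (forall s t, P s -> P t -> lo s <= hi t) ->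
  {l | forall t, P t -> lo t <= l <= hi t}.
Proof.
  intros H0 H.
  destruct (completeness (fun v => exists s, P s /\ v = lo s)) as [l [hub hl]].
  - exists (hi a0). intros v [s [hs ->]]. apply H; auto.
  - exists (lo a0), a0. split; [auto|auto].
  - exists l. intros t ht. split.
    + apply hub. exists t; auto.
    + apply hl. intros v [s [hs ->]]. auto.
Qed.

(* The primitive [g] of the bound traps [h] between [h - g] and [h + g]. *)
Lemma limit_of_derive_bound (h h' g g' : R -> R) (t0 : R) :
  (forall t, t0 <= t -> is_derive h t (h' t)) ->
  (forall t, t0 <= t -> is_derive g t (- g' t)) ->
  (forall t, t0 <= t -> 0 <= g t) ->
  (forall t, t0 <= t -> Rabs (h' t) <= g' t) ->
  exists l, forall t, t0 <= t -> Rabs (h t - l) <= g t.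
Proof.
  intros hh hg hpos hb.
  assert (up : forall s t, t0 <= s <= t -> h t + g t <= h s + g s).
  { intros s t hst.
    enough (- (h s + g s) <= - (h t + g t)) by lra.
    apply (derive_nonneg_le (fun r => - (h r + g r)) (fun r => - (h' r + - g' r))).
    - lra.
    - intros r hr. apply (is_derive_opp (fun r => h r + g r)).
      apply (is_derive_plus h g); [apply hh|apply hg]; lra.
    - intros r hr. assert (t0 <= r) by lra. specialize (hb r H).
      apply Rabs_le_between in hb. lra. }
  assert (dn : forall s t, t0 <= s <= t -> h s - g s <= h t - g t).
  { intros s t hst.
    apply (derive_nonneg_le (fun r => h r - g r) (fun r => h' r - - g' r)).
    - lra.
    - intros r hr.
      apply (is_derive_minus h g); [apply hh|apply hg]; lra.
    - intros r hr. assert (t0 <= r) by lra. specialize (hb r H).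
      apply Rabs_le_between in hb. lra. }
  destruct (limit_of_trapped R (fun t => t0 <= t) (fun t => h t - g t) (fun t => h t + g t) t0) as [l hl].
  - lra.
  - intros s t hs ht. destruct (Rle_lt_dec s t).
    + generalize (dn s t (conj hs r)) (hpos t ht). lra.
    + generalize (up t s ltac:(lra)) (hpos s hs). lra.
  - exists l. intros t ht. specialize (hl t ht). apply Rabs_le_between. lra.
Qed.

(** * Picard iteration *)

(** The intervals of radius [2 e / 2^n] around [v n] are nested: the radius drops by [e / 2^n] at
    each step, which is the most that the centre can move. *)
Lemma geometric_limit (v : nat -> R) (e : R) :
  0 <= e -> (forall n, Rabs (v (S n) - v n) <= e * (1/2)^n) ->
  {l | forall n, Rabs (v n - l) <= 2 * e * (1/2)^n}.
Proof.
  intros he hv.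
  assert (hp : forall n, 0 < (1/2)^n) by (intros; apply pow_lt; lra).
  assert (step : forall n, v n - 2 * e * (1/2)^n <= v (S n) - 2 * e * (1/2)^(S n) /\
                   v (S n) + 2 * e * (1/2)^(S n) <= v n + 2 * e * (1/2)^n).
  { intros n. specialize (hv n). apply Rabs_le_between in hv. specialize (hp n). simpl. nra. }
  assert (mono : forall n k, v n - 2 * e * (1/2)^n <= v (k + n)%nat - 2 * e * (1/2)^(k + n)%nat /\
                   v (k + n)%nat + 2 * e * (1/2)^(k + n)%nat <= v n + 2 * e * (1/2)^n).
  { intros n k. induction k; simpl Nat.add; [split; lra|]. specialize (step (k + n)%nat). lra. }
  destruct (limit_of_trapped nat (fun _ => True) (fun n => v n - 2 * e * (1/2)^n)
    (fun n => v n + 2 * e * (1/2)^n) O) as [l hl]; auto.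
  - intros s t _ _.
    assert (hst : forall n, 0 <= 2 * e * (1/2)^n) by (intros n; specialize (hp n); nra).
    destruct (Nat.le_ge_cases s t) as [h|h].
    + destruct (mono s (t - s)%nat) as [m1 m2].
      rewrite Nat.sub_add in m1, m2 by assumption. specialize (hst t). lra.
    + destruct (mono t (s - t)%nat) as [m1 m2].
      rewrite Nat.sub_add in m1, m2 by assumption. specialize (hst s). lra.
  - exists l. intros n. specialize (hl n I). apply Rabs_le_between. lra.
Qed.

Lemma lipschitz_continuous (h : R -> R) (k : R) :
  0 <= k -> (forall s t, Rabs (h s - h t) <= k * Rabs (s - t)) ->
  forall t, continuous h t.
Proof.
  intros hk hl t. apply continuity_pt_filterlim.
  intros eps heps. exists (eps / (k + 1)). split.
  - apply Rdiv_lt_0_compat; lra.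
  - intros s [_ hs]. unfold R_dist in *. simpl in *. unfold Rdist in *.
    apply Rle_lt_trans with (1 := hl s t).
    apply Rle_lt_trans with (k * (eps / (k + 1))).
    + apply Rmult_le_compat_l; lra.
    + apply Rlt_le_trans with ((k + 1) * (eps / (k + 1))); [|right; field; lra].
      apply Rmult_lt_compat_r; [apply Rdiv_lt_0_compat|]; lra.
Qed.

Lemma ex_RInt_of_continuous (h : R -> R) :
  (forall r, continuous h r) -> forall a b, ex_RInt h a b.
Proof. intros hc a b. apply (ex_RInt_continuous (V := R_CompleteNormedModule)). auto. Qed.

Definition dist3 (v w : I3 -> R) : R := sum3 (fun i => Rabs (v i - w i)).

Lemma dist3_ge (v w : I3 -> R) (i : I3) : Rabs (v i - w i) <= dist3 v w.
Proof.
  unfold dist3, sum3.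
  generalize (Rabs_pos (v i1 - w i1)) (Rabs_pos (v i2 - w i2)) (Rabs_pos (v i3 - w i3)).
  destruct i; lra.
Qed.

Lemma dist3_le (v w : I3 -> R) (e : R) :
  (forall i, Rabs (v i - w i) <= e) -> dist3 v w <= 3 * e.
Proof.
  intros H. unfold dist3, sum3.
  generalize (H i1) (H i2) (H i3). lra.
Qed.

Lemma RInt_abs_le (h : R -> R) (k s t : R) :
  (forall r, continuous h r) -> (forall r, Rmin s t <= r <= Rmax s t -> Rabs (h r) <= k) ->
  Rabs (RInt h s t) <= k * Rabs (s - t).
Proof.
  intros hc hb.
  assert (ex : forall a b, ex_RInt h a b) by (apply ex_RInt_of_continuous; auto).
  destruct (Rle_lt_dec s t) as [hst|hst].
  - rewrite Rmin_left, Rmax_right in hb by lra.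
    rewrite (Rabs_left1 (s - t)) by lra.
    generalize (abs_RInt_le_const h s t k hst (ex s t) hb). lra.
  - rewrite Rmin_right, Rmax_left in hb by lra.
    rewrite (Rabs_right (s - t)) by lra.
    rewrite <- (opp_RInt_swap h t s (ex t s)). unfold opp; simpl. rewrite Rabs_Ropp.
    generalize (abs_RInt_le_const h t s k ltac:(lra) (ex t s) hb). lra.
Qed.

Definition picard_step (Phi : I3 -> (I3 -> R) -> R) (t0 : R) (v0 : I3 -> R)
  (Y : I3 -> R -> R) (i : I3) (t : R) : R :=
  v0 i + RInt (fun s => Phi i (fun j => Y j s)) t0 t.

Fixpoint picard_iter (Phi : I3 -> (I3 -> R) -> R) (t0 : R) (v0 : I3 -> R) (n : nat)
  : I3 -> R -> R :=
  match n with
  | O => fun i _ => v0 i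
  | S m => picard_step Phi t0 v0 (picard_iter Phi t0 v0 m)
  end.

(** The bounds are global: with a truncated field no iterate can leave the region where the
    estimates hold. *)
Definition bounded_lipschitz (B L : R) (Phi : I3 -> (I3 -> R) -> R) : Prop :=
  forall i, (forall v, Rabs (Phi i v) <= B) /\
            (forall v w, Rabs (Phi i v - Phi i w) <= L * dist3 v w).

Definition curve_lipschitz (B : R) (Y : I3 -> R -> R) : Prop :=
  forall i s t, Rabs (Y i s - Y i t) <= B * Rabs (s - t).

Lemma field_along_curve_continuous Phi B L Y i :
  0 <= B -> 0 <= L -> bounded_lipschitz B L Phi -> curve_lipschitz B Y ->
  forall s, continuous (fun r => Phi i (fun j => Y j r)) s.
Proof.
  intros hB hL hPhi hY.
  apply (lipschitz_continuous _ (L * (3 * B))).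
  - nra.
  - intros s t. apply Rle_trans with (1 := proj2 (hPhi i) _ _).
    rewrite Rmult_assoc. apply Rmult_le_compat_l; auto.
    rewrite Rmult_assoc. apply dist3_le. intros j. apply hY.
Qed.

Lemma picard_step_lipschitz Phi B L t0 v0 Y :
  0 <= B -> 0 <= L -> bounded_lipschitz B L Phi -> curve_lipschitz B Y ->
  curve_lipschitz B (picard_step Phi t0 v0 Y).
Proof.
  intros hB hL hPhi hY i s t. unfold picard_step.
  pose proof (field_along_curve_continuous Phi B L Y i hB hL hPhi hY) as hc.
  set (h := fun r => Phi i (fun j => Y j r)) in *.
  assert (ex : forall a b, ex_RInt h a b) by (apply ex_RInt_of_continuous; auto).
  assert (hch : RInt h t0 s = RInt h t0 t + RInt h t s)
    by (symmetry; apply (RInt_Chasles h t0 t s); auto).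
  change (Rabs (v0 i + RInt h t0 s - (v0 i + RInt h t0 t)) <= B * Rabs (s - t)).
  replace (v0 i + RInt h t0 s - (v0 i + RInt h t0 t)) with (RInt h t s) by lra.
  rewrite (Rabs_minus_sym s t). apply RInt_abs_le; auto.
  intros. apply (proj1 (hPhi i)).
Qed.

(** The 6 in the hypothesis on [d]: the distance [dist3] sums three coordinates, and the contraction
    factor aimed at is 1/2. *)
Lemma picard_step_contract Phi B L t0 v0 Y Z d e :
  0 <= B -> 0 <= L -> bounded_lipschitz B L Phi ->
  curve_lipschitz B Y -> curve_lipschitz B Z ->
  6 * L * d <= 1 -> 0 <= e ->
  (forall i t, Rabs (t - t0) <= d -> Rabs (Y i t - Z i t) <= e) ->
  forall i t, Rabs (t - t0) <= d ->
    Rabs (picard_step Phi t0 v0 Y i t - picard_step Phi t0 v0 Z i t) <= e / 2.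
Proof.
  intros hB hL hPhi hY hZ hd he hYZ i t ht. unfold picard_step.
  pose proof (field_along_curve_continuous Phi B L Y i hB hL hPhi hY) as hcY.
  pose proof (field_along_curve_continuous Phi B L Z i hB hL hPhi hZ) as hcZ.
  set (g := fun r => Phi i (fun j => Y j r)) in *.
  set (h := fun r => Phi i (fun j => Z j r)) in *.
  assert (exg : forall a b, ex_RInt g a b) by (apply ex_RInt_of_continuous; auto).
  assert (exh : forall a b, ex_RInt h a b) by (apply ex_RInt_of_continuous; auto).
  change (Rabs (v0 i + RInt g t0 t - (v0 i + RInt h t0 t)) <= e / 2).
  assert (hm : RInt (fun r => minus (g r) (h r)) t0 t = RInt g t0 t - RInt h t0 t)
    by (apply (RInt_minus g h); auto).
  replace (v0 i + RInt g t0 t - (v0 i + RInt h t0 t)) with (RInt (fun r => minus (g r) (h r)) t0 t)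
    by (lra).
  apply Rle_trans with (L * (3 * e) * Rabs (t0 - t)).
  - apply RInt_abs_le.
    + intros r. apply (continuous_minus g h); auto.
    + intros r hr. change (minus (g r) (h r)) with (g r - h r).
      apply Rle_trans with (1 := proj2 (hPhi i) _ _).
      apply Rmult_le_compat_l; auto. apply dist3_le. intros j. apply hYZ.
      apply Rabs_le_between in ht. apply Rabs_le_between.
      unfold Rmin, Rmax in hr. destruct (Rle_dec t0 t); lra.
  - rewrite Rabs_minus_sym. 
    generalize (Rabs_pos (t - t0)); intros.
    assert (0 <= L * Rabs (t - t0)) by (apply Rmult_le_pos; auto).
    assert (L * Rabs (t - t0) <= L * d) by (apply Rmult_le_compat_l; auto).
    nra.
Qed.

Definition clamp (lo hi x : R) : R := Rmax lo (Rmin hi x).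

Lemma clamp_lipschitz lo hi x y : Rabs (clamp lo hi x - clamp lo hi y) <= Rabs (x - y).
Proof.
  unfold clamp, Rmax, Rmin.
  destruct (Rle_dec hi x), (Rle_dec hi y);
    repeat destruct Rle_dec; apply Rabs_le_between;
    unfold Rabs; destruct Rcase_abs; lra.
Qed.

Lemma clamp_id lo hi x : lo <= x <= hi -> clamp lo hi x = x.
Proof. intros. unfold clamp. rewrite Rmin_right, Rmax_right; lra. Qed.

Lemma clamp_bounds lo hi x : lo <= hi -> lo <= clamp lo hi x <= hi.
Proof. intros. unfold clamp, Rmax, Rmin. repeat destruct Rle_dec; lra. Qed.

Lemma picard_local_existence (Phi : I3 -> (I3 -> R) -> R) (B L t0 : R) (v0 : I3 -> R) :
  0 < B -> 0 < L -> bounded_lipschitz B L Phi ->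
  exists Y : I3 -> R -> R, forall i,
    Y i t0 = v0 i /\
    forall t, Rabs (t - t0) < / (6 * L) ->
      Rabs (Y i t - v0 i) <= B * Rabs (t - t0) /\
      is_derive (Y i) t (Phi i (fun j => Y j t)).
Proof.
  intros hB hL hPhi.
  set (d := / (6 * L)).
  assert (hd : 0 < d) by (apply Rinv_0_lt_compat; lra).
  assert (hLd : 6 * L * d <= 1) by (right; unfold d; field; lra).
  set (It := picard_iter Phi t0 v0).
  assert (hlip : forall n, curve_lipschitz B (It n)).
  { induction n.
    - intros i s t. unfold It; simpl. rewrite Rminus_diag, Rabs_R0.
      apply Rmult_le_pos; [lra|apply Rabs_pos].
    - apply (picard_step_lipschitz Phi B L); auto; lra. }
  assert (hI0 : forall n i, It n i t0 = v0 i).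
  { intros [|n] i; unfold It; simpl; auto. unfold picard_step.
    rewrite RInt_point. unfold zero; simpl. ring. }
  assert (hstep : forall n i t, Rabs (t - t0) <= d ->
     Rabs (It (S n) i t - It n i t) <= B * d * (1/2)^n).
  { induction n; intros i t ht.
    - change (It O i t) with (v0 i). rewrite <- (hI0 1%nat i).
      apply Rle_trans with (1 := hlip 1%nat i t t0). simpl. nra.
    - apply Rle_trans with ((B * d * (1/2)^n) / 2); [|right; simpl; field].
      apply (picard_step_contract Phi B L t0 v0 (It (S n)) (It n) d); auto; try lra.
      apply Rmult_le_pos; [nra|apply pow_le; lra]. }
  (* The contraction controls only times within [d] of [t0]. Evaluating the iterates at the clamped
     time gives a limit curve on the whole line, which is [B]-Lipschitz everywhere because clamping
     is 1-Lipschitz. *)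
  set (cl := clamp (t0 - d) (t0 + d)).
  assert (hcl : forall t, Rabs (cl t - t0) <= d).
  { intros t. generalize (clamp_bounds (t0 - d) (t0 + d) t ltac:(lra)).
    intros; apply Rabs_le_between. fold cl in H. lra. }
  assert (hBd : 0 <= B * d) by nra.
  set (Y := fun i t => proj1_sig (geometric_limit (fun n => It n i (cl t)) (B * d) hBd
              (fun n => hstep n i (cl t) (hcl t)))).
  assert (hY : forall i t n, Rabs (It n i (cl t) - Y i t) <= 2 * (B * d) * (1/2)^n).
  { intros i t. unfold Y. destruct geometric_limit as [l hl]; simpl. exact hl. }
  assert (hcid : forall t, Rabs (t - t0) <= d -> cl t = t).
  { intros t ht. apply clamp_id. apply Rabs_le_between in ht. lra. }
  assert (small : forall v K : R, 0 <= K -> (forall n, Rabs v <= K * (1/2)^n) -> v = 0).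
  { intros v K hK H. destruct (Req_dec v 0) as [|hv]; auto. exfalso.
    assert (0 < Rabs v) by (apply Rabs_pos_lt; auto).
    destruct (pow_lt_1_zero (1/2) ltac:(rewrite Rabs_right; lra) (Rabs v / (K + 1)))
      as [n hn].
    { apply Rdiv_lt_0_compat; lra. }
    specialize (hn n (le_n n)). specialize (H n).
    rewrite Rabs_right in hn by (apply Rle_ge, pow_le; lra).
    assert (K * (1/2)^n <= K * (Rabs v / (K + 1))) by (apply Rmult_le_compat_l; lra).
    assert (K * (Rabs v / (K + 1)) < (K + 1) * (Rabs v / (K + 1)))
      by (apply Rmult_lt_compat_r; [apply Rdiv_lt_0_compat|]; lra).
    assert ((K + 1) * (Rabs v / (K + 1)) = Rabs v) by (field; lra). lra. }
  assert (hYlip : curve_lipschitz B Y).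
  { intros i s t.
    destruct (Rle_lt_dec (Rabs (Y i s - Y i t)) (B * Rabs (s - t))) as [|hlt]; auto. exfalso.
    enough (Rabs (Y i s - Y i t) - B * Rabs (s - t) = 0) by lra.
    apply (small _ (4 * (B * d))); [lra|]. intros n. rewrite Rabs_right by lra.
    generalize (hY i s n) (hY i t n) (hlip n i (cl s) (cl t))
      (clamp_lipschitz (t0 - d) (t0 + d) s t); fold cl; intros h1 h2 h3 h4.
    assert (B * Rabs (cl s - cl t) <= B * Rabs (s - t)) by (apply Rmult_le_compat_l; lra).
    generalize (Rabs_triang (Y i s - It n i (cl s)) (It n i (cl s) - It n i (cl t)))
      (Rabs_triang (Y i s - It n i (cl s) + (It n i (cl s) - It n i (cl t))) (It n i (cl t) - Y i t)).
    rewrite (Rabs_minus_sym (Y i s)).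
    replace (Y i s - It n i (cl s) + (It n i (cl s) - It n i (cl t)) + (It n i (cl t) - Y i t))
      with (Y i s - Y i t) by ring. lra. }
  (* For every [n], both [Y] and its Picard image are within a constant times [(1/2)^n] of the
     iterate of index [S n]. *)
  assert (hfix : forall i t, Rabs (t - t0) <= d -> Y i t = picard_step Phi t0 v0 Y i t).
  { intros i t ht. apply Rminus_diag_uniq.
    apply (small _ (2 * (B * d))); [lra|]. intros n.
    assert (h1 := hY i t (S n)). rewrite (hcid t ht) in h1.
    assert (h2 : Rabs (It (S n) i t - picard_step Phi t0 v0 Y i t) <= (2 * (B * d) * (1/2)^n) / 2).
    { apply (picard_step_contract Phi B L t0 v0 (It n) Y d); auto; try lra.
      - apply Rmult_le_pos; [lra|apply pow_le; lra].
      - intros j s hs. rewrite <- (hcid s hs) at 1. apply hY. }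
    generalize (Rabs_triang (Y i t - It (S n) i t) (It (S n) i t - picard_step Phi t0 v0 Y i t)).
    rewrite (Rabs_minus_sym (Y i t)).
    replace (Y i t - It (S n) i t + (It (S n) i t - picard_step Phi t0 v0 Y i t))
      with (Y i t - picard_step Phi t0 v0 Y i t) by ring.
    simpl in h1, h2. simpl. lra. }
  exists Y. intros i.
  assert (hYt0 : Y i t0 = v0 i).
  { rewrite hfix. unfold picard_step. rewrite RInt_point. apply Rplus_0_r.
    rewrite Rminus_diag, Rabs_R0; lra. }
  split; auto. intros t ht. split.
  { rewrite <- hYt0. apply hYlip. }
  pose proof (field_along_curve_continuous Phi B L Y i ltac:(lra) ltac:(lra) hPhi hYlip) as hc.
  apply (is_derive_ext_loc (picard_step Phi t0 v0 Y i)).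
  - assert (he : 0 < d - Rabs (t - t0)) by lra.
    exists (mkposreal _ he). intros s hs. symmetry. apply hfix.
    unfold ball in hs; simpl in hs; unfold AbsRing_ball, abs, minus, plus, opp in hs; simpl in hs.
    generalize (Rabs_triang (s + - t) (t - t0)).
    replace (s + - t + (t - t0)) with (s - t0) by ring. lra.
  - unfold picard_step. evar_last.
    { apply (is_derive_plus (fun _ => v0 i) (fun t => RInt (fun s => Phi i (fun j => Y j s)) t0 t)).
      - apply is_derive_const.
      - apply is_derive_RInt with t0.
        + apply filter_forall. intros s. apply (RInt_correct (V := R_CompleteNormedModule)), ex_RInt_of_continuous. auto.
        + auto. }
    unfold plus, zero; simpl; ring.
Qed.

(** Gronwall for the sum [E] of squared differences: the field contributes at most [2 L D^2], with
    [D] the sum of absolute differences, and [D^2 <= 3 E]; hence the rate [6 L]. *)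
Lemma ode_uniqueness (Phi : I3 -> (I3 -> R) -> R) (L s t : R) (Y Z : I3 -> R -> R) :
  0 <= L -> s <= t ->
  (forall i v w, Rabs (Phi i v - Phi i w) <= L * dist3 v w) ->
  (forall i r, s <= r <= t -> is_derive (Y i) r (Phi i (fun j => Y j r))) ->
  (forall i r, s <= r <= t -> is_derive (Z i) r (Phi i (fun j => Z j r))) ->
  (forall i, Y i s = Z i s) -> forall i, Y i t = Z i t.
Proof.
  intros hL hst hPhi hY hZ h0 i.
  set (E := fun r => sum3 (fun i => (Y i r - Z i r)^2)).
  set (F := fun i r => Phi i (fun j => Y j r) - Phi i (fun j => Z j r)).
  set (E' := fun r => sum3 (fun i => 2 * (Y i r - Z i r) * F i r)).
  assert (hE : forall r, s <= r <= t -> is_derive E r (E' r)).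
  { intros r hr.
    assert (hj : forall j, is_derive (fun r => (Y j r - Z j r)^2) r (2 * (Y j r - Z j r) * F j r)).
    { intros j. auto_derive.
      - split; [|split; [|exact I]]; eexists; [apply hY|apply hZ]; auto.
      - change (Derive (fun x => Y j x) r) with (Derive (Y j) r).
        change (Derive (fun x => Z j x) r) with (Derive (Z j) r).
        rewrite (is_derive_unique _ _ _ (hY j r hr)), (is_derive_unique _ _ _ (hZ j r hr)).
        unfold F. ring. }
    unfold E, E', sum3.
    apply (is_derive_plus (fun r => (Y i1 r - Z i1 r)^2 + (Y i2 r - Z i2 r)^2)
       (fun r => (Y i3 r - Z i3 r)^2)); auto.
    apply (is_derive_plus (fun r => (Y i1 r - Z i1 r)^2) (fun r => (Y i2 r - Z i2 r)^2)); auto. }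
  assert (hE' : forall r, E' r <= 6 * L * E r).
  { intros r.
    set (D := dist3 (fun j => Y j r) (fun j => Z j r)).
    assert (hj : forall j, 2 * (Y j r - Z j r) * F j r <= 2 * Rabs (Y j r - Z j r) * (L * D)).
    { intros j. apply Rle_trans with (1 := Rle_abs _).
      rewrite !Rabs_mult, (Rabs_right 2) by lra.
      apply Rmult_le_compat_l; [generalize (Rabs_pos (Y j r - Z j r)); lra|apply hPhi]. }
    apply Rle_trans with (2 * L * D^2).
    - unfold E', sum3. generalize (hj i1) (hj i2) (hj i3).
      assert (hD : D = Rabs (Y i1 r - Z i1 r) + Rabs (Y i2 r - Z i2 r) + Rabs (Y i3 r - Z i3 r))
        by reflexivity.
      replace (2 * L * D^2) with (2 * L * D *
        (Rabs (Y i1 r - Z i1 r) + Rabs (Y i2 r - Z i2 r) + Rabs (Y i3 r - Z i3 r)))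
        by (rewrite <- hD; ring).
      lra.
    - unfold E, sum3. rewrite <- !(pow2_abs (Y _ r - Z _ r)).
      unfold D, dist3, sum3.
      set (p := Rabs _). set (q := Rabs (Y i2 r - Z i2 r)). set (w := Rabs (Y i3 r - Z i3 r)).
      assert (0 <= L * ((p - q)^2 + (q - w)^2 + (w - p)^2)).
      { apply Rmult_le_pos; auto. generalize (pow2_ge_0 (p-q)) (pow2_ge_0 (q-w)) (pow2_ge_0 (w-p)). lra. }
      nra. }
  assert (hEdef : forall r, E r = sum3 (fun i => (Y i r - Z i r)^2)) by reflexivity.
  clearbody E E'.
  assert (H : - (E s * exp (- (6 * L) * s)) <= - (E t * exp (- (6 * L) * t))).
  { apply (derive_nonneg_le (fun r => - (E r * exp (- (6 * L) * r)))
      (fun r => (6 * L * E r - E' r) * exp (- (6 * L) * r))); auto.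
    - intros r hr. auto_derive.
      + exists (E' r); apply hE; auto.
      + change (Derive (fun x => E x) r) with (Derive E r).
        rewrite (is_derive_unique _ _ _ (hE r hr)). ring.
    - intros r hr. apply Rmult_le_pos; [|left; apply exp_pos]. specialize (hE' r). lra. }
  assert (hEs : E s = 0).
  { rewrite hEdef. unfold sum3. rewrite !h0. ring. }
  rewrite hEs, Rmult_0_l, Ropp_0 in H.
  assert (hEt : E t <= 0).
  { generalize (exp_pos (- (6 * L) * t)); intros.
    destruct (Rle_lt_dec (E t) 0); auto. nra. }
  rewrite hEdef in hEt. unfold sum3 in hEt.
  assert (hsq : (Y i t - Z i t)^2 = 0).
  { generalize (pow2_ge_0 (Y i1 t - Z i1 t)) (pow2_ge_0 (Y i2 t - Z i2 t)) (pow2_ge_0 (Y i3 t - Z i3 t)).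
    destruct i; lra. }
  assert (Y i t - Z i t = 0) by nra. lra.
Qed.

(** * The first-order system *)

(** [vfield a b c x y z] is the velocity of the function with value [x] and constant
    [a]; [drift] is the value of [u]. *)
Definition drift (a b c x y z : R) : R := - (a / x^2 + b / y^2 + c / z^2) / 3.

Definition vfield (a b c x y z : R) : R :=
  (a / x + drift a b c x y z * x) / 2 + (y^2 + z^2 - x^2) / (2 * y * z).

Definition drift3 (c v : I3 -> R) : R := drift (c i1) (c i2) (c i3) (v i1) (v i2) (v i3).

Definition field (c : I3 -> R) (i : I3) (v : I3 -> R) : R :=
  vfield (c i) (c (next i)) (c (next (next i))) (v i) (v (next i)) (v (next (next i))).

Lemma is_derive_prod3 (f : I3 -> R -> R) (d : I3 -> R) (t : R) :
  (forall i, is_derive (f i) t (d i)) ->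
  is_derive (fun s => prod3 (fun i => f i s)) t
    (d i1 * f i2 t * f i3 t + f i1 t * d i2 * f i3 t + f i1 t * f i2 t * d i3).
Proof.
  intros H. unfold prod3. auto_derive.
  - repeat split; eexists; apply H.
  - change (Derive (fun x => f i1 x) t) with (Derive (f i1) t).
    change (Derive (fun x => f i2 x) t) with (Derive (f i2) t).
    change (Derive (fun x => f i3 x) t) with (Derive (f i3) t).
    rewrite (Derive_eq _ _ _ (H i1)), (Derive_eq _ _ _ (H i2)),
      (Derive_eq _ _ _ (H i3)). ring.
Qed.

Lemma is_derive_sq (h : R -> R) (t d : R) :
  is_derive h t d -> is_derive (fun s => h s ^ 2) t (2 * h t * d).
Proof.
  intros H. auto_derive.
  - eexists; apply H.
  - change (Derive (fun x => h x) t) with (Derive h t).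
    rewrite (Derive_eq _ _ _ H). ring.
Qed.

Lemma tau_derive (f : I3 -> R -> R) (i : I3) (t d : R) :
  is_derive (f i) t d ->
  tau f i t = 2 * f i t * d + f i t ^ 2 / prod3 (fun j => f j t)
    * (2 * f i t ^ 2 - sum3 (fun j => f j t ^ 2)).
Proof.
  intros H. unfold tau.
  rewrite (Derive_eq (fun s => f i s ^ 2) t _ (is_derive_sq _ _ _ H)). reflexivity.
Qed.

Lemma in_interval_between (a T : Rbar) (s t r : R) :
  in_interval a T s -> in_interval a T t -> s <= r <= t -> in_interval a T r.
Proof.
  unfold in_interval. destruct a, T; simpl; intuition lra.
Qed.

Lemma in_interval_inhabited (a T : Rbar) : Rbar_lt a T -> exists t, in_interval a T t.
Proof.
  unfold in_interval. destruct a as [a| |], T as [T| |]; simpl; intros H; try easy.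
  - exists ((a + T) / 2). lra.
  - exists (a + 1). lra.
  - exists (T - 1). lra.
  - exists 0; auto.
Qed.

(** Only the combination [tau_i - u f_i^2] is differentiated, never [u] itself; its constancy gives
    [c]. The formulas for [u] and for the velocities are then algebra at each fixed time. *)
Lemma first_order_system (f : I3 -> R -> R) (u : R -> R) (a T : Rbar) :
  steady_soliton f u a T ->
  exists c : I3 -> R, sum3 c = 0 /\
    forall t, in_interval a T t ->
      (forall i, 0 < f i t /\ is_derive (f i) t (field c i (fun j => f j t))) /\
      (forall i, tau f i t = c i + u t * f i t ^ 2) /\
      u t = drift3 c (fun j => f j t).
Proof.
  intros [haT hsol].
  destruct (in_interval_inhabited a T haT) as [t0 ht0].
  set (c := fun i => tau f i t0 - u t0 * f i t0 ^ 2).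
  exists c. split.
  { destruct (hsol t0 ht0) as (_ & _ & _ & _ & H). unfold c, sum3 in *. lra. }
  intros t ht.
  assert (hc : forall i, tau f i t - u t * f i t ^ 2 = c i).
  { intros i. destruct (Rle_lt_dec t0 t) as [h|h].
    - symmetry. unfold c. apply (derive_zero_const (fun s => tau f i s - u s * f i s ^ 2)); auto.
      intros r hr. apply (hsol r). apply (in_interval_between a T t0 t); auto.
    - unfold c. apply (derive_zero_const (fun s => tau f i s - u s * f i s ^ 2)); [lra|].
      intros r hr. apply (hsol r). apply (in_interval_between a T t t0); auto. }
  clearbody c. clear ht0 t0.
  destruct (hsol t ht) as (hpos & hex & hp & _ & hs).
  assert (hd : forall i, is_derive (f i) t (Derive (f i) t)) by (intros; apply Derive_correct, hex).
  set (d := fun i => Derive (f i) t) in *.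
  change (forall i, is_derive (f i) t (d i)) in hd. clearbody d.
  rewrite (Derive_eq (fun s => prod3 (fun i => f i s)) t _ (is_derive_prod3 f d t hd)) in hp.
  assert (htau := fun i => tau_derive f i t (d i) (hd i)).
  assert (htc : forall i, tau f i t = c i + u t * f i t ^ 2) by (intros i; generalize (hc i); lra).
  assert (he : forall i, d i = (c i + u t * f i t ^ 2) / (2 * f i t)
     - f i t * (2 * f i t ^ 2 - sum3 (fun j => f j t ^ 2)) / (2 * prod3 (fun j => f j t))).
  { intros i. rewrite <- htc, htau. field.
    generalize (hpos i) (hpos i1) (hpos i2) (hpos i3); unfold prod3; intros.
    split; [repeat apply Rmult_integral_contrapositive_currified|]; lra. }
  generalize (hpos i1) (hpos i2) (hpos i3); intros p1 p2 p3.
  assert (hu : u t = drift3 c (fun j => f j t)).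
  { rewrite !he in hp. unfold sum3, prod3, drift3, drift in *.
    set (x := f i1 t) in *. set (y := f i2 t) in *. set (z := f i3 t) in *.
    (* After the velocities are substituted, the volume equation says that this product vanishes;
       its last factor is [sum tau_i / f_i^2]. *)
    assert (hq : x * y * z * (c i1 / x^2 + c i2 / y^2 + c i3 / z^2 + 3 * u t) = 0).
    { match type of hp with ?l = ?r => transitivity (l - r) end; [field|]; lra. }
    apply Rmult_integral in hq. destruct hq as [hq|hq]; [|lra].
    exfalso. apply (Rgt_not_eq (x * y * z) 0); auto. repeat apply Rmult_lt_0_compat; auto. }
  split; [|split]; auto.
  intros i. split; auto.
  replace (field c i (fun j => f j t)) with (d i); auto.
  rewrite he, hu. unfold field, vfield, drift3, drift, sum3, prod3.
  destruct i; simpl; field; lra.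
Qed.

(** The way back: an extension obtained by solving the first-order system has to be recognised as a
    soliton before [forward_maximal] can refuse it. *)
Lemma soliton_of_first_order (c : I3 -> R) (f : I3 -> R -> R) (a T : Rbar) :
  sum3 c = 0 -> Rbar_lt a T ->
  (forall t, in_interval a T t -> forall i,
     0 < f i t /\ is_derive (f i) t (field c i (fun j => f j t))) ->
  steady_soliton f (fun t => drift3 c (fun j => f j t)) a T.
Proof.
  intros hc haT H. split; auto. intros t ht.
  assert (htc : forall s, in_interval a T s -> forall i,
    tau f i s - drift3 c (fun j => f j s) * f i s ^ 2 = c i).
  { intros s hs i. rewrite (tau_derive f i s _ (proj2 (H s hs i))).
    generalize (proj1 (H s hs i1)) (proj1 (H s hs i2)) (proj1 (H s hs i3)); intros.
    unfold field, vfield, drift3, drift, sum3, prod3.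
    destruct i; simpl; field; lra. }
  generalize (proj1 (H t ht i1)) (proj1 (H t ht i2)) (proj1 (H t ht i3)); intros.
  split; [|split; [|split; [|split]]].
  - intros i; apply H; auto.
  - intros i; eexists; apply H; auto.
  - rewrite (Derive_eq (fun s => prod3 (fun i => f i s)) t _ (is_derive_prod3 f _ t (fun i => proj2 (H t ht i)))).
    unfold sum3 in hc. replace (c i3) with (- c i1 - c i2) by lra.
    unfold field, vfield, drift, sum3. simpl.
    replace (c i3) with (- c i1 - c i2) by lra. field. lra.
  - intros i. apply (is_derive_ext_loc (fun _ => c i)).
    + assert (ho : locally t (in_interval a T)).
      { unfold in_interval. apply filter_and.
        - apply open_Rbar_gt. apply ht.
        - apply open_Rbar_lt. apply ht. }
      apply filter_imp with (2 := ho). intros s hs. symmetry. apply htc; auto.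
    + apply (is_derive_const (c i) t).
  - assert (hi := htc t ht). generalize (hi i1) (hi i2) (hi i3). unfold sum3 in *. lra.
Qed.

(** * Maximal solutions leave compact boxes *)

(** Bounded Lipschitz functions form an algebra, boundedness being what makes products Lipschitz.
    The truncated field lies in it as a polynomial in clamped coordinates and their reciprocals. *)
Definition bl (phi : (I3 -> R) -> R) : Prop :=
  exists B L : R, 0 <= B /\ 0 <= L /\ (forall v, Rabs (phi v) <= B) /\
    (forall v w, Rabs (phi v - phi w) <= L * dist3 v w).

Lemma dist3_pos v w : 0 <= dist3 v w.
Proof.
  apply Rle_trans with (2 := dist3_ge v w i1). apply Rabs_pos.
Qed.

Lemma bl_const (k : R) : bl (fun _ => k).
Proof.
  exists (Rabs k), 0. repeat split; try lra.
  - apply Rabs_pos.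
  - intros; lra.
  - intros. rewrite Rminus_diag, Rabs_R0. lra.
Qed.

Lemma bl_plus phi psi : bl phi -> bl psi -> bl (fun v => phi v + psi v).
Proof.
  intros (B1 & L1 & hB1 & hL1 & h1 & l1) (B2 & L2 & hB2 & hL2 & h2 & l2).
  exists (B1 + B2), (L1 + L2). repeat split; try lra.
  - intros v. apply Rle_trans with (1 := Rabs_triang _ _). generalize (h1 v) (h2 v); lra.
  - intros v w. replace (phi v + psi v - (phi w + psi w)) with ((phi v - phi w) + (psi v - psi w)) by ring.
    apply Rle_trans with (1 := Rabs_triang _ _). generalize (l1 v w) (l2 v w); lra.
Qed.

Lemma bl_mult phi psi : bl phi -> bl psi -> bl (fun v => phi v * psi v).
Proof.
  intros (B1 & L1 & hB1 & hL1 & h1 & l1) (B2 & L2 & hB2 & hL2 & h2 & l2).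
  exists (B1 * B2), (L1 * B2 + B1 * L2). repeat split.
  - nra.
  - nra.
  - intros v. rewrite Rabs_mult. apply Rmult_le_compat; auto using Rabs_pos.
  - intros v w. replace (phi v * psi v - phi w * psi w)
      with ((phi v - phi w) * psi v + phi w * (psi v - psi w)) by ring.
    apply Rle_trans with (1 := Rabs_triang _ _). rewrite !Rabs_mult.
    apply Rle_trans with ((L1 * dist3 v w) * B2 + B1 * (L2 * dist3 v w)); [|right; ring].
    apply Rplus_le_compat; apply Rmult_le_compat; auto using Rabs_pos.
Qed.

Lemma bl_clamp (m M : R) (i : I3) : 0 < m <= M -> bl (fun v => clamp m M (v i)).
Proof.
  intros hm. exists M, 1. repeat split; try lra.
  - intros v. generalize (clamp_bounds m M (v i) ltac:(lra)); intros.
    rewrite Rabs_right; lra.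
  - intros v w. rewrite Rmult_1_l. apply Rle_trans with (2 := dist3_ge v w i).
    apply clamp_lipschitz.
Qed.

Lemma bl_inv_clamp (m M : R) (i : I3) : 0 < m <= M -> bl (fun v => / clamp m M (v i)).
Proof.
  intros hm. exists (/ m), (/ m * / m).
  assert (hi : 0 < / m) by (apply Rinv_0_lt_compat; lra).
  assert (hcl : forall v : I3 -> R, 0 < / clamp m M (v i) <= / m /\ m <= clamp m M (v i)).
  { intros v. generalize (clamp_bounds m M (v i) ltac:(lra)); intros. repeat split.
    - apply Rinv_0_lt_compat; lra.
    - apply Rinv_le_contravar; lra.
    - lra. }
  repeat split; try nra.
  - intros v. rewrite Rabs_right; generalize (hcl v); lra.
  - intros v w. destruct (hcl v) as [hv hv'], (hcl w) as [hw hw'].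
    replace (/ clamp m M (v i) - / clamp m M (w i)) with
      ((/ clamp m M (v i) * / clamp m M (w i)) * (clamp m M (w i) - clamp m M (v i))) by (field; lra).
    rewrite Rabs_mult. apply Rmult_le_compat; auto using Rabs_pos.
    + rewrite Rabs_right by nra. apply Rmult_le_compat; lra.
    + rewrite Rabs_minus_sym. apply Rle_trans with (2 := dist3_ge v w i).
      apply clamp_lipschitz.
Qed.

Lemma bl_ext phi psi : (forall v, phi v = psi v) -> bl phi -> bl psi.
Proof.
  intros H (B & L & hB & hL & h & l). exists B, L. repeat split; auto.
  - intros; rewrite <- H; auto.
  - intros; rewrite <- !H; auto.
Qed.

Definition clamped_field (m M : R) (c : I3 -> R) (i : I3) (v : I3 -> R) : R :=
  field c i (fun j => clamp m M (v j)).

Lemma bl_clamped_field m M c i : 0 < m <= M -> bl (clamped_field m M c i).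
Proof.
  intros hm. unfold clamped_field, field, vfield, drift.
  set (X := fun (j : I3) (v : I3 -> R) => clamp m M (v j)).
  set (V := fun (j : I3) (v : I3 -> R) => / clamp m M (v j)).
  assert (hX : forall j, bl (fun v => X j v)) by (intros; apply bl_clamp; auto).
  assert (hV : forall j, bl (fun v => V j v)) by (intros; apply bl_inv_clamp; auto).
  set (j := next i). set (k := next j).
  apply (bl_ext (fun v => (c i * V i v + (- (1/3)) * ((c i * (V i v * V i v) + c j * (V j v * V j v))
     + c k * (V k v * V k v)) * X i v) * (1/2)
     + ((X j v * X j v + X k v * X k v) + (-1) * (X i v * X i v)) * ((1/2) * (V j v * V k v)))).
  - intros v. unfold X, V.
    generalize (clamp_bounds m M (v i) ltac:(lra)) (clamp_bounds m M (v j) ltac:(lra))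
      (clamp_bounds m M (v k) ltac:(lra)); intros.
    field. lra.
  - repeat first [apply bl_plus | apply bl_mult | apply hX | apply hV | apply bl_const].
Qed.

Lemma clamped_field_bounds m M c : 0 < m <= M ->
  exists B L, 0 < B /\ 0 < L /\ bounded_lipschitz B L (clamped_field m M c).
Proof.
  intros hm.
  destruct (bl_clamped_field m M c i1 hm) as (B1 & L1 & hB1 & hL1 & h1 & l1).
  destruct (bl_clamped_field m M c i2 hm) as (B2 & L2 & hB2 & hL2 & h2 & l2).
  destruct (bl_clamped_field m M c i3 hm) as (B3 & L3 & hB3 & hL3 & h3 & l3).
  exists (B1 + B2 + B3 + 1), (L1 + L2 + L3 + 1). split; [lra|]. split; [lra|].
  intros i. split.
  - intros v. generalize (h1 v) (h2 v) (h3 v). destruct i; lra.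
  - intros v w. 
    assert (hL : forall L, L <= L1 + L2 + L3 + 1 -> L * dist3 v w <= (L1 + L2 + L3 + 1) * dist3 v w)
      by (intros; apply Rmult_le_compat_r; auto using dist3_pos).
    destruct i; [apply Rle_trans with (1 := l1 v w)|apply Rle_trans with (1 := l2 v w)
      |apply Rle_trans with (1 := l3 v w)]; apply hL; lra.
Qed.

Lemma field_ext c i v w : (forall j, v j = w j) -> field c i v = field c i w.
Proof. intros H. unfold field. rewrite !H. reflexivity. Qed.

Lemma clamped_field_eq m M c i v : (forall j, m <= v j <= M) ->
  clamped_field m M c i v = field c i v.
Proof. intros H. apply field_ext. intros j. apply clamp_id, H. Qed.

(** * Uniqueness and uniform local existence for the untruncated field *)

Lemma continuous_bounded (h : R -> R) (s t : R) : s <= t ->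
  (forall r, s <= r <= t -> continuous h r) -> exists K, forall r, s <= r <= t -> h r <= K.
Proof.
  intros hst hc. destruct (continuity_ab_maj h s t hst) as [m [hm _]].
  - intros r hr. apply continuity_pt_filterlim, hc, hr.
  - exists (h m). auto.
Qed.

(** On a compact time interval both solutions are positive and continuous, so they share a box
    [[m, M]]; there the field coincides with its truncation and Lipschitz uniqueness applies. *)
Lemma field_solution_unique (c : I3 -> R) (s t : R) (Y Z : I3 -> R -> R) : s <= t ->
  (forall i r, s <= r <= t -> 0 < Y i r /\ is_derive (Y i) r (field c i (fun j => Y j r))) ->
  (forall i r, s <= r <= t -> 0 < Z i r /\ is_derive (Z i) r (field c i (fun j => Z j r))) ->
  (forall i, Y i s = Z i s) -> forall i, Y i t = Z i t.
Proof.
  intros hst hY hZ.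
  assert (hb : forall h : I3 -> R -> R,
    (forall i r, s <= r <= t -> 0 < h i r /\ is_derive (h i) r (field c i (fun j => h j r))) ->
    exists m M, 0 < m <= M /\ forall i r, s <= r <= t -> m <= h i r <= M).
  { intros h hh.
    assert (hc : forall i r, s <= r <= t -> continuous (h i) r).
    { intros i r hr. apply (ex_derive_continuous (h i)). eexists. apply hh; auto. }
    assert (hK : forall i, exists K, 0 < K /\ forall r, s <= r <= t -> h i r <= K /\ / h i r <= K).
    { intros i.
      destruct (continuous_bounded (h i) s t hst (hc i)) as [K1 hK1].
      destruct (continuous_bounded (fun r => / h i r) s t hst) as [K2 hK2].
      - intros r hr. apply (continuous_comp (h i) Rinv); [apply hc; auto|].
        apply (continuous_Rinv (h i r)). generalize (proj1 (hh i r hr)); lra.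
      - exists (Rabs K1 + Rabs K2 + 1). split.
        + generalize (Rabs_pos K1) (Rabs_pos K2); lra.
        + intros r hr. generalize (hK1 r hr) (hK2 r hr) (Rle_abs K1) (Rle_abs K2)
            (Rabs_pos K1) (Rabs_pos K2). lra. }
    destruct (hK i1) as (K1 & p1 & k1), (hK i2) as (K2 & p2 & k2), (hK i3) as (K3 & p3 & k3).
    set (K := K1 + K2 + K3 + 1).
    assert (hall : forall i r, s <= r <= t -> h i r <= K /\ / h i r <= K).
    { intros i r hr. generalize (k1 r hr) (k2 r hr) (k3 r hr). unfold K. destruct i; lra. }
    assert (1 < K) by (unfold K; lra).
    assert (/ K < 1) by (rewrite <- Rinv_1; apply Rinv_lt_contravar; lra).
    exists (/ K), K. split.
    - split; [apply Rinv_0_lt_compat|]; lra.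
    - intros i r hr. destruct (hall i r hr) as [ha hb]. split; auto.
      generalize (proj1 (hh i r hr)); intros hp.
      rewrite <- (Rinv_inv (h i r)). apply Rinv_le_contravar; auto.
      apply Rinv_0_lt_compat; auto. }
  destruct (hb Y hY) as (m1 & M1 & hm1 & b1).
  destruct (hb Z hZ) as (m2 & M2 & hm2 & b2).
  set (m := Rmin m1 m2). set (M := Rmax M1 M2).
  assert (hm : 0 < m <= M).
  { unfold m, M, Rmin, Rmax; repeat destruct Rle_dec; lra. }
  assert (hin : m <= m1 /\ m <= m2 /\ M1 <= M /\ M2 <= M).
  { unfold m, M; repeat split; auto using Rmin_l, Rmin_r, Rmax_l, Rmax_r. }
  destruct (clamped_field_bounds m M c hm) as (B & L & hB & hL & hbl).
  apply (ode_uniqueness (clamped_field m M c) L s t Y Z); auto; try lra.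
  - intros; apply hbl.
  - intros i r hr. rewrite clamped_field_eq; [apply hY; auto|].
    intros j. generalize (b1 j r hr). lra.
  - intros i r hr. rewrite clamped_field_eq; [apply hZ; auto|].
    intros j. generalize (b2 j r hr). lra.
Qed.

(** The point is that [d] depends on the box alone, not on [t0] or [v0]. In that time a start in
    [[m, M]] moves by at most [m / 2], so the truncation to [[m / 2, 2 M]] is never felt. *)
Lemma field_local_existence (c : I3 -> R) (m M : R) : 0 < m <= M ->
  exists d, 0 < d /\ forall (t0 : R) (v0 : I3 -> R), (forall i, m <= v0 i <= M) ->
    exists Y : I3 -> R -> R, forall i, Y i t0 = v0 i /\
      forall t, Rabs (t - t0) < d ->
        0 < Y i t /\ is_derive (Y i) t (field c i (fun j => Y j t)).
Proof.
  intros hm.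
  destruct (clamped_field_bounds (m / 2) (2 * M) c ltac:(lra)) as (B & L & hB & hL & hbl).
  exists (Rmin (/ (6 * L)) (m / (2 * B))).
  assert (p1 : 0 < / (6 * L)) by (apply Rinv_0_lt_compat; lra).
  assert (p2 : 0 < m / (2 * B)) by (apply Rdiv_lt_0_compat; lra).
  split; [apply Rmin_pos; auto|].
  intros t0 v0 hv.
  destruct (picard_local_existence _ B L t0 v0 hB hL hbl) as [Y hY].
  exists Y. intros i. split; [apply hY|].
  intros t ht.
  assert (ht1 : Rabs (t - t0) < / (6 * L)) by (apply Rlt_le_trans with (1 := ht), Rmin_l).
  assert (ht2 : Rabs (t - t0) < m / (2 * B)) by (apply Rlt_le_trans with (1 := ht), Rmin_r).
  assert (hin : forall j, m / 2 <= Y j t <= 2 * M).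
  { intros j. destruct (proj2 (hY j) t ht1) as [h _].
    assert (B * Rabs (t - t0) <= m / 2).
    { replace (m / 2) with (B * (m / (2 * B))) by (field; lra).
      apply Rmult_le_compat_l; lra. }
    specialize (hv j). apply Rabs_le_between in h. lra. }
  split.
  - specialize (hin i). lra.
  - rewrite <- (clamped_field_eq (m / 2) (2 * M)) by auto. apply hY; auto.
Qed.

(** A visit to the box later than [T - d] could be continued past [T] by a local solution whose
    existence time is at least [d], against maximality. *)
Lemma leaves_boxes (f : I3 -> R -> R) (u : R -> R) (a : Rbar) (T : R) (c : I3 -> R) (m M : R) :
  Rbar_lt a T -> forward_maximal f u a T -> sum3 c = 0 ->
  (forall t, in_interval a T t ->
     (forall i, 0 < f i t /\ is_derive (f i) t (field c i (fun j => f j t))) /\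
     u t = drift3 c (fun j => f j t)) ->
  0 < m <= M ->
  exists d, 0 < d /\ forall t, in_interval a T t -> T - d < t -> ~ (forall i, m <= f i t <= M).
Proof.
  intros haT hmax hc hsol hm.
  destruct (field_local_existence c m M hm) as [d [hd hloc]].
  exists d. split; auto. intros t0 ht0 hT hbox.
  destruct (hloc t0 (fun i => f i t0) hbox) as [Y hY].
  (* Gluing at [t0] is harmless: by uniqueness [g] is still [f] up to [T], so near every time it
     coincides with one solution, either [f] or [Y]. *)
  set (g := fun i t => if Rle_dec t t0 then f i t else Y i t).
  assert (ht0T : t0 < T) by apply ht0.
  assert (heq : forall t i, in_interval a T t -> g i t = f i t).
  { intros t i ht. unfold g. destruct (Rle_dec t t0) as [|hn]; auto.
    apply (field_solution_unique c t0 t); try lra.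
    - intros j r hr. apply hY. rewrite Rabs_right by lra. generalize (proj2 ht); simpl; lra.
    - intros j r hr. apply hsol. apply (in_interval_between a T t0 t); auto.
    - intros j; apply hY. }
  apply (hmax (t0 + d) g (fun t => drift3 c (fun j => g j t))).
  - simpl. lra.
  - apply soliton_of_first_order; auto.
    { apply Rbar_lt_trans with (1 := haT). simpl; lra. }
    intros t [hat htT] i. simpl in htT.
    destruct (Rlt_le_dec t T) as [hlt|hge].
    + assert (ht : in_interval a T t) by (split; auto).
      rewrite heq by auto. split; [apply hsol; auto|].
      rewrite (field_ext c i (fun j => g j t) (fun j => f j t)) by (intros; apply heq; auto).
      apply (is_derive_ext_loc (f i)); [|apply hsol; auto].
      apply (locally_interval _ t a T); auto.
      intros y hy1 hy2. symmetry. apply heq; split; auto.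
    + assert (hg : forall s, t0 < s -> forall j, g j s = Y j s).
      { intros s hs j. unfold g. destruct (Rle_dec s t0); lra. }
      assert (habs : Rabs (t - t0) < d) by (rewrite Rabs_right; lra).
      rewrite hg by lra. split; [apply hY; auto|].
      rewrite (field_ext c i (fun j => g j t) (fun j => Y j t)) by (intros; apply hg; lra).
      apply (is_derive_ext_loc (Y i)); [|apply hY; auto].
      apply (locally_interval _ t t0 p_infty); simpl; try lra; auto.
      intros y hy1 _. symmetry. apply hg; auto.
  - intros t ht. split.
    + intros i. apply heq; auto.
    + rewrite (proj2 (hsol t ht)). unfold drift3. rewrite !heq; auto.
Qed.

(** * Order of the functions and finite maximal time *)

Ltac rw_derive :=
  repeat match goal with
  | H : is_derive ?h ?t ?d |- context [Derive _ ?t] =>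
      progress (change (Derive (fun s => h s) t) with (Derive h t);
                rewrite ?(Derive_eq h t d H))
  end.

Ltac ex_der := repeat split; try (eexists; eassumption); try lra; auto.

(** Labels are left free: the system is symmetric under permutations, so later estimates can be
    stated for an ordered triple. *)
Definition ode_at (a b c : R) (x y z : R -> R) (t : R) : Prop :=
  (0 < x t /\ 0 < y t /\ 0 < z t) /\
  is_derive x t (vfield a b c (x t) (y t) (z t)) /\
  is_derive y t (vfield b c a (y t) (z t) (x t)) /\
  is_derive z t (vfield c a b (z t) (x t) (y t)).

Lemma vfield_swap a b c x y z : vfield a c b x z y = vfield a b c x y z.
Proof.
  unfold vfield, drift.
  replace (c / z^2) with (c * / z^2) by reflexivity.
  replace (2 * z * y) with (2 * y * z) by ring.
  unfold Rdiv. ring.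
Qed.

Lemma ode_at_rot a b c x y z t : ode_at a b c x y z t -> ode_at b c a y z x t.
Proof. unfold ode_at. tauto. Qed.

Lemma ode_at_swap a b c x y z t : ode_at a b c x y z t -> ode_at b a c y x z t.
Proof.
  unfold ode_at. rewrite (vfield_swap b c a), (vfield_swap a b c), (vfield_swap c a b). tauto.
Qed.

Definition distinct3 (i j k : I3) : Prop := i <> j /\ j <> k /\ k <> i.

Lemma ode_at_perm (c : I3 -> R) (f : I3 -> R -> R) (t : R) (i j k : I3) :
  distinct3 i j k ->
  (forall i, 0 < f i t /\ is_derive (f i) t (field c i (fun j => f j t))) ->
  ode_at (c i) (c j) (c k) (f i) (f j) (f k) t.
Proof.
  intros hd H.
  assert (H0 : ode_at (c i1) (c i2) (c i3) (f i1) (f i2) (f i3) t).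
  { generalize (H i1) (H i2) (H i3). unfold ode_at, field. simpl. tauto. }
  destruct hd as (h1 & h2 & h3).
  destruct i, j, k; try (exfalso; congruence);
  eauto 6 using ode_at_rot, ode_at_swap.
Qed.

Lemma sum3_perm (g : I3 -> R) (i j k : I3) : distinct3 i j k -> sum3 g = g i + g j + g k.
Proof.
  intros (h1 & h2 & h3). unfold sum3. destruct i, j, k; try (exfalso; congruence); ring.
Qed.

Lemma interval_ext (a T : Rbar) (s t : R) : in_interval a T s -> in_interval a T t ->
  exists lo hi, lo < s /\ t < hi /\ forall r, lo < r < hi -> in_interval a T r.
Proof.
  intros [hs1 hs2] [ht1 ht2].
  destruct (in_interval_inhabited a s hs1) as [lo [hl1 hl2]].
  destruct (in_interval_inhabited t T ht2) as [hi [hh1 hh2]].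
  exists lo, hi. simpl in *. repeat split; auto.
  - apply (Rbar_lt_trans a lo r); simpl; [exact hl1|lra].
  - apply (Rbar_lt_trans r hi T); simpl; [lra|exact hh2].
Qed.

(** The nonlinear terms factor, [x^2 (y^2 + z^2 - x^2) - y^2 (x^2 + z^2 - y^2) = (x^2 - y^2) (z^2 -
    x^2 - y^2)], so [x^2 - y^2] satisfies a linear equation with source [a - b >= 0]. *)
Lemma order_preserved a b c x y z (al T : Rbar) (s t : R) :
  (forall r, in_interval al T r -> ode_at a b c x y z r) ->
  in_interval al T s -> in_interval al T t -> s <= t -> b <= a -> y s <= x s -> y t <= x t.
Proof.
  intros H hs ht hst hab h0.
  destruct (interval_ext al T s t hs ht) as (lo & hi & hlo & hhi & hin).
  set (E := fun r => drift a b c (x r) (y r) (z r) + (z r ^ 2 - x r ^ 2 - y r ^ 2) / (x r * y r * z r)).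
  assert (hD : 0 <= x t ^ 2 - y t ^ 2).
  { apply (linear_comparison_nonneg (fun r => x r ^ 2 - y r ^ 2)
     (fun r => a - b + E r * (x r ^ 2 - y r ^ 2)) E lo hi s t); auto.
    - intros r hr. destruct (H r (hin r hr)) as ((p1 & p2 & p3) & hx & hy & hz).
      auto_derive; [ex_der|]. rw_derive. unfold E, vfield, drift. field. lra.
    - intros r hr. apply (ex_derive_continuous E).
      destruct (H r (hin r hr)) as ((p1 & p2 & p3) & hx & hy & hz).
      unfold E, drift. auto_derive. ex_der; try nra.
      apply Rgt_not_eq. repeat apply Rmult_lt_0_compat; auto.
    - intros r hr. lra.
    - destruct (H s hs) as ((p1 & p2 & p3) & _). nra. }
  destruct (H t ht) as ((p1 & p2 & p3) & _). nra.
Qed.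

(** For [b <= a] the relation [y <= x] is absorbing: either it holds at some time and from then on,
    or [x < y] throughout. The other sign of [b - a] exchanges the roles. *)
Lemma order_eventual a b c x y z (al T : Rbar) (t0 : R) :
  (forall r, in_interval al T r -> ode_at a b c x y z r) -> in_interval al T t0 ->
  exists t1, in_interval al T t1 /\ t0 <= t1 /\
   ((forall t, in_interval al T t -> t1 <= t -> y t <= x t) \/
    (forall t, in_interval al T t -> t1 <= t -> x t <= y t)).
Proof.
  assert (W : forall a b c x y z, (forall r, in_interval al T r -> ode_at a b c x y z r) ->
    in_interval al T t0 -> b <= a -> exists t1, in_interval al T t1 /\ t0 <= t1 /\
   ((forall t, in_interval al T t -> t1 <= t -> y t <= x t) \/
    (forall t, in_interval al T t -> t1 <= t -> x t <= y t))).
  { clear. intros a b c x y z H h0 hab.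
    destruct (classic (exists t1, in_interval al T t1 /\ t0 <= t1 /\ y t1 <= x t1))
      as [(t1 & h1 & h2 & h3)|hn].
    - exists t1. repeat split; auto; try apply h1. left. intros t ht hle.
      apply (order_preserved a b c x y z al T t1 t); auto.
    - exists t0. repeat split; auto; try apply h0; try lra. right. intros t ht hle.
      destruct (Rle_lt_dec (x t) (y t)); auto. exfalso. apply hn. exists t. repeat split; try apply ht; lra. }
  intros H h0. destruct (Rle_lt_dec b a) as [hab|hab].
  - apply (W a b c x y z); auto.
  - destruct (W b a c y x z) as (t1 & h1 & h2 & h3); auto; try lra.
    + intros; apply ode_at_swap; auto.
    + exists t1. tauto.
Qed.

(** With [p = z / x], [q = z / y], [r = x / y], the part without constants is [z (r + / r - p q)],
    where [r + / r >= 2] and [p q <= 1]. The constants enter with weights at most 2/3, so the sum of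
    their absolute values dominates them. *)
Lemma smallest_growth a b c x y z : 0 < z -> z <= x -> z <= y ->
  z - (Rabs a + Rabs b + Rabs c) <= 2 * z * vfield c a b z x y.
Proof.
  intros hz hx hy.
  assert (ex : exists p, 0 < p <= 1 /\ p = z / x).
  { exists (z / x). repeat split.
    - apply Rdiv_lt_0_compat; lra.
    - apply Rmult_le_reg_r with x; [lra|]. unfold Rdiv. rewrite Rmult_assoc, Rinv_l; lra. }
  assert (ey : exists q, 0 < q <= 1 /\ q = z / y).
  { exists (z / y). repeat split.
    - apply Rdiv_lt_0_compat; lra.
    - apply Rmult_le_reg_r with y; [lra|]. unfold Rdiv. rewrite Rmult_assoc, Rinv_l; lra. }
  destruct ex as (p & hp & ep), ey as (q & hq & eq).
  assert (hr : 0 < x / y) by (apply Rdiv_lt_0_compat; lra).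
  set (r := x / y) in *.
  assert (e : 2 * z * vfield c a b z x y
     = 2 / 3 * c - (a * p^2 + b * q^2) / 3 + z * (r + / r - p * q)).
  { rewrite ep, eq. unfold r, vfield, drift. field. lra. }
  rewrite e.
  assert (2 <= r + / r).
  { apply Rmult_le_reg_r with r; auto. rewrite Rmult_plus_distr_r, Rinv_l by lra.
    generalize (pow2_ge_0 (r - 1)). nra. }
  assert (p^2 <= 1 /\ q^2 <= 1 /\ p * q <= 1) by (repeat split; nra).
  assert (0 <= p^2 /\ 0 <= q^2) by (repeat split; nra).
  assert (a * p^2 <= Rabs a) by (generalize (Rle_abs a) (Rabs_pos a); nra).
  assert (b * q^2 <= Rabs b) by (generalize (Rle_abs b) (Rabs_pos b); nra).
  assert (- c <= Rabs c) by (rewrite <- Rabs_Ropp; apply Rle_abs).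
  generalize (Rabs_pos a) (Rabs_pos b) (Rabs_pos c).
  nra.
Qed.

Lemma is_derive_prod a b c x y z t : a + b + c = 0 -> ode_at a b c x y z t ->
  is_derive (fun s => x s * y s * z s) t ((x t ^ 2 + y t ^ 2 + z t ^ 2) / 2).
Proof.
  intros hs ((p1 & p2 & p3) & hx & hy & hz).
  auto_derive; [ex_der|]. rw_derive. unfold vfield, drift.
  replace c with (- a - b) by lra. field. lra.
Qed.

(** The drift cancels in a ratio, and the last term always pulls the two functions together. This is
    the source of all upper bounds on ratios below. *)
Lemma is_derive_ln_ratio a b c x y z t : ode_at a b c x y z t ->
  is_derive (fun s => ln (x s / y s)) t
    ((a / x t ^ 2 - b / y t ^ 2) / 2 - (x t ^ 2 - y t ^ 2) / (x t * y t * z t)).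
Proof.
  intros ((p1 & p2 & p3) & hx & hy & hz).
  auto_derive.
  - ex_der. apply Rdiv_lt_0_compat; lra.
  - rw_derive. unfold vfield, drift. field. lra.
Qed.

Lemma div_le_of_lower (k a m v : R) : 0 < m -> m <= v -> Rabs a <= k -> a / v <= k / m.
Proof.
  intros hm hv ha. generalize (Rle_abs a) (Rabs_pos a); intros.
  apply Rle_trans with (k / v).
  - apply Rmult_le_compat_r; [left; apply Rinv_0_lt_compat|]; lra.
  - apply Rmult_le_compat_l; [lra|]. apply Rinv_le_contravar; lra.
Qed.

Lemma ln_le_exp v k : 0 < v -> ln v <= k -> v <= exp k.
Proof.
  intros hv h. rewrite <- (exp_ln v hv). destruct h as [h|h].
  - left. apply exp_increasing; auto.
  - rewrite h; lra.
Qed.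

(** The volume is the intermediate quantity: once [x / z] is bounded, [(ln p)'] is at most
    [3 / 2 * (x / z) / y], and a bound on [p] bounds [x = p / (y z)] because [y] and [z] are at
    least [m]. *)
Lemma finite_time_bound a b c x y z (t1 T m : R) :
  a + b + c = 0 -> t1 < T -> 0 < m ->
  (forall t, t1 <= t < T -> ode_at a b c x y z t /\ m <= z t /\ z t <= y t <= x t) ->
  exists M, forall t, t1 <= t < T -> x t <= M.
Proof.
  intros hs hT hm H.
  set (k1 := (Rabs a / m^2 + Rabs c / m^2) / 2).
  set (K := ln (x t1 / z t1) + Rabs k1 * (T - t1)).
  assert (hk : forall t, t1 <= t < T -> x t / z t <= exp K).
  { intros t ht. apply ln_le_exp.
    - destruct (H t ht) as (((p1 & p2 & p3) & _) & _). apply Rdiv_lt_0_compat; auto.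
    - apply Rle_trans with (ln (x t1 / z t1) + Rabs k1 * (t - t1)).
      2: { unfold K. generalize (Rabs_pos k1); intros. nra. }
      apply (derive_bound_le (fun s => ln (x s / z s)) (fun t => ((a / x t ^ 2 - c / z t ^ 2) / 2
          - (x t ^ 2 - z t ^ 2) / (x t * z t * y t)))); [lra| |].
      + intros r hr. apply (is_derive_ln_ratio a c b x z y).
        destruct (H r ltac:(lra)) as (ho & _). apply ode_at_swap, ode_at_rot, ode_at_rot; auto.
      + intros r hr. destruct (H r ltac:(lra)) as (((p1 & p2 & p3) & _) & h1 & h2).
        apply Rle_trans with (2 := Rle_abs k1). unfold k1.
        assert (0 <= (x r ^ 2 - z r ^ 2) / (x r * z r * y r)).
        { apply Rmult_le_pos; [nra|]. left. apply Rinv_0_lt_compat.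
          repeat apply Rmult_lt_0_compat; auto. }
        assert (a / x r ^ 2 <= Rabs a / m^2) by (apply div_le_of_lower; [nra|nra|lra]).
        assert ((- c) / z r ^ 2 <= Rabs c / m^2)
          by (apply div_le_of_lower; [nra|nra|rewrite Rabs_Ropp; lra]).
        replace (- c / z r ^ 2) with (- (c / z r ^ 2)) in * by (field; lra).
        lra. }
  set (k2 := 3 / 2 * exp K / m).
  set (p := fun t => x t * y t * z t).
  assert (hp : forall t, t1 <= t < T -> 0 < p t).
  { intros t ht. destruct (H t ht) as (((p1 & p2 & p3) & _) & _).
    unfold p. repeat apply Rmult_lt_0_compat; auto. }
  assert (hk2 : 0 < k2).
  { unfold k2. generalize (exp_pos K); intros. apply Rdiv_lt_0_compat; lra. }
  set (K2 := ln (p t1) + k2 * (T - t1)).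
  assert (hK2 : forall t, t1 <= t < T -> p t <= exp K2).
  { intros t ht. apply ln_le_exp; auto.
    apply Rle_trans with (ln (p t1) + k2 * (t - t1)).
    2: { unfold K2. nra. }
    apply (derive_bound_le (fun s => ln (p s)) (fun t => (x t ^ 2 + y t ^ 2 + z t ^ 2) / 2 / p t)); [lra| |].
    - intros r hr. destruct (H r ltac:(lra)) as (ho & _).
      assert (hd := is_derive_prod a b c x y z r hs ho). fold p in hd.
      evar_last.
      + apply (is_derive_comp ln p); [apply is_derive_ln, hp; lra|apply hd].
      + unfold scal; simpl; unfold mult; simpl. field.
        generalize (hp r ltac:(lra)); lra.
    - intros r hr. destruct (H r ltac:(lra)) as (((p1 & p2 & p3) & _) & h1 & h2).
      specialize (hk r ltac:(lra)).
      apply Rle_trans with ((3 * x r ^2) / 2 / p r).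
      + apply Rmult_le_compat_r; [left; apply Rinv_0_lt_compat, hp; lra|]. nra.
      + replace (3 * x r ^ 2 / 2 / p r) with (3 / 2 * (x r / z r) * / y r)
          by (unfold p; field; lra).
        unfold k2, Rdiv at 2. apply Rmult_le_compat.
        * assert (0 < x r / z r) by (apply Rdiv_lt_0_compat; auto). lra.
        * left; apply Rinv_0_lt_compat; lra.
        * lra.
        * apply Rinv_le_contravar; lra. }
  exists (exp K2 / m^2). intros t ht.
  destruct (H t ht) as (((p1 & p2 & p3) & _) & h1 & h2).
  apply Rmult_le_reg_r with (m^2); [nra|].
  replace (exp K2 / m ^ 2 * m ^ 2) with (exp K2) by (field; lra).
  apply Rle_trans with (2 := hK2 t ht). unfold p.
  rewrite Rmult_assoc. apply Rmult_le_compat_l; [lra|]. simpl. rewrite Rmult_1_r.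
  apply Rmult_le_compat; lra.
Qed.

(** [z^2 + C t] is nondecreasing, with [C] the sum of absolute values of the constants. Comparing
    with a later time at which [z^2 <= e] leaves [e + C (T - t)], for every [e > 0]. Small values of
    [z] at some times thus already give its convergence to zero. *)
Lemma smallest_vanishing_rate a b c x y z (t1 T : R) :
  (forall t, t1 <= t < T -> ode_at a b c x y z t /\ z t <= y t <= x t) ->
  (forall m s, 0 < m -> t1 <= s < T -> exists t, s <= t < T /\ z t < m) ->
  forall t, t1 <= t < T -> z t ^ 2 <= (Rabs a + Rabs b + Rabs c) * (T - t).
Proof.
  intros H hinf t ht. set (k := Rabs a + Rabs b + Rabs c).
  assert (hk : 0 <= k) by (unfold k; generalize (Rabs_pos a) (Rabs_pos b) (Rabs_pos c); lra).
  apply le_epsilon. intros e he.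
  destruct (hinf (sqrt e) t (sqrt_lt_R0 e he) ht) as (s & hs & hz).
  assert (z s ^ 2 <= e).
  { destruct (H s ltac:(lra)) as (((p1 & p2 & p3) & _) & _).
    rewrite <- (sqrt_sqrt e) by lra. nra. }
  assert (z t ^ 2 + k * t <= z s ^ 2 + k * s).
  { apply (derive_nonneg_le (fun r => z r ^ 2 + k * r)
      (fun r => 2 * z r * vfield c a b (z r) (x r) (y r) + k)); [lra| |].
    - intros r hr. destruct (H r ltac:(lra)) as (((p1 & p2 & p3) & hx & hy & hz') & _).
      auto_derive; [ex_der|]. rw_derive. ring.
    - intros r hr. destruct (H r ltac:(lra)) as (((p1 & p2 & p3) & _) & h1).
      generalize (smallest_growth a b c (x r) (y r) (z r) p3 ltac:(lra) ltac:(lra)).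
      fold k. lra. }
  nra.
Qed.

(** * The conical regime *)

(** Since the threshold lies below [z s], [(z - z s)' >= (z - z s) / (2 z)], so [z] never falls
    below [z s]. Its velocity is then at least [(1 - k / z s) / 2], which is [d]. *)
Lemma smallest_above_threshold a b c x y z (t0 s : R) :
  (forall t, t0 < t -> ode_at a b c x y z t /\ z t <= y t <= x t) ->
  t0 < s -> Rabs a + Rabs b + Rabs c < z s ->
  exists d, 0 < d /\ forall t, s <= t -> z s + d * (t - s) <= z t.
Proof.
  intros H hs hz. set (k := Rabs a + Rabs b + Rabs c) in *.
  assert (hk : 0 <= k) by (unfold k; generalize (Rabs_pos a) (Rabs_pos b) (Rabs_pos c); lra).
  set (z' := fun t => vfield c a b (z t) (x t) (y t)).
  assert (hg : forall t, t0 < t -> z t - k <= 2 * z t * z' t).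
  { intros t ht. destruct (H t ht) as (((p1 & p2 & p3) & _) & h1).
    apply smallest_growth; lra. }
  assert (hpos : forall t, t0 < t -> 0 < z t) by (intros t ht; apply (H t ht)).
  assert (hd : forall t, t0 < t -> is_derive z t (z' t)) by (intros t ht; apply (H t ht)).
  assert (hge : forall t, s <= t -> z s <= z t).
  { intros t ht. enough (0 <= z t - z s) by lra.
    apply (linear_comparison_nonneg (fun r => z r - z s) z' (fun r => / (2 * z r)) t0 (t + 1) s t); try lra.
    - intros r hr. assert (h := hd r ltac:(lra)). auto_derive; [ex_der|]. rw_derive. ring.
    - intros r hr. apply (ex_derive_continuous (fun r => / (2 * z r))).
      assert (h := hd r ltac:(lra)). specialize (hpos r ltac:(lra)).
      auto_derive. ex_der.
    - intros r hr. specialize (hg r ltac:(lra)). specialize (hpos r ltac:(lra)).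
      apply Rmult_le_reg_l with (2 * z r); [lra|].
      rewrite <- Rmult_assoc, Rinv_r by lra. lra. }
  set (d := (1 - k / z s) / 2).
  assert (hzs := hpos s hs).
  assert (hks : k / z s < 1).
  { apply Rmult_lt_reg_r with (z s); auto. replace (k / z s * z s) with k by (field; lra). lra. }
  assert (hd0 : 0 < d) by (unfold d; lra).
  exists d. split; auto. intros t ht.
  enough (z s - d * s <= z t - d * t) by lra.
  apply (derive_nonneg_le (fun r => z r - d * r) (fun r => z' r - d)); auto.
  - intros r hr. assert (h := hd r ltac:(lra)). auto_derive; [ex_der|]. rw_derive. ring.
  - intros r hr. specialize (hg r ltac:(lra)). specialize (hge r ltac:(lra)).
    assert (k / z r <= k / z s).
    { apply Rmult_le_compat_l; auto. apply Rinv_le_contravar; auto. }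
    assert ((1 - k / z r) / 2 <= z' r).
    { apply Rmult_le_reg_l with (2 * z r); [lra|].
      replace (2 * z r * ((1 - k / z r) / 2)) with (z r - k) by (field; lra). lra. }
    unfold d. lra.
Qed.

(** The linear lower bound makes [(ln (x / z))'] at most [q / t^2], which is integrable. So [x / z]
    stays bounded, and with it every term of [x'] is bounded above. *)
Lemma linear_growth a b c x y z (t0 s : R) :
  (forall t, t0 < t -> ode_at a b c x y z t /\ z t <= y t <= x t) ->
  t0 < s -> Rabs a + Rabs b + Rabs c < z s ->
  exists d K t2, 0 < d /\ 0 < K /\ 1 <= t2 /\ t0 < t2 /\
    forall t, t2 <= t -> d * t <= z t /\ x t <= K * t.
Proof.
  intros H hs hz.
  destruct (smallest_above_threshold a b c x y z t0 s H hs hz) as (d1 & hd1 & hlow).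
  set (k := Rabs a + Rabs b + Rabs c) in *.
  assert (hk : 0 <= k) by (unfold k; generalize (Rabs_pos a) (Rabs_pos b) (Rabs_pos c); lra).
  set (d := d1 / 2). assert (hd : 0 < d) by (unfold d; lra).
  (* From [2 s] on, [d1 (t - s) >= d1 t / 2], which explains [d]; and [t >= 1] lets additive
     constants be absorbed into multiples of [t]. *)
  set (t2 := 1 + Rabs s + Rabs s).
  assert (ht2 : 1 <= t2 /\ s <= t2 /\ 2 * s <= t2)
    by (unfold t2; generalize (Rle_abs s) (Rabs_pos s); lra).
  assert (hlow2 : forall t, t2 <= t -> d * t <= z t).
  { intros t ht. specialize (hlow t ltac:(lra)). unfold d. nra. }
  set (q := k / d^2).
  assert (hq : 0 <= q).
  { unfold q. apply Rmult_le_pos; auto. left; apply Rinv_0_lt_compat; nra. }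
  set (R0 := exp (ln (x t2 / z t2) + q)).
  assert (hR : forall t, t2 <= t -> x t <= R0 * z t).
  { intros t ht.
    assert (pz : 0 < z t) by (apply (H t ltac:(lra))).
    assert (px : 0 < x t) by (apply (H t ltac:(lra))).
    apply Rmult_le_reg_r with (/ z t); [apply Rinv_0_lt_compat; auto|].
    rewrite Rmult_assoc, Rinv_r, Rmult_1_r by lra.
    apply ln_le_exp. apply Rdiv_lt_0_compat; auto.
    assert (hm : - (ln (x t2 / z t2) + q * / t2) <= - (ln (x t / z t) + q * / t)).
    { apply (derive_nonneg_le (fun r => - (ln (x r / z r) + q * / r))
        (fun r => - (((a / x r ^ 2 - c / z r ^ 2) / 2
          - (x r ^ 2 - z r ^ 2) / (x r * z r * y r)) + q * (- / r ^ 2)))); auto.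
      - intros r hr. apply (is_derive_opp (fun r => ln (x r / z r) + q * / r)).
        apply (is_derive_plus (fun r => ln (x r / z r)) (fun r => q * / r)).
        + apply (is_derive_ln_ratio a c b x z y).
          destruct (H r ltac:(lra)) as (ho & _). apply ode_at_swap, ode_at_rot, ode_at_rot; auto.
        + auto_derive; [lra|]. field. lra.
      - intros r hr. destruct (H r ltac:(lra)) as (((p1 & p2 & p3) & _) & h1).
        specialize (hlow2 r ltac:(lra)).
        assert (0 <= (x r ^ 2 - z r ^ 2) / (x r * z r * y r)).
        { apply Rmult_le_pos; [nra|]. left. apply Rinv_0_lt_compat.
          repeat apply Rmult_lt_0_compat; auto. }
        assert (hdr0 : 0 < d * r) by (apply Rmult_lt_0_compat; lra).
        assert (hdr : 0 < (d * r)^2) by (apply pow_lt; auto).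
        assert (ha : a / x r ^ 2 <= k / (d * r)^2).
        { apply div_le_of_lower; [apply pow_lt; lra|apply pow_incr; lra|].
          unfold k; generalize (Rabs_pos b) (Rabs_pos c); lra. }
        assert (hc : (- c) / z r ^ 2 <= k / (d * r)^2).
        { apply div_le_of_lower; [apply pow_lt; lra|apply pow_incr; lra|rewrite Rabs_Ropp].
          unfold k; generalize (Rabs_pos b) (Rabs_pos a); lra. }
        replace (- c / z r ^ 2) with (- (c / z r ^ 2)) in hc by (field; lra).
        replace (k / (d * r)^2) with (q * / r^2) in ha, hc by (unfold q; field; lra).
        lra. }
    assert (q * / t2 <= q * 1).
    { apply Rmult_le_compat_l; auto. rewrite <- Rinv_1. apply Rinv_le_contravar; lra. }
    assert (0 <= q * / t).
    { apply Rmult_le_pos; auto. left; apply Rinv_0_lt_compat; lra. }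
    lra. }
  assert (hR0 : 0 < R0) by apply exp_pos.
  set (K1 := k / (2 * d) + k * R0 / (6 * d) + 1).
  assert (hK1 : 0 < K1).
  { unfold K1.
    assert (0 <= k / (2 * d)) by (apply Rmult_le_pos; auto; left; apply Rinv_0_lt_compat; lra).
    assert (0 <= k * R0 / (6 * d)) by (apply Rmult_le_pos; [nra|]; left; apply Rinv_0_lt_compat; lra).
    lra. }
  assert (px2 : 0 < x t2) by (apply (H t2 ltac:(lra))).
  exists d, (x t2 + K1), t2. repeat split; try lra.
  - apply hlow2; auto.
  - assert (hx : x t <= x t2 + K1 * (t - t2)).
    { apply (derive_bound_le x (fun t => vfield a b c (x t) (y t) (z t))); auto.
      - intros r hr. apply (H r ltac:(lra)).
      - intros r hr. destruct (H r ltac:(lra)) as (((p1 & p2 & p3) & _) & h1).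
        specialize (hlow2 r ltac:(lra)). specialize (hR r ltac:(lra)).
        assert (hdz : d <= z r) by nra.
        unfold vfield, K1.
        assert (e1 : a / x r <= k / d).
        { apply div_le_of_lower; [lra|lra|]. unfold k; generalize (Rabs_pos b) (Rabs_pos c); lra. }
        assert (e2 : drift a b c (x r) (y r) (z r) * x r <= k * R0 / (3 * d)).
        { assert (dr : drift a b c (x r) (y r) (z r) <= k / (3 * z r ^ 2)).
          { unfold drift.
            assert (g1 : (- a) / x r ^ 2 <= Rabs a / z r ^ 2)
              by (apply div_le_of_lower; [apply pow_lt; lra|apply pow_incr; lra|rewrite Rabs_Ropp; lra]).
            assert (g2 : (- b) / y r ^ 2 <= Rabs b / z r ^ 2)
              by (apply div_le_of_lower; [apply pow_lt; lra|apply pow_incr; lra|rewrite Rabs_Ropp; lra]).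
            assert (g3 : (- c) / z r ^ 2 <= Rabs c / z r ^ 2)
              by (apply div_le_of_lower; [apply pow_lt; lra|apply pow_incr; lra|rewrite Rabs_Ropp; lra]).
            replace (k / (3 * z r ^ 2)) with ((Rabs a / z r ^ 2 + Rabs b / z r ^ 2 + Rabs c / z r ^ 2) / 3)
              by (unfold k; field; lra).
            unfold Rdiv in *. lra. }
          apply Rle_trans with (k / (3 * z r ^ 2) * x r); [apply Rmult_le_compat_r; lra|].
          apply Rle_trans with (k / (3 * z r ^ 2) * (R0 * z r)).
          { apply Rmult_le_compat_l; auto.
            apply Rmult_le_pos; auto. left; apply Rinv_0_lt_compat; nra. }
          replace (k / (3 * z r ^ 2) * (R0 * z r)) with (k * R0 * / (3 * z r)) by (field; lra).
          apply Rmult_le_compat_l; [nra|]. apply Rinv_le_contravar; lra. }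
        assert (e3 : (y r ^ 2 + z r ^ 2 - x r ^ 2) / (2 * y r * z r) <= 1).
        { apply Rmult_le_reg_r with (2 * y r * z r); [nra|].
          unfold Rdiv. rewrite Rmult_assoc, Rinv_l by nra. nra. }
        replace (k / (2 * d)) with (k / d / 2) by (field; lra).
        replace (k * R0 / (6 * d)) with (k * R0 / (3 * d) / 2) by (field; lra).
        lra. }
    nra.
Qed.

(** * Differences of the functions and their common linear asymptotics *)

Definition linear_bounds (d K t2 : R) (x : R -> R) : Prop :=
  forall t, t2 <= t -> d * t <= x t <= K * t.

(** For [a = b = c = 0] this quantity is conserved, a first integral of the static equations. In
    general the terms without constants still cancel, and only the constants and the drift
    survive. *)
Lemma is_derive_first_integral a b c x y z t : ode_at a b c x y z t ->
  is_derive (fun s => z s ^ 2 * (x s ^ 2 - y s ^ 2)) t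
    (z t ^ 2 * (a - b) + c * (x t ^ 2 - y t ^ 2)
     + 2 * drift a b c (x t) (y t) (z t) * (z t ^ 2 * (x t ^ 2 - y t ^ 2))).
Proof.
  intros ((p1 & p2 & p3) & hx & hy & hz).
  auto_derive; [ex_der|]. rw_derive. unfold vfield, drift. field. lra.
Qed.

Lemma drift_bound a b c x y z m : 0 < m -> m <= x -> m <= y -> m <= z ->
  Rabs (drift a b c x y z) <= (Rabs a + Rabs b + Rabs c) / m^2.
Proof.
  intros hm hx hy hz. unfold drift.
  assert (E : forall a v, m <= v -> Rabs (a / v^2) <= Rabs a / m^2).
  { intros e v hv. unfold Rdiv. rewrite Rabs_mult. apply Rmult_le_compat_l; [apply Rabs_pos|].
    rewrite Rabs_right.
    - apply Rinv_le_contravar; nra.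
    - apply Rle_ge. left; apply Rinv_0_lt_compat; nra. }
  unfold Rdiv. rewrite Rabs_mult, Rabs_Ropp, (Rabs_right (/ 3)) by lra.
  assert (h := Rabs_triang (a / x^2 + b / y^2) (c / z^2)).
  assert (h' := Rabs_triang (a / x^2) (b / y^2)).
  generalize (E a x hx) (E b y hy) (E c z hz) (Rabs_pos (a / x^2 + b / y^2 + c / z^2)).
  unfold Rdiv in *. lra.
Qed.

Lemma abs_diff_of_sq (x y m e : R) : 0 < m -> m <= x -> m <= y ->
  Rabs (x^2 - y^2) <= e -> Rabs (x - y) <= e / (2 * m).
Proof.
  intros hm hx hy he.
  replace (x^2 - y^2) with ((x - y) * (x + y)) in he by ring.
  rewrite Rabs_mult, (Rabs_right (x + y)) in he by lra.
  apply Rmult_le_reg_r with (2 * m); [lra|].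
  replace (e / (2 * m) * (2 * m)) with e by (field; lra).
  generalize (Rabs_pos (x - y)); nra.
Qed.

(** Everything beyond [(a - b) z^2] is of the size of [x^2 - y^2]: the drift is [O(t^-2)] and
    compensates [z^2 = O(t^2)]. *)
Lemma first_integral_derive_bound a b c x y z (d K t2 t : R) :
  0 < d -> 0 < K -> 1 <= t2 -> linear_bounds d K t2 x -> linear_bounds d K t2 y -> linear_bounds d K t2 z ->
  t2 <= t ->
  Rabs (c * (x t ^ 2 - y t ^ 2) + 2 * drift a b c (x t) (y t) (z t) * (z t ^ 2 * (x t ^ 2 - y t ^ 2)))
  <= (Rabs a + Rabs b + Rabs c) * (1 + 2 * K^2 / d^2) * Rabs (x t ^ 2 - y t ^ 2).
Proof.
  intros hd hK h2 hx hy hz ht.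
  specialize (hx t ht). specialize (hy t ht). specialize (hz t ht).
  set (k := Rabs a + Rabs b + Rabs c).
  set (w := x t ^ 2 - y t ^ 2).
  assert (0 < d * t) by nra.
  assert (hu := drift_bound a b c (x t) (y t) (z t) (d * t) ltac:(lra) ltac:(lra) ltac:(lra) ltac:(lra)).
  fold k in hu. set (u := drift a b c (x t) (y t) (z t)) in *.
  replace (c * w + 2 * u * (z t ^ 2 * w)) with ((c + 2 * (u * z t ^ 2)) * w) by ring.
  rewrite Rabs_mult. apply Rmult_le_compat_r; [apply Rabs_pos|].
  apply Rle_trans with (1 := Rabs_triang _ _).
  rewrite !Rabs_mult, (Rabs_right 2) by lra.
  rewrite (Rabs_right (z t ^ 2)) by (apply Rle_ge; nra).
  assert (Rabs u * z t ^ 2 <= k / (d * t)^2 * (K * t)^2).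
  { apply Rmult_le_compat; [apply Rabs_pos|nra|auto|nra]. }
  replace (k / (d * t)^2 * (K * t)^2) with (k * K^2 / d^2) in H0 by (field; lra).
  replace (k * (1 + 2 * K^2 / d^2)) with (k + 2 * (k * K^2 / d^2)) by (field; lra).
  assert (Rabs c <= k) by (unfold k; generalize (Rabs_pos a) (Rabs_pos b); lra). lra.
Qed.

(** The velocity of [N] is [O(t^2)], so [N = O(t^3)]; dividing by [z^2] and by [x + y] removes all
    three powers of [t]. *)
Lemma difference_bounded a b c x y z (d K t2 : R) :
  0 < d -> 0 < K -> 1 <= t2 ->
  (forall t, t2 <= t -> ode_at a b c x y z t) ->
  linear_bounds d K t2 x -> linear_bounds d K t2 y -> linear_bounds d K t2 z ->
  exists A, 0 <= A /\ forall t, t2 <= t -> Rabs (x t - y t) <= A.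
Proof.
  intros hd hK h2 H hx hy hz.
  set (N := fun t => z t ^ 2 * (x t ^ 2 - y t ^ 2)).
  set (N' := fun t => z t ^ 2 * (a - b) + c * (x t ^ 2 - y t ^ 2)
     + 2 * drift a b c (x t) (y t) (z t) * (z t ^ 2 * (x t ^ 2 - y t ^ 2))).
  set (A1 := K^2 * Rabs (a - b) + (Rabs a + Rabs b + Rabs c) * (1 + 2 * K^2 / d^2) * K^2).
  assert (hA1 : 0 <= A1).
  { unfold A1. assert (0 < K^2) by nra. assert (0 < d^2) by nra.
    assert (0 < 2 * K^2 / d^2) by (apply Rdiv_lt_0_compat; lra).
    generalize (Rabs_pos (a - b)) (Rabs_pos a) (Rabs_pos b) (Rabs_pos c); intros.
    apply Rplus_le_le_0_compat; [nra|].
    repeat apply Rmult_le_pos; lra. }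
  assert (hsq : forall t, t2 <= t -> Rabs (x t ^ 2 - y t ^ 2) <= K^2 * t^2).
  { intros t ht. specialize (hx t ht). specialize (hy t ht). assert (0 < d * t) by nra.
    assert (0 <= x t ^ 2 <= K^2 * t^2) by nra.
    assert (0 <= y t ^ 2 <= K^2 * t^2) by nra.
    apply Rabs_le_between. lra. }
  (* The factor 3 is slack, chosen so that [A1 * t^3] is a primitive of the bound. *)
  assert (hN' : forall t, t2 <= t -> Rabs (N' t) <= 3 * A1 * t^2).
  { intros t ht. unfold N'. rewrite Rplus_assoc.
    apply Rle_trans with (1 := Rabs_triang _ _).
    assert (hb := first_integral_derive_bound a b c x y z d K t2 t hd hK h2 hx hy hz ht).
    specialize (hsq t ht). specialize (hz t ht).
    rewrite Rabs_mult. rewrite (Rabs_right (z t ^ 2)) by (apply Rle_ge; nra).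
    assert (z t ^ 2 <= K^2 * t^2) by (assert (0 < d * t) by nra; nra).
    set (k' := (Rabs a + Rabs b + Rabs c) * (1 + 2 * K^2 / d^2)) in *.
    assert (0 <= k').
    { unfold k'. assert (0 < 2 * K^2 / d^2) by (apply Rdiv_lt_0_compat; nra).
      generalize (Rabs_pos a) (Rabs_pos b) (Rabs_pos c); intros. apply Rmult_le_pos; lra. }
    assert (z t ^ 2 * Rabs (a - b) <= K^2 * t^2 * Rabs (a - b))
      by (apply Rmult_le_compat_r; [apply Rabs_pos|lra]).
    assert (k' * Rabs (x t ^ 2 - y t ^ 2) <= k' * (K^2 * t^2)) by (apply Rmult_le_compat_l; lra).
    unfold A1.
    apply Rle_trans with (K^2 * t^2 * Rabs (a - b) + k' * (K^2 * t^2)); [lra|].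
    replace (K^2 * t^2 * Rabs (a - b) + k' * (K^2 * t^2)) with (A1 * t^2) by (unfold A1; ring).
    fold A1. nra. }
  assert (hd' : forall t, t2 <= t -> is_derive N t (N' t)).
  { intros t ht. apply is_derive_first_integral; auto. }
  assert (hN : forall t, t2 <= t -> Rabs (N t) <= (Rabs (N t2) + A1) * t^3).
  { intros t ht.
    assert (u1 : A1 * t2^3 - N t2 <= A1 * t^3 - N t).
    { apply (derive_nonneg_le (fun r => A1 * r^3 - N r) (fun r => 3 * A1 * r^2 - N' r)); auto.
      - intros r hr. assert (h := hd' r ltac:(lra)). clearbody N. auto_derive; [ex_der|]. rw_derive. ring.
      - intros r hr. generalize (hN' r ltac:(lra)) (Rle_abs (N' r)); lra. }
    assert (u2 : A1 * t2^3 + N t2 <= A1 * t^3 + N t).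
    { apply (derive_nonneg_le (fun r => A1 * r^3 + N r) (fun r => 3 * A1 * r^2 + N' r)); auto.
      - intros r hr. assert (h := hd' r ltac:(lra)). clearbody N. auto_derive; [ex_der|]. rw_derive. ring.
      - intros r hr. generalize (hN' r ltac:(lra)) (Rabs_maj2 (N' r)); lra. }
    assert (0 <= A1 * t2^3) by (apply Rmult_le_pos; auto; apply pow_le; lra).
    assert (1 <= t^3) by (apply pow_R1_Rle; lra).
    generalize (Rle_abs (N t2)) (Rabs_maj2 (N t2)) (Rabs_pos (N t2)); intros.
    apply Rabs_le_between. nra. }
  set (A2 := Rabs (N t2) + A1).
  assert (hA2 : 0 <= A2) by (unfold A2; generalize (Rabs_pos (N t2)); lra).
  exists (A2 / d^2 / (2 * d)). split.
  { unfold Rdiv. assert (0 < / d^2) by (apply Rinv_0_lt_compat; nra).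
    assert (0 < / (2 * d)) by (apply Rinv_0_lt_compat; nra).
    repeat apply Rmult_le_pos; lra. }
  intros t ht. specialize (hN t ht). fold A2 in hN.
  specialize (hx t ht). specialize (hy t ht). specialize (hz t ht).
  assert (0 < d * t) by nra.
  apply Rle_trans with ((A2 / d^2 * t) / (2 * (d * t))); [|right; field; nra].
  apply abs_diff_of_sq; try lra.
  unfold N in hN. rewrite Rabs_mult, (Rabs_right (z t ^ 2)) in hN by (apply Rle_ge; nra).
  apply Rmult_le_reg_l with ((d * t)^2); [nra|].
  replace ((d * t)^2 * (A2 / d^2 * t)) with (A2 * t^3) by (field; lra).
  apply Rle_trans with (2 := hN). apply Rmult_le_compat_r; [apply Rabs_pos|]. nra.
Qed.

Lemma static_difference_decay x y z (d K t2 : R) :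
  0 < d -> 0 < K -> 1 <= t2 ->
  (forall t, t2 <= t -> ode_at 0 0 0 x y z t) ->
  linear_bounds d K t2 x -> linear_bounds d K t2 y -> linear_bounds d K t2 z ->
  exists A, 0 <= A /\ forall t, t2 <= t -> Rabs (x t - y t) <= A / t^3.
Proof.
  intros hd hK h2 H hx hy hz.
  set (N := fun t => z t ^ 2 * (x t ^ 2 - y t ^ 2)).
  assert (hN : forall t, t2 <= t -> N t = N t2).
  { intros t ht. symmetry. apply derive_zero_const; auto. intros r hr.
    evar_last. apply (is_derive_first_integral 0 0 0); apply H; lra.
    destruct (H r ltac:(lra)) as ((p1 & p2 & p3) & _). unfold drift. field. lra. }
  exists (Rabs (N t2) / (2 * d^3)). split.
  { apply Rmult_le_pos; [apply Rabs_pos|]. left; apply Rinv_0_lt_compat.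
    assert (0 < d^3) by (apply pow_lt; auto). lra. }
  intros t ht. specialize (hN t ht).
  specialize (hx t ht). specialize (hy t ht). specialize (hz t ht).
  assert (0 < d * t) by nra.
  apply Rle_trans with ((Rabs (N t2) / (d * t)^2) / (2 * (d * t))); [|right; field; lra].
  apply abs_diff_of_sq; try lra.
  rewrite <- hN. unfold N. rewrite Rabs_mult, (Rabs_right (z t ^ 2)) by (apply Rle_ge; nra).
  apply Rmult_le_reg_l with ((d * t)^2); [nra|].
  replace ((d * t)^2 * (z t ^ 2 * Rabs (x t ^ 2 - y t ^ 2) / (d * t)^2))
    with (z t ^ 2 * Rabs (x t ^ 2 - y t ^ 2)) by (field; lra).
  apply Rmult_le_compat_r; [apply Rabs_pos|]. nra.
Qed.

(* The deviation from [1/2] is governed by the Schur polynomial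
   [x (x-y) (x-z) + y (y-x) (y-z) + z (z-x) (z-y)]. *)
Lemma mean_velocity_bound a b c x y z m M e :
  a + b + c = 0 -> 0 < m -> m <= x <= M -> m <= y <= M -> m <= z <= M ->
  Rabs (x - y) <= e -> Rabs (y - z) <= e -> Rabs (z - x) <= e ->
  Rabs ((vfield a b c x y z + vfield b c a y z x + vfield c a b z x y) / 3 - 1 / 2)
  <= (Rabs a + Rabs b) * e / m^2 + (Rabs a + Rabs b) * M^2 * e / m^4 + M * e^2 / m^3.
Proof.
  intros hs hm hx hy hz hxy hyz hzx.
  assert (he : 0 <= e) by (generalize (Rabs_pos (x - y)); lra).
  set (k := Rabs a + Rabs b).
  assert (hk : 0 <= k) by (unfold k; generalize (Rabs_pos a) (Rabs_pos b); lra).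
  set (S := x * (x - y) * (x - z) + y * (y - x) * (y - z) + z * (z - x) * (z - y)).
  (* With [c = - a - b], the sum [a / x + b / y + c / z] becomes [L] and
     [a / x^2 + b / y^2 + c / z^2] becomes [Q]: differences of reciprocals, small with [e]. *)
  set (L := a * ((z - x) * / (x * z)) + b * (- (y - z) * / (y * z))).
  set (Q := a * ((z - x) * ((z + x) * / (x * z)^2)) + b * (- (y - z) * ((y + z) * / (y * z)^2))).
  assert (eq : (vfield a b c x y z + vfield b c a y z x + vfield c a b z x y) / 3 - 1 / 2
    = L / 6 + - (Q * (x + y + z)) / 18 + - S * / (x * y * z) / 6).
  { unfold vfield, drift, L, Q, S. replace c with (- a - b) by lra. field. lra. }
  rewrite eq.
  assert (inv2 : forall v w, m <= v -> m <= w -> 0 < / (v * w) <= / m^2).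
  { intros v w hv hw. split.
    - apply Rinv_0_lt_compat. nra.
    - apply Rinv_le_contravar; nra. }
  assert (hmi : 0 < / m) by (apply Rinv_0_lt_compat; lra).
  assert (em2 : / m^2 = / m * / m) by (field; lra).
  assert (hL : Rabs L <= k * e / m^2).
  { unfold L. apply Rle_trans with (1 := Rabs_triang _ _).
    rewrite !Rabs_mult, Rabs_Ropp.
    rewrite (Rabs_right (/ (x * z))) by (generalize (inv2 x z); lra).
    rewrite (Rabs_right (/ (y * z))) by (generalize (inv2 y z); lra).
    replace (k * e / m^2) with (Rabs a * (e * / m^2) + Rabs b * (e * / m^2)) by (unfold k; field; lra).
    apply Rplus_le_compat; (apply Rmult_le_compat_l; [apply Rabs_pos|]);
      apply Rmult_le_compat; auto using Rabs_pos; try (apply inv2; lra);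
      left; apply inv2; lra. }
  assert (hQ : Rabs Q <= k * (e * (2 * M * / m^4))).
  { assert (inv4 : forall v w, m <= v <= M -> m <= w <= M ->
       0 <= (v + w) * / (v * w)^2 <= 2 * M * / m^4).
    { intros v w hv hw. destruct (inv2 v w) as [q1 q2]; try lra.
      replace (/ (v * w)^2) with (/ (v * w) * / (v * w)) by (field; lra).
      replace (/ m^4) with (/ m^2 * / m^2) by (field; lra).
      split.
      - apply Rmult_le_pos; [lra|nra].
      - apply Rmult_le_compat; [lra|nra|lra|]. apply Rmult_le_compat; lra. }
    unfold Q. apply Rle_trans with (1 := Rabs_triang _ _).
    rewrite (Rabs_mult a), (Rabs_mult b), (Rabs_mult (z - x)), (Rabs_mult (- (y - z))), Rabs_Ropp.
    rewrite (Rplus_comm z x).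
    rewrite (Rabs_right ((x + z) * _)) by (generalize (inv4 x z); lra).
    rewrite (Rabs_right ((y + z) * _)) by (generalize (inv4 y z); lra).
    unfold k. rewrite (Rmult_plus_distr_r (Rabs a) (Rabs b)).
    apply Rplus_le_compat; (apply Rmult_le_compat_l; [apply Rabs_pos|]);
      apply Rmult_le_compat; auto using Rabs_pos; apply inv4; lra. }
  assert (hS : Rabs S <= 3 * (M * e^2)).
  { assert (one : forall v p q, 0 <= v <= M -> Rabs p <= e -> Rabs q <= e -> Rabs (v * p * q) <= M * e^2).
    { intros v p q hv hp hq. rewrite !Rabs_mult, (Rabs_right v) by lra.
      replace (M * e^2) with (M * e * e) by ring.
      apply Rmult_le_compat; auto using Rabs_pos.
      - apply Rmult_le_pos; [lra|apply Rabs_pos].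
      - apply Rmult_le_compat; try lra; apply Rabs_pos. }
    unfold S. apply Rle_trans with (1 := Rabs_triang _ _).
    assert (hT := Rabs_triang (x * (x - y) * (x - z)) (y * (y - x) * (y - z))).
    assert (o1 := one x (x - y) (x - z) ltac:(lra) hxy ltac:(rewrite Rabs_minus_sym; auto)).
    assert (o2 := one y (y - x) (y - z) ltac:(lra) ltac:(rewrite Rabs_minus_sym; auto) hyz).
    assert (o3 := one z (z - x) (z - y) ltac:(lra) hzx ltac:(rewrite Rabs_minus_sym; auto)).
    lra. }
  assert (p3 : 0 < / (x * y * z) <= / m^3).
  { assert (0 < x * y) by nra. assert (m^2 <= x * y) by nra. split.
    - apply Rinv_0_lt_compat. nra.
    - apply Rinv_le_contravar; [apply pow_lt; lra|].
      replace (m^3) with (m^2 * m) by ring. apply Rmult_le_compat; nra. }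
  apply Rle_trans with (1 := Rabs_triang _ _).
  apply Rle_trans with (1 := Rplus_le_compat_r _ _ _ (Rabs_triang _ _)).
  unfold Rdiv. rewrite !Rabs_mult, !Rabs_Ropp, !Rabs_mult.
  rewrite (Rabs_right (/ 6)), (Rabs_right (/ 18)) by lra.
  rewrite (Rabs_right (/ (x * y * z))) by lra. rewrite (Rabs_right (x + y + z)) by lra.
  assert (hQ2 : Rabs Q * (x + y + z) <= k * (e * (2 * M * / m^4)) * (3 * M)).
  { apply Rmult_le_compat; auto using Rabs_pos; lra. }
  replace (k * (e * (2 * M * / m ^ 4)) * (3 * M)) with (6 * (k * M^2 * e * / m^4)) in hQ2 by ring.
  assert (hS2 : Rabs S * / (x * y * z) <= 3 * (M * e^2) * / m^3).
  { apply Rmult_le_compat; auto using Rabs_pos; lra. }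
  unfold Rdiv in hL.
  assert (0 <= k * M^2 * e * / m^4).
  { assert (0 < / m^4) by (apply Rinv_0_lt_compat, pow_lt; lra).
    repeat apply Rmult_le_pos; try lra. }
  assert (0 <= M * e^2 * / m^3).
  { assert (0 < / m^3) by (apply Rinv_0_lt_compat, pow_lt; lra).
    repeat apply Rmult_le_pos; try lra. }
  assert (0 <= k * e * / m^2).
  { repeat apply Rmult_le_pos; try lra. rewrite em2; nra. }
  lra.
Qed.

Lemma is_derive_mean a b c x y z t : ode_at a b c x y z t ->
  is_derive (fun s => (x s + y s + z s) / 3 - s / 2) t
   ((vfield a b c (x t) (y t) (z t) + vfield b c a (y t) (z t) (x t)
     + vfield c a b (z t) (x t) (y t)) / 3 - 1 / 2).
Proof.
  intros (_ & hx & hy & hz).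
  auto_derive; [ex_der|]. rw_derive. field.
Qed.

(** For functions comparable to [t] with bounded differences, all three terms of
    [mean_velocity_bound] are [O(t^-2)], with primitive [B / t]; so the mean minus [t / 2]
    converges. *)
Lemma asymptotically_half_linear a b c x y z (d K t2 A : R) :
  a + b + c = 0 -> 0 < d -> 0 < K -> 1 <= t2 -> 0 <= A ->
  (forall t, t2 <= t -> ode_at a b c x y z t) ->
  linear_bounds d K t2 x -> linear_bounds d K t2 y -> linear_bounds d K t2 z ->
  (forall t, t2 <= t -> Rabs (x t - y t) <= A /\ Rabs (y t - z t) <= A /\ Rabs (z t - x t) <= A) ->
  exists B, forall t, t2 <= t -> Rabs (x t - t / 2) <= B.
Proof.
  intros hs hd hK h2 hA H hx hy hz hdiff.
  set (k := Rabs a + Rabs b).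
  assert (hk : 0 <= k) by (unfold k; generalize (Rabs_pos a) (Rabs_pos b); lra).
  set (B := k * A / d^2 + k * K^2 * A / d^4 + K * A^2 / d^3).
  assert (q2 : 0 < / d^2) by (apply Rinv_0_lt_compat, pow_lt; auto).
  assert (q3 : 0 < / d^3) by (apply Rinv_0_lt_compat, pow_lt; auto).
  assert (q4 : 0 < / d^4) by (apply Rinv_0_lt_compat, pow_lt; auto).
  assert (hB : 0 <= B).
  { assert (0 <= k * A) by nra. assert (0 <= k * K^2 * A) by (apply Rmult_le_pos; nra).
    assert (0 <= K * A^2) by nra. unfold B, Rdiv.
    repeat apply Rplus_le_le_0_compat; apply Rmult_le_pos; lra. }
  destruct (limit_of_derive_bound (fun t => (x t + y t + z t) / 3 - t / 2)
    (fun t => (vfield a b c (x t) (y t) (z t) + vfield b c a (y t) (z t) (x t)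
     + vfield c a b (z t) (x t) (y t)) / 3 - 1 / 2)
    (fun t => B / t) (fun t => B / t^2) t2) as [l hl].
  - intros t ht. apply is_derive_mean; auto.
  - intros t ht. auto_derive; [lra|]. field. lra.
  - intros t ht. apply Rmult_le_pos; auto. left; apply Rinv_0_lt_compat; lra.
  - intros t ht. specialize (hx t ht). specialize (hy t ht). specialize (hz t ht).
    destruct (hdiff t ht) as (e1 & e2 & e3).
    assert (0 < d * t) by nra.
    apply Rle_trans with (1 := mean_velocity_bound a b c (x t) (y t) (z t) (d * t) (K * t) A
      hs H0 hx hy hz e1 e2 e3). fold k.
    assert (1 <= t) by lra.
    replace (k * A / (d * t)^2) with (k * A / d^2 / t^2) by (field; lra).
    replace (k * (K * t)^2 * A / (d * t)^4) with (k * K^2 * A / d^4 / t^2) by (field; lra).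
    replace (K * t * A^2 / (d * t)^3) with (K * A^2 / d^3 / t^2) by (field; lra).
    unfold B. right. field. lra.
  - exists (B + Rabs l + A). intros t ht. specialize (hl t ht).
    destruct (hdiff t ht) as (e1 & e2 & e3).
    assert (B / t <= B).
    { rewrite <- (Rmult_1_r B) at 2. apply Rmult_le_compat_l; auto.
      rewrite <- Rinv_1. apply Rinv_le_contravar; lra. }
    apply Rabs_le_between in hl. apply Rabs_le_between in e1.
    apply Rabs_le_between in e3. generalize (Rle_abs l) (Rabs_maj2 l); intros.
    apply Rabs_le_between. lra.
Qed.

(** Differences of size [t^-3] leave only the Schur term, which is [O(t^-8)], far below the [t^-4]
    used. The constant [l] is common to the three functions, so that one translation in time can
    remove it. *)
Lemma static_asymptotics x y z (d K t2 A : R) :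
  0 < d -> 0 < K -> 1 <= t2 -> 0 <= A ->
  (forall t, t2 <= t -> ode_at 0 0 0 x y z t) ->
  linear_bounds d K t2 x -> linear_bounds d K t2 y -> linear_bounds d K t2 z ->
  (forall t, t2 <= t -> Rabs (x t - y t) <= A / t^3 /\ Rabs (y t - z t) <= A / t^3
     /\ Rabs (z t - x t) <= A / t^3) ->
  exists l B, 0 <= B /\ forall t, t2 <= t ->
    Rabs (x t - t / 2 - l) <= B / t^3 /\ Rabs (y t - t / 2 - l) <= B / t^3
    /\ Rabs (z t - t / 2 - l) <= B / t^3.
Proof.
  intros hd hK h2 hA H hx hy hz hdiff.
  set (B := K * A^2 / d^3).
  assert (q3 : 0 < / d^3) by (apply Rinv_0_lt_compat, pow_lt; auto).
  assert (hB : 0 <= B).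
  { assert (0 <= K * A^2) by nra. unfold B, Rdiv. apply Rmult_le_pos; lra. }
  assert (ht3 : forall t, t2 <= t -> 1 <= t^3) by (intros; apply pow_R1_Rle; lra).
  destruct (limit_of_derive_bound (fun t => (x t + y t + z t) / 3 - t / 2)
    (fun t => (vfield 0 0 0 (x t) (y t) (z t) + vfield 0 0 0 (y t) (z t) (x t)
     + vfield 0 0 0 (z t) (x t) (y t)) / 3 - 1 / 2)
    (fun t => B / t^3) (fun t => 3 * B / t^4) t2) as [l hl].
  - intros t ht. apply is_derive_mean; auto.
  - intros t ht. assert (1 <= t) by lra. auto_derive.
    + apply Rgt_not_eq. specialize (ht3 t ht). simpl in *. lra.
    + field. lra.
  - intros t ht. apply Rmult_le_pos; auto. left; apply Rinv_0_lt_compat. specialize (ht3 t ht); lra.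
  - intros t ht. specialize (hx t ht). specialize (hy t ht). specialize (hz t ht).
    destruct (hdiff t ht) as (e1 & e2 & e3). specialize (ht3 t ht).
    assert (0 < d * t) by nra.
    apply Rle_trans with (1 := mean_velocity_bound 0 0 0 (x t) (y t) (z t) (d * t) (K * t) (A / t^3)
      ltac:(lra) H0 hx hy hz e1 e2 e3).
    assert (1 <= t) by lra. rewrite Rabs_R0.
    replace ((0 + 0) * (A / t ^ 3) / (d * t) ^ 2 + (0 + 0) * (K * t) ^ 2 * (A / t ^ 3) / (d * t) ^ 4 +
       K * t * (A / t ^ 3) ^ 2 / (d * t) ^ 3) with (B / t^4 * / t^4) by (unfold B; field; lra).
    assert (0 < / t^4) by (apply Rinv_0_lt_compat, pow_lt; lra).
    assert (/ t^4 <= 1).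
    { rewrite <- Rinv_1. apply Rinv_le_contravar; [lra|]. apply pow_R1_Rle; lra. }
    unfold Rdiv. assert (0 <= B * / t^4) by (apply Rmult_le_pos; lra). nra.
  - exists l, (A + B). split; [lra|]. intros t ht. specialize (hl t ht). specialize (ht3 t ht).
    destruct (hdiff t ht) as (e1 & e2 & e3).
    apply Rabs_le_between in hl. apply Rabs_le_between in e1.
    apply Rabs_le_between in e2. apply Rabs_le_between in e3.
    replace ((A + B) / t^3) with (A / t^3 + B / t^3) by (field; lra).
    repeat split; apply Rabs_le_between; lra.
Qed.

(* If [a > b] the first integral [z^2 (x^2 - y^2)] grows like [t^3], which
   [x - y -> 0] forbids. *)
Lemma differences_vanish_le a b c x y z (d K t2 A : R) :
  0 < d -> 0 < K -> 1 <= t2 ->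
  (forall t, t2 <= t -> ode_at a b c x y z t) ->
  linear_bounds d K t2 x -> linear_bounds d K t2 y -> linear_bounds d K t2 z ->
  0 <= A -> (forall t, t2 <= t -> Rabs (x t - y t) <= A) ->
  (forall e, 0 < e -> exists t3, forall t, t3 <= t -> Rabs (x t - y t) <= e) ->
  a <= b.
Proof.
  intros hd hK h2 H hx hy hz hA hdiff hlim.
  destruct (Rle_lt_dec a b) as [|hab]; auto. exfalso.
  set (N := fun t => z t ^ 2 * (x t ^ 2 - y t ^ 2)).
  set (N' := fun t => z t ^ 2 * (a - b) + c * (x t ^ 2 - y t ^ 2)
     + 2 * drift a b c (x t) (y t) (z t) * (z t ^ 2 * (x t ^ 2 - y t ^ 2))).
  set (ka := d^2 * (a - b)).
  assert (hka : 0 < ka) by (unfold ka; apply Rmult_lt_0_compat; [apply pow_lt|]; lra).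
  set (k' := (Rabs a + Rabs b + Rabs c) * (1 + 2 * K^2 / d^2)).
  assert (hk' : 0 <= k').
  { unfold k'. assert (0 < 2 * K^2 / d^2) by (apply Rdiv_lt_0_compat; nra).
    generalize (Rabs_pos a) (Rabs_pos b) (Rabs_pos c); intros. apply Rmult_le_pos; lra. }
  assert (hsum : forall t, t2 <= t -> Rabs (x t ^ 2 - y t ^ 2) <= Rabs (x t - y t) * (2 * K * t)).
  { intros t ht. specialize (hx t ht). specialize (hy t ht). assert (0 < d * t) by nra.
    replace (x t ^ 2 - y t ^ 2) with ((x t - y t) * (x t + y t)) by ring.
    rewrite Rabs_mult. apply Rmult_le_compat_l; [apply Rabs_pos|].
    rewrite Rabs_right; lra. }
  set (B := k' * A * (2 * K)).
  assert (hB : 0 <= B) by (unfold B; apply Rmult_le_pos; [apply Rmult_le_pos|]; lra).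
  assert (hN' : forall t, t2 <= t -> ka * t^2 - B * t <= N' t).
  { intros t ht. unfold N'. rewrite Rplus_assoc.
    assert (hb := first_integral_derive_bound a b c x y z d K t2 t hd hK h2 hx hy hz ht).
    fold k' in hb. specialize (hsum t ht). specialize (hdiff t ht). specialize (hz t ht).
    assert (0 < d * t) by nra.
    assert ((d * t)^2 * (a - b) <= z t ^ 2 * (a - b))
      by (apply Rmult_le_compat_r; [lra|apply pow_incr; lra]).
    replace ((d * t)^2 * (a - b)) with (ka * t^2) in H1 by (unfold ka; ring).
    assert (k' * Rabs (x t ^ 2 - y t ^ 2) <= k' * (A * (2 * K * t))).
    { apply Rmult_le_compat_l; auto. apply Rle_trans with (1 := hsum).
      apply Rmult_le_compat_r; auto. assert (0 < K * t) by nra. lra. }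
    replace (k' * (A * (2 * K * t))) with (B * t) in H2 by (unfold B; ring).
    apply Rabs_le_between in hb. lra. }
  (* This [e] bounds [N] by [2 K^3 e t^3 = ka / 8 * t^3], below the growth [ka / 6 * t^3] that the
     derivative forces; the gap [ka / 24] dictates [t5]. *)
  set (e := ka / (16 * K^3)).
  assert (hK3 : 0 < K^3) by (apply pow_lt; auto).
  assert (he : 0 < e) by (unfold e; apply Rdiv_lt_0_compat; lra).
  destruct (hlim e he) as [t3 ht3].
  (* Beyond [t4] the error [B t] is at most half of [ka t^2]. *)
  set (t4 := t2 + Rabs t3 + 2 * B / ka).
  assert (hBk : 0 <= 2 * B / ka) by (apply Rmult_le_pos; [lra|left; apply Rinv_0_lt_compat; lra]).
  assert (ht4 : t2 <= t4 /\ t3 <= t4 /\ 2 * B <= ka * t4).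
  { unfold t4. generalize (Rle_abs t3) (Rabs_pos t3); intros. repeat split; try lra.
    replace (2 * B) with (ka * (2 * B / ka)) at 1 by (field; lra).
    apply Rmult_le_compat_l; lra. }
  assert (hgrow : forall t, t4 <= t -> N t4 - ka / 6 * t4^3 <= N t - ka / 6 * t^3).
  { intros t ht. apply (derive_nonneg_le (fun r => N r - ka / 6 * r^3) (fun r => N' r - ka / 2 * r^2)); auto.
    - intros r hr. assert (h : is_derive N r (N' r)) by (apply is_derive_first_integral, H; lra).
      clearbody N. auto_derive; [ex_der|]. rw_derive. field.
    - intros r hr. specialize (hN' r ltac:(lra)).
      assert (2 * B * r <= ka * r * r).
      { apply Rmult_le_compat_r; [lra|]. apply Rle_trans with (ka * t4); [lra|].
        apply Rmult_le_compat_l; lra. }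
      nra. }
  assert (hup : forall t, t4 <= t -> N t <= ka / 8 * t^3).
  { intros t ht. assert (t2 <= t) by lra.
    specialize (hsum t H0). specialize (ht3 t ltac:(lra)). specialize (hz t H0).
    assert (0 < d * t) by nra. assert (0 < K * t) by nra.
    unfold N. apply Rle_trans with (z t ^ 2 * Rabs (x t ^ 2 - y t ^ 2)).
    { apply Rmult_le_compat_l; [apply pow2_ge_0|apply Rle_abs]. }
    apply Rle_trans with ((K * t)^2 * (e * (2 * K * t))).
    - apply Rmult_le_compat; [apply pow2_ge_0|apply Rabs_pos|apply pow_incr; lra|].
      apply Rle_trans with (1 := hsum). apply Rmult_le_compat_r; lra.
    - right. unfold e. field. lra. }
  set (q := Rabs (N t4 - ka / 6 * t4^3)).
  set (t5 := t4 + 24 * (q + 1) / ka).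
  assert (hq : 0 <= q) by apply Rabs_pos.
  assert (0 < 24 * (q + 1) / ka) by (apply Rdiv_lt_0_compat; lra).
  assert (h5 : t4 <= t5) by (unfold t5; lra).
  assert (ka / 24 * t5 <= ka / 24 * t5^3).
  { apply Rmult_le_compat_l; [lra|]. assert (1 <= t5) by lra.
    assert (1 <= t5^2) by (apply pow_R1_Rle; lra). simpl in *. nra. }
  assert (q + 1 <= ka / 24 * t5).
  { replace (q + 1) with (ka / 24 * (24 * (q + 1) / ka)) by (field; lra).
    apply Rmult_le_compat_l; [lra|]. unfold t5; lra. }
  generalize (hgrow t5 h5) (hup t5 h5) (Rabs_maj2 (N t4 - ka / 6 * t4^3)). fold q. lra.
Qed.

(** * Derivative estimates *)

Definition near_infinity (P : R -> Prop) : Prop := Rbar_locally p_infty P.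

Lemma near_infinity_ge (M : R) (P : R -> Prop) : (forall t, M <= t -> P t) -> near_infinity P.
Proof. intros H. exists M. intros t ht. apply H. lra. Qed.

Lemma near_infinity_and (P Q : R -> Prop) :
  near_infinity P -> near_infinity Q -> near_infinity (fun t => P t /\ Q t).
Proof. apply (filter_and (F := Rbar_locally p_infty)). Qed.

Lemma near_infinity_imp (P Q : R -> Prop) :
  (forall t, P t -> Q t) -> near_infinity P -> near_infinity Q.
Proof. apply (filter_imp (F := Rbar_locally p_infty)). Qed.

Lemma near_infinity_locally (P : R -> Prop) : near_infinity P -> near_infinity (fun t => locally t P).
Proof.
  intros [M H]. exists M. intros t ht.
  apply (locally_interval _ t M p_infty); simpl; auto.
Qed.

(** Symbols of order [k], controlled up to [m] derivatives: each derivative lowers the order by one.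
    Derivatives are given by witnesses [g] rather than by [Derive], so that closure under algebra
    amounts to exhibiting formulas. *)
Fixpoint symbol (m : nat) (k : R) (h : R -> R) : Prop :=
  (exists K, near_infinity (fun t => Rabs (h t) <= K * Rpower t k)) /\
  match m with
  | O => True
  | S m' => exists g, near_infinity (fun t => is_derive h t (g t)) /\ symbol m' (k - 1) g
  end.

Lemma symbol_bound m k h : symbol m k h ->
  exists K, near_infinity (fun t => Rabs (h t) <= K * Rpower t k).
Proof. destruct m; simpl; tauto. Qed.

Lemma symbol_eq_order m k l h : k = l -> symbol m k h -> symbol m l h.
Proof. intros ->; auto. Qed.

Lemma symbol_ext m k h g : near_infinity (fun t => h t = g t) -> symbol m k h -> symbol m k g.
Proof.
  intros he hs.
  assert (hb : exists K, near_infinity (fun t => Rabs (g t) <= K * Rpower t k)).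
  { destruct (symbol_bound m k h hs) as [K hK]. exists K.
    apply (near_infinity_imp _ _ ) with (2 := near_infinity_and _ _ he hK).
    intros t [e ht]. rewrite <- e; auto. }
  destruct m as [|m]; simpl in *; split; auto.
  destruct hs as [_ (h' & hd & hs)]. exists h'. split; auto.
  apply (near_infinity_imp _ _ ) with (2 := near_infinity_and _ _ (near_infinity_locally _ he) hd).
  intros t [e ht]. apply (is_derive_ext_loc h); auto.
Qed.

Lemma symbol_pred m k h : symbol (S m) k h -> symbol m k h.
Proof.
  revert k h. induction m; intros k h [hb (g & hg & hs)].
  - simpl; auto.
  - split; auto. exists g. split; auto.
Qed.

Lemma symbol_le m n k h : (n <= m)%nat -> symbol m k h -> symbol n k h.
Proof. induction 1; auto. intros; apply IHle, symbol_pred; auto. Qed.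

Lemma symbol_weaken m k l h : k <= l -> symbol m k h -> symbol m l h.
Proof.
  revert k l h. induction m; intros k l h hkl [[K hK] hs]; split.
  1, 3: exists (Rabs K);
    apply (near_infinity_imp _ _) with (2 := near_infinity_and _ _ hK (near_infinity_ge 1 (fun t => 1 <= t) (fun t ht => ht)));
    intros t [h1 h2]; apply Rle_trans with (1 := h1);
    assert (0 < Rpower t k) by apply exp_pos;
    assert (Rpower t k <= Rpower t l) by (apply Rle_Rpower; lra);
    generalize (Rle_abs K) (Rabs_pos K); nra.
  - exact I.
  - destruct hs as (g & hg & hs). exists g. split; auto. apply (IHm (k - 1)); auto; lra.
Qed.

Lemma symbol_plus m k h g : symbol m k h -> symbol m k g -> symbol m k (fun t => h t + g t).
Proof.
  revert k h g. induction m; intros k h g [[K1 hK1] hs1] [[K2 hK2] hs2]; split.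
  1, 3: exists (K1 + K2); apply (near_infinity_imp _ _) with (2 := near_infinity_and _ _ hK1 hK2);
    intros t [h1 h2]; apply Rle_trans with (1 := Rabs_triang _ _); lra.
  - exact I.
  - destruct hs1 as (h' & hd1 & hs1), hs2 as (g' & hd2 & hs2).
    exists (fun t => h' t + g' t). split; auto.
    apply (near_infinity_imp _ _) with (2 := near_infinity_and _ _ hd1 hd2).
    intros t [e1 e2]. apply (is_derive_plus h g); auto.
Qed.

Lemma symbol_mult m k l h g : symbol m k h -> symbol m l g -> symbol m (k + l) (fun t => h t * g t).
Proof.
  revert k l h g. induction m; intros k l h g s1 s2;
    pose proof s1 as [[K1 hK1] hs1]; pose proof s2 as [[K2 hK2] hs2]; split.
  1, 3: exists (K1 * K2); apply (near_infinity_imp _ _) with (2 := near_infinity_and _ _ hK1 hK2);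
    intros t [h1 h2]; rewrite Rabs_mult, Rpower_plus;
    replace (K1 * K2 * (Rpower t k * Rpower t l)) with ((K1 * Rpower t k) * (K2 * Rpower t l)) by ring;
    apply Rmult_le_compat; auto using Rabs_pos.
  - exact I.
  - destruct hs1 as (h' & hd1 & hs1), hs2 as (g' & hd2 & hs2).
    exists (fun t => h' t * g t + h t * g' t). split.
    + apply (near_infinity_imp _ _) with (2 := near_infinity_and _ _ hd1 hd2).
      intros t [e1 e2]. auto_derive; [ex_der|]. rw_derive. ring.
    + apply symbol_plus.
      * apply (symbol_eq_order _ (k - 1 + l)); [ring|]. apply IHm; auto. apply symbol_pred; auto.
      * apply (symbol_eq_order _ (k + (l - 1))); [ring|]. apply IHm; auto. apply symbol_pred; auto.
Qed.

Lemma symbol_zero m k : symbol m k (fun _ => 0).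
Proof.
  revert k. induction m; intros k; split; auto; try exact I.
  1, 2: exists 0; apply (near_infinity_ge 0); intros; rewrite Rabs_R0; lra.
  exists (fun _ => 0). split; auto.
  apply (near_infinity_ge 0); intros. apply (is_derive_const 0).
Qed.

Lemma symbol_const m c : symbol m 0 (fun _ => c).
Proof.
  assert (hb : exists K, near_infinity (fun t => Rabs c <= K * Rpower t 0)).
  { exists (Rabs c). apply (near_infinity_ge 1). intros t ht. rewrite Rpower_O; lra. }
  destruct m; split; auto.
  exists (fun _ => 0). split; [|apply symbol_zero].
  apply (near_infinity_ge 0); intros. apply (is_derive_const c).
Qed.

Lemma symbol_id m : symbol m 1 (fun t => t).
Proof.
  assert (hb : exists K, near_infinity (fun t => Rabs t <= K * Rpower t 1)).
  { exists 1. apply (near_infinity_ge 1). intros t ht. rewrite Rpower_1, Rabs_right; lra. }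
  destruct m; split; auto.
  exists (fun _ => 1). split.
  - apply (near_infinity_ge 0); intros. apply (is_derive_id t).
  - apply (symbol_eq_order _ 0); [ring|apply symbol_const].
Qed.

Lemma symbol_scal m k c h : symbol m k h -> symbol m k (fun t => c * h t).
Proof.
  intros hs. apply (symbol_eq_order _ (0 + k)); [ring|].
  apply (symbol_mult m 0 k (fun _ => c) h); auto. apply symbol_const.
Qed.

(** The derivative [- h' / h^2] has order [0 - 2] and involves [/ h] with one derivative less, which
    the induction provides. *)
Lemma symbol_inv m d h : 0 < d -> near_infinity (fun t => d * t <= h t) ->
  symbol m 1 h -> symbol m (-1) (fun t => / h t).
Proof.
  intros hd hlow.
  assert (hb : exists K, near_infinity (fun t => Rabs (/ h t) <= K * Rpower t (-1))).
  { exists (/ d).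
    apply (near_infinity_imp _ _) with (2 := near_infinity_and _ _ hlow (near_infinity_ge 1 (fun t => 1 <= t) (fun t ht => ht))).
    intros t [h1 h2]. assert (0 < d * t) by nra.
    replace (-1) with (Ropp 1) by ring. rewrite Rpower_Ropp, Rpower_1 by lra. rewrite Rabs_right.
    - rewrite <- Rinv_mult. apply Rinv_le_contravar; lra.
    - left; apply Rinv_0_lt_compat; lra. }
  induction m; intros hs; split; auto.
  specialize (IHm (symbol_pred _ _ _ hs)).
  destruct hs as [_ (h' & hd' & hs)].
  exists (fun t => -1 * (h' t * (/ h t * / h t))). split.
  - apply (near_infinity_imp _ _) with (2 := near_infinity_and _ _ hd' (near_infinity_and _ _ hlow
      (near_infinity_ge 1 (fun t => 1 <= t) (fun t ht => ht)))).
    intros t (e1 & h1 & h2). assert (0 < d * t) by nra.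
    auto_derive; [ex_der|]. rw_derive. field. lra.
  - apply symbol_scal. apply (symbol_eq_order _ ((1 - 1) + (-1 + -1))); [ring|].
    repeat apply symbol_mult; auto.
Qed.

(** [Derive_n] adds derivatives on the outside, whereas [symbol] peels them off from the inside. *)
Lemma Derive_n_S_shift h m t : Derive_n h (S m) t = Derive_n (Derive h) m t.
Proof.
  revert t. induction m; intros t; [reflexivity|].
  change (Derive (Derive_n h (S m)) t = Derive (Derive_n (Derive h) m) t).
  apply Derive_ext. auto.
Qed.

Lemma symbol_Derive_n m k h : symbol m k h ->
  exists K, near_infinity (fun t => ex_derive_n h m t /\ Rabs (Derive_n h m t) <= K * Rpower t (k - INR m)).
Proof.
  revert k h. induction m; intros k h hs.
  - destruct (symbol_bound _ _ _ hs) as [K hK]. exists K.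
    apply (near_infinity_imp _ _) with (2 := hK). intros t ht. simpl. split; auto.
    rewrite Rminus_0_r; auto.
  - destruct hs as [_ (g & hg & hs)].
    destruct (IHm _ _ hs) as [K hK]. exists K.
    apply (near_infinity_imp _ _) with (2 := near_infinity_and _ _ (near_infinity_locally _ hg) (near_infinity_and _ _ hg hK)).
    intros t (h1 & h2 & h3 & h4).
    assert (hloc : locally t (fun s => Derive h s = g s)).
    { apply filter_imp with (2 := h1). intros s hs'. apply is_derive_unique; auto. }
    assert (hn : forall n, locally t (fun s => Derive_n (Derive h) n s = Derive_n g n s)).
    { intros n. apply locally_locally in hloc. apply filter_imp with (2 := hloc).
      intros s hs'. apply Derive_n_ext_loc; auto. }
    split.
    + destruct m as [|m].
      * simpl. eexists; exact h2.
      * simpl in h3 |- *. apply (ex_derive_ext_loc (Derive_n g m)); auto.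
        apply filter_imp with (2 := hn m). intros s e.
        change (Derive_n g m s = Derive_n h (S m) s). rewrite Derive_n_S_shift; auto.
    + rewrite Derive_n_S_shift. rewrite (locally_singleton _ _ (hn m)).
      rewrite S_INR. replace (k - (INR m + 1)) with (k - 1 - INR m) by ring. auto.
Qed.

(** The gain of one order. In [y^2 + z^2 - x^2 - y z] the terms in [t^2] cancel, leaving
    [t ((Y + Z) / 2 - X)] and products of deviations, over [2 y z]. The constants must themselves be
    symbols of order [k]: any constant for [k = 0], only zero for [k = -3]. *)
Lemma symbol_field m k a b c X Y Z : k <= 0 ->
  (forall e, In e (a :: b :: c :: nil) -> symbol m k (fun _ => e)) ->
  symbol m k X -> symbol m k Y -> symbol m k Z ->
  symbol m (k - 1) (fun t => vfield a b c (t / 2 + X t) (t / 2 + Y t) (t / 2 + Z t) - 1 / 2).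
Proof.
  intros hk hc hX hY hZ.
  assert (lin : forall W, symbol m k W -> symbol m 1 (fun t => t / 2 + W t) /\
     near_infinity (fun t => / 4 * t <= t / 2 + W t)).
  { intros W hW. split.
    - apply symbol_plus.
      + apply (symbol_ext _ _ (fun t => / 2 * t)).
        * apply (near_infinity_ge 0). intros; field.
        * apply symbol_scal, symbol_id.
      + apply (symbol_weaken _ k); auto; lra.
    - assert (hW0 : symbol 0 0 W) by (apply (symbol_weaken _ k); auto; apply (symbol_le m); auto; apply Nat.le_0_l).
      destruct hW0 as [[K hK] _].
      apply (near_infinity_imp _ _) with (2 := near_infinity_and _ _ hK (near_infinity_ge (1 + 4 * Rabs K) (fun t => 1 + 4 * Rabs K <= t) (fun t ht => ht))).
      intros t [h1 h2]. generalize (Rle_abs K) (Rabs_pos K); intros.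
      rewrite Rpower_O in h1 by lra. apply Rabs_le_between in h1. lra. }
  destruct (lin X hX) as [lX bX], (lin Y hY) as [lY bY], (lin Z hZ) as [lZ bZ].
  assert (iX := symbol_inv m (/ 4) _ ltac:(lra) bX lX).
  assert (iY := symbol_inv m (/ 4) _ ltac:(lra) bY lY).
  assert (iZ := symbol_inv m (/ 4) _ ltac:(lra) bZ lZ).
  set (x := fun t => t / 2 + X t) in *. set (y := fun t => t / 2 + Y t) in *.
  set (z := fun t => t / 2 + Z t) in *.
  assert (ha : symbol m k (fun _ => a)) by (apply hc; simpl; auto).
  assert (hb : symbol m k (fun _ => b)) by (apply hc; simpl; auto).
  assert (hc' : symbol m k (fun _ => c)) by (apply hc; simpl; auto).
  apply (symbol_ext _ _ (fun t => (/ 2 * (a * / x t)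
     + (- / 6) * (((a * (/ x t * / x t) + b * (/ y t * / y t)) + c * (/ z t * / z t)) * x t))
     + / 2 * (((t * (/ 2 * (Y t + Z t) + -1 * X t)) + ((Y t * Y t + Z t * Z t) + -1 * (X t * X t + Y t * Z t)))
         * (/ y t * / z t)))).
  { apply (near_infinity_imp _ _) with (2 := near_infinity_and _ _ (near_infinity_and _ _ bX (near_infinity_and _ _ bY bZ))
      (near_infinity_ge 1 (fun t => 1 <= t) (fun t ht => ht))).
    intros t ((q1 & q2 & q3) & ht). fold (x t) (y t) (z t).
    assert (eX : X t = x t - t / 2) by (unfold x; ring).
    assert (eY : Y t = y t - t / 2) by (unfold y; ring).
    assert (eZ : Z t = z t - t / 2) by (unfold z; ring).
    rewrite eX, eY, eZ. clearbody x y z.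
    unfold vfield, drift. field. lra. }
  apply symbol_plus; [apply symbol_plus|].
  - apply symbol_scal. apply (symbol_mult m k (-1)); auto.
  - apply symbol_scal. apply (symbol_eq_order _ ((k + (-1 + -1)) + 1)); [ring|].
    apply symbol_mult; auto.
    repeat apply symbol_plus; repeat apply symbol_mult; auto.
  - apply symbol_scal. apply (symbol_eq_order _ ((1 + k) + (-1 + -1))); [ring|].
    apply symbol_mult; [|apply symbol_mult; auto].
    assert (quad : forall V W, symbol m k V -> symbol m k W -> symbol m (1 + k) (fun t => V t * W t)).
    { intros V W hV hW. apply (symbol_weaken _ (k + k)); [lra|]. apply symbol_mult; auto. }
    apply symbol_plus.
    + apply symbol_mult; [apply symbol_id|].
      apply symbol_plus; apply symbol_scal; auto. apply symbol_plus; auto.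
    + repeat first [apply symbol_plus | apply symbol_scal]; auto.
Qed.

(** If the deviations have [m] controlled derivatives, so have their velocities, one order lower;
    hence the deviations have [S m] of them. Only the pointwise estimate has to be supplied. *)
Lemma symbol_bootstrap k a b c x y z : k <= 0 ->
  (forall m e, In e (a :: b :: c :: nil) -> symbol m k (fun _ => e)) ->
  near_infinity (ode_at a b c x y z) ->
  symbol 0 k (fun t => x t - t / 2) -> symbol 0 k (fun t => y t - t / 2) ->
  symbol 0 k (fun t => z t - t / 2) ->
  forall m, symbol m k (fun t => x t - t / 2) /\ symbol m k (fun t => y t - t / 2) /\
            symbol m k (fun t => z t - t / 2).
Proof.
  intros hk hc ho hx hy hz. induction m as [|m (h1 & h2 & h3)]; auto.
  assert (step : forall a b c x y z,
    (forall e, In e (a :: b :: c :: nil) -> symbol m k (fun _ => e)) ->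
    near_infinity (ode_at a b c x y z) ->
    symbol m k (fun t => x t - t / 2) -> symbol m k (fun t => y t - t / 2) ->
    symbol m k (fun t => z t - t / 2) -> symbol (S m) k (fun t => x t - t / 2)).
  { clear - hk. intros a b c x y z hc ho h1 h2 h3. split; [apply (symbol_bound m); auto|].
    exists (fun t => vfield a b c (x t) (y t) (z t) - 1 / 2). split.
    - apply (near_infinity_imp _ _) with (2 := ho). intros t (_ & hx & _).
      auto_derive; [ex_der|]. rw_derive. field.
    - apply (symbol_ext _ _ (fun t => vfield a b c (t / 2 + (x t - t / 2)) (t / 2 + (y t - t / 2)) (t / 2 + (z t - t / 2)) - 1 / 2)).
      + apply (near_infinity_ge 0). intros t _. repeat f_equal; ring.
      + apply symbol_field; auto. }
  split; [|split].
  - apply (step a b c x y z); auto.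
  - apply (step b c a y z x); auto.
    + intros e he. apply hc. simpl in *; tauto.
    + apply (near_infinity_imp _ _) with (2 := ho). intros t. apply ode_at_rot.
  - apply (step c a b z x y); auto.
    + intros e he. apply hc. simpl in *; tauto.
    + apply (near_infinity_imp _ _) with (2 := ho). intros t. intros h. apply ode_at_rot, ode_at_rot; auto.
Qed.

(** * The exponential regime *)

Lemma exp_ge_1_plus (v : R) : 1 + v <= exp v.
Proof.
  destruct (Req_dec v 0) as [->|h].
  - rewrite exp_0; lra.
  - left. apply exp_ineq1; auto.
Qed.

Lemma exp_decay_small (k e : R) : 0 < k -> 0 < e -> exists t3, forall t, t3 <= t -> exp (- k * t) <= e.
Proof.
  intros hk he. exists (/ (e * k)). intros t ht.
  replace (- k * t) with (- (k * t)) by ring.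
  rewrite exp_Ropp. rewrite <- (Rinv_inv e).
  apply Rinv_le_contravar; [apply Rinv_0_lt_compat; auto|].
  apply Rle_trans with (2 := exp_ge_1_plus _).
  assert (/ e <= k * t).
  { replace (/ e) with (k * / (e * k)) by (field; lra). apply Rmult_le_compat_l; lra. }
  lra.
Qed.

Lemma exp_le_1_plus_double (v : R) : 0 <= v <= / 2 -> exp v <= 1 + 2 * v.
Proof.
  intros hv. assert (h := exp_ge_1_plus (- v)). rewrite exp_Ropp in h.
  assert (0 < exp v) by apply exp_pos.
  assert (1 + - v <= / exp v) by auto.
  assert (exp v * (1 - v) <= 1).
  { replace 1 with (exp v * / exp v) at 2 by (field; lra). apply Rmult_le_compat_l; lra. }
  nra.
Qed.

Definition trapped (a b c k t0 : R) (x y z : R -> R) : Prop :=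
  forall t, t0 < t -> ode_at a b c x y z t /\ z t <= y t <= x t /\ z t <= k.

(** [p' >= (x^2 + y^2) / 2 >= x y = p / z >= p / k]. The rate appears as the square of
    [exp (- / (2 * k) * t)] because that exponential is the unit in which the later errors decay. *)
Lemma volume_growth a b c k t0 x y z t1 : a + b + c = 0 -> 0 < k -> trapped a b c k t0 x y z -> t0 < t1 ->
  exists P0, 0 < P0 /\ forall t, t1 <= t -> P0 <= x t * y t * z t * (exp (- / (2 * k) * t))^2.
Proof.
  intros hs hk H h1.
  set (p := fun t => x t * y t * z t).
  assert (hp : forall t, t0 < t -> 0 < p t).
  { intros t ht. destruct (H t ht) as (((p1 & p2 & p3) & _) & _). unfold p.
    repeat apply Rmult_lt_0_compat; auto. }
  assert (hd : forall t, t0 < t -> is_derive p t ((x t ^ 2 + y t ^ 2 + z t ^ 2) / 2)).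
  { intros t ht. apply (is_derive_prod a b c); auto. apply H; auto. }
  exists (p t1 * (exp (- / (2 * k) * t1))^2). split.
  { apply Rmult_lt_0_compat; [auto|apply pow_lt, exp_pos]. }
  intros t ht.
  apply (derive_nonneg_le (fun t => p t * (exp (- / (2 * k) * t))^2)
    (fun t => ((x t ^ 2 + y t ^ 2 + z t ^ 2) / 2 - p t / k) * (exp (- / (2 * k) * t))^2)); auto.
  - intros r hr. assert (h := hd r ltac:(lra)). clearbody p. auto_derive; [ex_der|].
    rw_derive. field. lra.
  - intros r hr. apply Rmult_le_pos; [|apply pow_le; left; apply exp_pos].
    destruct (H r ltac:(lra)) as (((p1 & p2 & p3) & _) & h2 & h3).
    assert (p r / k <= x r * y r).
    { apply Rmult_le_reg_r with k; auto. unfold Rdiv. rewrite Rmult_assoc, Rinv_l, Rmult_1_r by lra.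
      unfold p. apply Rmult_le_compat_l; nra. }
    generalize (pow2_ge_0 (x r - y r)) (pow2_ge_0 (z r)). nra.
Qed.

(** The pull on [ln (x / y)] has strength [/ k], twice [ka]: one half absorbs the volume term, the
    other half is left for the decay. The bound on [/ y^2] is volume growth, through
    [/ y^2 = (x / y) z / p]. *)
Lemma ratio_decay a b c k t0 x y z : a + b + c = 0 -> 0 < k -> Rabs a + Rabs b + Rabs c <= k ->
  trapped a b c k t0 x y z ->
  exists M t2, 0 <= M /\ t0 < t2 /\ 0 <= t2 /\ forall t, t2 <= t ->
    1 <= x t / y t <= 2 /\ x t / y t - 1 <= M * exp (- / (2 * k) * t) /\
    / y t ^ 2 <= M * exp (- / (2 * k) * t).
Proof.
  intros hs hk habc H.
  set (t1 := Rabs t0 + 1).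
  assert (ht1 : t0 < t1 /\ 0 <= t1) by (unfold t1; generalize (Rle_abs t0) (Rabs_pos t0); lra).
  destruct (volume_growth a b c k t0 x y z t1 hs hk H ltac:(lra)) as (P0 & hP0 & hvol).
  set (ka := / (2 * k)) in *.
  assert (hka : 0 < ka) by (apply Rinv_0_lt_compat; lra).
  assert (hkk : ka * k = / 2) by (unfold ka; field; lra).
  set (e := fun t => exp (- ka * t)).
  assert (he : forall t, 0 < e t) by (intros; apply exp_pos).
  assert (he1 : forall t, 0 <= t -> e t <= 1).
  { intros t ht. unfold e. rewrite <- exp_0. destruct (Req_dec (- ka * t) 0) as [->|]; [lra|].
    left. apply exp_increasing. nra. }
  set (p := fun t => x t * y t * z t).
  assert (hpos : forall t, t0 < t -> 0 < x t /\ 0 < y t /\ 0 < z t /\ 0 < p t).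
  { intros t ht. destruct (H t ht) as (((p1 & p2 & p3) & _) & _). unfold p.
    repeat split; auto. repeat apply Rmult_lt_0_compat; auto. }
  assert (hpinv : forall t, t1 <= t -> / p t <= (e t)^2 / P0).
  { intros t ht. destruct (hpos t ltac:(lra)) as (_ & _ & _ & hp).
    apply Rmult_le_reg_r with (p t * P0); [apply Rmult_lt_0_compat; auto|].
    replace (/ p t * (p t * P0)) with P0 by (field; lra).
    replace ((e t)^2 / P0 * (p t * P0)) with (p t * (e t)^2) by (field; lra).
    apply hvol; auto. }
  (* With this bound on [e], [/ p <= e^2 / P0 <= e / P0 <= / k^3], which makes [k^2 / (2 p)] at most
     [ka]. *)
  destruct (exp_decay_small ka (Rmin 1 (P0 / k^3)) hka) as [t3 ht3].
  { apply Rmin_pos; [lra|]. apply Rdiv_lt_0_compat; [|apply pow_lt]; auto. }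
  set (t4 := t1 + Rabs t3). assert (ht4 : t1 <= t4 /\ t3 <= t4)
    by (unfold t4; generalize (Rle_abs t3) (Rabs_pos t3); lra).
  assert (hsmall : forall t, t4 <= t -> k^2 / (2 * p t) <= ka).
  { intros t ht. specialize (hpinv t ltac:(lra)). specialize (ht3 t ltac:(lra)).
    fold (e t) in ht3.
    assert (e t <= 1) by (apply Rle_trans with (1 := ht3), Rmin_l).
    assert (hle : e t <= P0 / k^3) by (apply Rle_trans with (1 := ht3), Rmin_r).
    specialize (he t).
    assert (/ p t <= / k^3).
    { apply Rle_trans with (1 := hpinv).
      apply Rle_trans with (e t / P0).
      - apply Rmult_le_compat_r; [left; apply Rinv_0_lt_compat; auto|nra].
      - apply Rmult_le_reg_r with P0; auto. unfold Rdiv at 1. rewrite Rmult_assoc, Rinv_l, Rmult_1_r by lra.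
        unfold Rdiv in hle. lra. }
    destruct (hpos t ltac:(lra)) as (_ & _ & _ & hp).
    replace (k^2 / (2 * p t)) with (k^2 / 2 * / p t) by (field; lra).
    replace ka with (k^2 / 2 * / k^3) by (unfold ka; field; lra).
    apply Rmult_le_compat_l; [nra|auto]. }
  set (L := fun t => ln (x t / y t)).
  set (L' := fun t => (a / x t ^ 2 - b / y t ^ 2) / 2 - (x t ^ 2 - y t ^ 2) / (x t * y t * z t)).
  assert (hr1 : forall t, t0 < t -> 1 <= x t / y t).
  { intros t ht. destruct (H t ht) as (((p1 & p2 & p3) & _) & h2 & _).
    apply Rmult_le_reg_r with (y t); auto. unfold Rdiv. rewrite Rmult_assoc, Rinv_l; lra. }
  assert (hLpos : forall t, t0 < t -> 0 <= L t).
  { intros t ht. unfold L. rewrite <- ln_1. destruct (hr1 t ht) as [h|h].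
    - left. apply ln_increasing; lra.
    - rewrite <- h. lra. }
  assert (hexpL : forall t, t0 < t -> exp (L t) = x t / y t).
  { intros t ht. unfold L. apply exp_ln. generalize (hr1 t ht); lra. }
  assert (hLd : forall t, t0 < t -> is_derive L t (L' t)).
  { intros t ht. apply (is_derive_ln_ratio a b c). apply H; auto. }
  (* For [r = x / y] one has [(ln r)' <= k^2 r / (2p) - (r - 1) / k]; once [p] is
     large the first term is absorbed and [r - 1 >= ln r] makes it linear. *)
  assert (hL' : forall t, t4 <= t -> L' t <= k^2 / (2 * P0) * (e t)^2 - ka * L t).
  { intros t ht. destruct (H t ltac:(lra)) as (((p1 & p2 & p3) & _) & h2 & h3).
    destruct (hpos t ltac:(lra)) as (_ & _ & _ & hp).
    assert (hr := hr1 t ltac:(lra)). set (r := x t / y t) in *.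
    assert (hyr : / y t ^ 2 = r * z t * / p t) by (unfold r, p; field; lra).
    assert (g1 : a / x t ^ 2 <= Rabs a * / y t ^ 2) by (apply div_le_of_lower; nra).
    assert (g2 : (- b) / y t ^ 2 <= Rabs b * / y t ^ 2) by (apply div_le_of_lower; [nra|lra|rewrite Rabs_Ropp; lra]).
    replace (- b / y t ^ 2) with (- (b / y t ^ 2)) in g2 by (field; lra).
    assert (hpi : 0 < / p t) by (apply Rinv_0_lt_compat; auto).
    assert (g3 : (Rabs a + Rabs b) * / y t ^ 2 <= k * (r * k * / p t)).
    { rewrite hyr. generalize (Rabs_pos a) (Rabs_pos b) (Rabs_pos c); intros.
      apply Rmult_le_compat; [lra| |lra|].
      - apply Rmult_le_pos; [|lra]. apply Rmult_le_pos; lra.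
      - apply Rmult_le_compat_r; [lra|]. apply Rmult_le_compat_l; lra. }
    assert (g4 : (x t ^ 2 - y t ^ 2) / (x t * y t * z t) = (r - / r) * / z t) by (unfold r; field; lra).
    assert (hri : / r <= 1) by (rewrite <- Rinv_1; apply Rinv_le_contravar; lra).
    assert (g5 : (r - 1) * / k <= (r - / r) * / z t).
    { apply Rmult_le_compat; [lra| |lra|apply Rinv_le_contravar; lra].
      left; apply Rinv_0_lt_compat; lra. }
    assert (hlnr : L t <= r - 1).
    { generalize (exp_ge_1_plus (L t)). rewrite (hexpL t) by lra. fold r. lra. }
    assert (g6 := hsmall t ht).
    assert (g7 : L' t <= k^2 / (2 * p t) * r - (r - 1) * / k).
    { unfold L'. rewrite g4. replace (k^2 / (2 * p t) * r) with (k * (r * k * / p t) / 2) by (field; lra).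
      lra. }
    assert (hk2 : / k = 2 * ka) by (unfold ka; field; lra).
    assert (g8 : (k^2 / (2 * p t)) * (r - 1) <= ka * (r - 1)) by (apply Rmult_le_compat_r; lra).
    assert (g9 : k^2 / (2 * p t) <= k^2 / (2 * P0) * (e t)^2).
    { replace (k^2 / (2 * p t)) with (k^2 / 2 * / p t) by (field; lra).
      replace (k^2 / (2 * P0) * (e t)^2) with (k^2 / 2 * ((e t)^2 / P0)) by (field; lra).
      apply Rmult_le_compat_l; [nra|]. apply hpinv; lra. }
    rewrite hk2 in g7.
    assert (ka * L t <= ka * (r - 1)) by (apply Rmult_le_compat_l; lra).
    lra. }
  set (E := k^2 / (2 * P0)).
  assert (hE : 0 < E) by (unfold E; apply Rdiv_lt_0_compat; [apply pow_lt|]; lra).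
  (* The function [L / e + E / ka * e] has derivative [(L' + ka L - E e^2) / e <= 0]; [M1] is its
     value at [t4]. *)
  set (M1 := L t4 * / e t4 + E / ka * e t4).
  assert (hM1 : 0 <= M1).
  { unfold M1. apply Rplus_le_le_0_compat; apply Rmult_le_pos.
    - apply hLpos; lra.
    - left; apply Rinv_0_lt_compat, he.
    - left; apply Rdiv_lt_0_compat; auto.
    - left; apply he. }
  assert (hLdecay : forall t, t4 <= t -> L t <= M1 * e t).
  { intros t ht.
    assert (hm : - (L t4 * / e t4 + E / ka * e t4) <= - (L t * / e t + E / ka * e t)).
    { apply (derive_nonneg_le (fun r => - (L r * / e r + E / ka * e r))
        (fun r => (E * (e r)^2 - ka * L r - L' r) * / e r)); auto.
      - intros r hr. assert (h := hLd r ltac:(lra)). assert (hne := he r).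
        assert (hde : is_derive e r (- ka * e r)).
        { unfold e. auto_derive; auto. ring. }
        clearbody L e. auto_derive; [ex_der|]. rw_derive. field. lra.
      - intros r hr. apply Rmult_le_pos; [|left; apply Rinv_0_lt_compat, he].
        generalize (hL' r ltac:(lra)). fold E. lra. }
    fold M1 in hm.
    assert (0 <= E / ka * e t) by (apply Rmult_le_pos; left; [apply Rdiv_lt_0_compat|apply he]; auto).
    apply Rmult_le_reg_r with (/ e t); [apply Rinv_0_lt_compat, he|].
    rewrite Rmult_assoc, Rinv_r, Rmult_1_r by (generalize (he t); lra). lra. }
  (* Past [t5] the logarithm is at most 1/2, where [exp v <= 1 + 2 v] turns its decay into that of
     [x / y - 1] and yields [x / y <= 2]. *)
  destruct (exp_decay_small ka (/ (2 * (M1 + 1))) hka) as [t5 ht5].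
  { apply Rinv_0_lt_compat; lra. }
  exists (2 * M1 + 2 * k / P0), (t4 + Rabs t5).
  assert (hkP : 0 < 2 * k / P0) by (apply Rdiv_lt_0_compat; lra).
  generalize (Rle_abs t5) (Rabs_pos t5); intros q1 q2.
  split; [lra|]. split; [lra|]. split; [lra|].
  intros t ht. specialize (ht5 t ltac:(lra)). specialize (hLdecay t ltac:(lra)). fold (e t) in *.
  assert (het := he t). assert (het1 := he1 t ltac:(lra)).
  assert (hLh : L t <= / 2).
  { apply Rle_trans with (1 := hLdecay).
    apply Rle_trans with ((M1 + 1) * / (2 * (M1 + 1))); [|right; field; lra].
    apply Rmult_le_compat; lra. }
  assert (hrL := exp_le_1_plus_double (L t) (conj (hLpos t ltac:(lra)) hLh)).
  rewrite hexpL in hrL by lra.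
  assert (hr := hr1 t ltac:(lra)).
  repeat split; try lra.
  - assert (0 <= 2 * k / P0 * e t) by nra. lra.
  - destruct (H t ltac:(lra)) as (((p1 & p2 & p3) & _) & h2 & h3).
    destruct (hpos t ltac:(lra)) as (_ & _ & _ & hp).
    assert (hyr : / y t ^ 2 = (x t / y t) * z t * / p t) by (unfold p; field; lra).
    rewrite hyr. specialize (hpinv t ltac:(lra)).
    apply Rle_trans with (2 * k * ((e t)^2 / P0)).
    + apply Rmult_le_compat; auto.
      * apply Rmult_le_pos; lra.
      * left; apply Rinv_0_lt_compat; auto.
      * apply Rmult_le_compat; lra.
    + replace (2 * k * ((e t)^2 / P0)) with (2 * k / P0 * e t * e t) by (field; lra).
      assert (0 <= 2 * k / P0 * e t) by nra. assert (0 <= M1 * e t) by nra. nra.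
Qed.

(** The main part of [z'] is [1 + c / (3 z)]. What remains is the contribution of [a / x^2] and
    [b / y^2], the excess [(r - 1)^2 / (2 r)] of [(x^2 + y^2) / (2 x y)] over 1, and
    [z^2 / (2 x y)]; each decays by [ratio_decay]. *)
Lemma smallest_velocity_error a b c k t0 x y z : a + b + c = 0 -> 0 < k -> Rabs a + Rabs b + Rabs c <= k ->
  trapped a b c k t0 x y z ->
  exists M t2, 0 <= M /\ t0 < t2 /\ 0 <= t2 /\ forall t, t2 <= t ->
    1 <= x t / y t <= 2 /\ x t / y t - 1 <= M * exp (- / (2 * k) * t) /\
    / y t ^ 2 <= M * exp (- / (2 * k) * t) /\
    Rabs (vfield c a b (z t) (x t) (y t) - (z t - - c / 3) / z t) <= M * exp (- / (2 * k) * t).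
Proof.
  intros hs hk habc H.
  destruct (ratio_decay a b c k t0 x y z hs hk habc H) as (M & t2 & hM & h02 & h2 & hd).
  exists (M * (k^2 + k^2 + 1)), t2. repeat split; try apply hd; auto; try nra.
  1, 2: apply Rle_trans with (M * exp (- / (2 * k) * t)); [apply hd; auto|];
    apply Rmult_le_compat_r; [left; apply exp_pos|nra].
  destruct (hd t H0) as (hr & hr1 & hy).
  destruct (H t ltac:(lra)) as (((p1 & p2 & p3) & _) & h3 & h4).
  set (e := exp (- / (2 * k) * t)) in *. assert (he : 0 < e) by apply exp_pos.
  set (r := x t / y t) in *.
  assert (hv : vfield c a b (z t) (x t) (y t) - (z t - - c / 3) / z t
    = - (z t / 6 * (a / x t ^ 2 + b / y t ^ 2)) + (r - 1)^2 / (2 * r) + - (z t ^ 2 / (2 * r) * / y t ^ 2)).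
  { unfold r, vfield, drift. field. lra. }
  rewrite hv.
  assert (hyi : 0 < / y t ^ 2) by (apply Rinv_0_lt_compat, pow_lt; auto).
  assert (hxi : 0 < / x t ^ 2 <= / y t ^ 2).
  { split; [apply Rinv_0_lt_compat, pow_lt; auto|]. apply Rinv_le_contravar; [apply pow_lt; auto|].
    apply pow_incr; lra. }
  assert (hkz : z t <= k) by lra.
  assert (b1 : Rabs (z t / 6 * (a / x t ^ 2 + b / y t ^ 2)) <= k^2 * (M * e)).
  { rewrite Rabs_mult, (Rabs_right (z t / 6)) by lra.
    assert (Rabs (a / x t ^ 2 + b / y t ^ 2) <= k * (M * e)).
    { apply Rle_trans with (1 := Rabs_triang _ _). unfold Rdiv. rewrite !Rabs_mult.
      rewrite (Rabs_right (/ x t ^ 2)), (Rabs_right (/ y t ^ 2)) by lra.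
      generalize (Rabs_pos a) (Rabs_pos b) (Rabs_pos c); intros.
      apply Rle_trans with ((Rabs a + Rabs b) * / y t ^ 2); [nra|].
      apply Rmult_le_compat; lra. }
    replace (k^2 * (M * e)) with (k * (k * (M * e))) by ring.
    apply Rmult_le_compat; auto using Rabs_pos; lra. }
  assert (b2 : Rabs ((r - 1)^2 / (2 * r)) <= M * e).
  { assert (0 < / (2 * r) <= / 2).
    { split; [apply Rinv_0_lt_compat; lra|apply Rinv_le_contravar; lra]. }
    unfold Rdiv. rewrite Rabs_right by (apply Rle_ge, Rmult_le_pos; [apply pow2_ge_0|lra]).
    apply Rle_trans with ((r - 1)^2 * 1).
    - apply Rmult_le_compat_l; [apply pow2_ge_0|lra].
    - nra. }
  assert (b3 : Rabs (z t ^ 2 / (2 * r) * / y t ^ 2) <= k^2 * (M * e)).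
  { assert (0 < / (2 * r) <= / 2).
    { split; [apply Rinv_0_lt_compat; lra|apply Rinv_le_contravar; lra]. }
    assert (z t ^ 2 <= k^2) by (apply pow_incr; lra).
    assert (0 <= z t ^ 2) by apply pow2_ge_0.
    assert (0 <= z t ^ 2 / (2 * r) <= k^2).
    { unfold Rdiv. split; [apply Rmult_le_pos; lra|]. nra. }
    rewrite Rabs_right by (apply Rle_ge, Rmult_le_pos; lra).
    apply Rmult_le_compat; lra. }
  apply Rle_trans with (1 := Rabs_triang _ _).
  assert (hT := Rabs_triang (- (z t / 6 * (a / x t ^ 2 + b / y t ^ 2))) ((r - 1)^2 / (2 * r))).
  rewrite Rabs_Ropp in hT |- *. lra.
Qed.

(* The rest point [l] is repelling, so a bounded solution stays within the size
   of the forcing term of it. *)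
Lemma unstable_equilibrium (z z' : R -> R) (l k ka M t2 : R) :
  0 < k -> 0 < ka -> 0 <= M ->
  (forall t, t2 < t -> is_derive z t (z' t) /\ 0 < z t <= k /\
     Rabs (z' t - (z t - l) / z t) <= M * exp (- ka * t)) ->
  forall t, t2 < t -> Rabs (z t - l) <= k * M * exp (- ka * t).
Proof.
  intros hk hka hM H.
  assert (W : forall s : R, s = 1 \/ s = -1 -> forall t, t2 < t ->
    s * (z t - l) <= k * M * exp (- ka * t)).
  { intros s hs t ht. destruct (Rle_lt_dec (s * (z t - l)) (k * M * exp (- ka * t))) as [|hlt]; auto.
    exfalso.
    set (G := fun r => s * (z r - l) - k * M * exp (- ka * r)).
    assert (hG : 0 < G t) by (unfold G; lra).
    set (B := k + Rabs l).
    assert (hGB : forall r, t2 < r -> G r <= B).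
    { intros r hr. destruct (H r hr) as (_ & hz & _). unfold G, B.
      assert (0 <= k * M * exp (- ka * r)).
      { apply Rmult_le_pos; [nra|left; apply exp_pos]. }
      generalize (Rle_abs l) (Rabs_maj2 l). destruct hs as [-> | ->]; lra. }
    (* [G] grows at least at the exponential rate [/ k], so by [t'] it has reached
       [G t * exp (B / G t) >= G t + B], above its bound [B]. *)
    set (t' := t + k * (B / G t)).
    assert (hB : 0 <= B) by (unfold B; generalize (Rabs_pos l); lra).
    assert (hBG : 0 <= B / G t) by (apply Rmult_le_pos; auto; left; apply Rinv_0_lt_compat; auto).
    assert (ht' : t <= t') by (unfold t'; nra).
    assert (hg : G t * exp (/ k * (t' - t)) <= G t').
    { apply (linear_comparison_exp G (fun r => s * z' r + ka * (k * M * exp (- ka * r)))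
        (fun r => / z r) (/ k) t2 (t' + 1)); auto; try lra.
      - intros r hr. destruct (H r ltac:(lra)) as (hd & _ & _).
        unfold G. auto_derive; [ex_der|]. rw_derive. ring.
      - intros r hr. destruct (H r ltac:(lra)) as (hd & hz & _).
        apply (ex_derive_continuous (fun r => / z r)). auto_derive. ex_der.
      - intros r hr. destruct (H r ltac:(lra)) as (hd & hz & he).
        unfold G. set (e := exp (- ka * r)) in *. assert (he0 : 0 < e) by apply exp_pos.
        (* Because [z <= k], the term subtracted in [G], multiplied by [/ z], outweighs the forcing;
           this is why [G] carries the factor [k]. *)
        assert (h1 : M * e <= / z r * (k * M * e)).
        { apply Rmult_le_reg_l with (z r); [lra|]. replace (z r * (/ z r * (k * M * e))) with (k * M * e) by (field; lra).
          assert (0 <= M * e) by nra. nra. }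
        assert (h2 : 0 <= ka * (k * M * e)) by (assert (0 <= M * e) by nra; assert (0 < ka * k) by nra; nra).
        assert (h3 : / z r * (s * (z r - l)) = s * ((z r - l) / z r)) by (field; lra).
        rewrite Rmult_minus_distr_l, h3.
        apply Rabs_le_between in he. destruct hs as [-> | ->]; lra.
      - intros r hr. destruct (H r ltac:(lra)) as (hd & hz & he).
        apply Rinv_le_contravar; lra. }
    replace (/ k * (t' - t)) with (B / G t) in hg by (unfold t'; field; lra).
    generalize (exp_ge_1_plus (B / G t)) (hGB t' ltac:(lra)); intros.
    assert (G t * (1 + B / G t) <= G t * exp (B / G t)) by (apply Rmult_le_compat_l; lra).
    replace (G t * (1 + B / G t)) with (G t + B) in H2 by (field; lra). lra. }
  intros t ht. apply Rabs_le_between.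
  generalize (W 1 (or_introl eq_refl) t ht) (W (-1) (or_intror eq_refl) t ht). lra.
Qed.

Lemma two_sided_sqrt (c C v w : R) : 0 < c -> 0 < C -> 0 < v -> 0 < w ->
  c * w^2 <= v^2 <= C * w^2 -> sqrt c * w <= v <= sqrt C * w.
Proof.
  intros hc hC hv hw h.
  assert (0 < sqrt c) by (apply sqrt_lt_R0; auto).
  assert (0 < sqrt C) by (apply sqrt_lt_R0; auto).
  assert (sqrt c * sqrt c = c) by (apply sqrt_sqrt; lra).
  assert (sqrt C * sqrt C = C) by (apply sqrt_sqrt; lra).
  split.
  - apply Rsqr_incr_0_var; [|lra]. unfold Rsqr. nra.
  - apply Rsqr_incr_0_var; [|nra]. unfold Rsqr. nra.
Qed.

Lemma is_lim_of_exp_bound (h : R -> R) (l M ka t2 : R) : 0 < ka -> 0 <= M ->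
  (forall t, t2 <= t -> Rabs (h t - l) <= M * exp (- ka * t)) -> is_lim h p_infty l.
Proof.
  intros hka hM H. apply is_lim_spec. intros eps.
  destruct (exp_decay_small ka (eps / (M + 1)) hka) as [t3 ht3].
  { apply Rdiv_lt_0_compat; [apply cond_pos|lra]. }
  exists (Rmax t2 t3). intros t ht.
  assert (t2 <= t) by (generalize (Rmax_l t2 t3); lra).
  assert (t3 <= t) by (generalize (Rmax_r t2 t3); lra).
  apply Rle_lt_trans with (1 := H t H0). specialize (ht3 t H1).
  generalize (cond_pos eps) (exp_pos (- ka * t)); intros.
  apply Rle_lt_trans with (M * (eps / (M + 1))).
  - apply Rmult_le_compat_l; auto.
  - apply Rlt_le_trans with ((M + 1) * (eps / (M + 1))); [|right; field; lra].
    apply Rmult_lt_compat_r; [apply Rdiv_lt_0_compat|]; lra.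
Qed.

(** [(ln p)' - / l] is exponentially small, hence integrable, so [p] is comparable to [exp (t / l)].
    Then [x^2 = (x / y) p / z] and [y^2 = (y / x) p / z] give both functions the rate
    [/ (2 * l)]. *)
Lemma exponential_asymptotics a b c k t0 x y z :
  a + b + c = 0 -> 0 < k -> Rabs a + Rabs b + Rabs c <= k -> trapped a b c k t0 x y z ->
  (exists l, 0 < l /\ is_lim z p_infty l) /\
  grows_exponentially x /\ grows_exponentially y /\ is_lim (fun t => x t / y t) p_infty 1.
Proof.
  intros hs hk habc H.
  destruct (smallest_velocity_error a b c k t0 x y z hs hk habc H) as (M & t2 & hM & h02 & h2 & hd).
  set (ka := / (2 * k)) in *.
  assert (hka : 0 < ka) by (apply Rinv_0_lt_compat; lra).
  set (l := - c / 3) in *.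
  assert (hz : forall t, t2 < t -> Rabs (z t - l) <= k * M * exp (- ka * t)).
  { apply (unstable_equilibrium z (fun t => vfield c a b (z t) (x t) (y t)) l k ka M t2); auto.
    intros t ht. destruct (H t ltac:(lra)) as (((p1 & p2 & p3) & _ & _ & hz) & _ & h3).
    split; [exact hz|]. split; [lra|]. apply hd; lra. }
  assert (hkM : 0 <= k * M) by nra.
  assert (hzl : is_lim z p_infty l).
  { apply (is_lim_of_exp_bound z l (k * M) ka (t2 + 1)); auto. intros t ht. apply hz. lra. }
  assert (hsmall : forall e, 0 < e -> exists t3, t2 < t3 /\ forall t, t3 <= t -> (k * M + M) * exp (- ka * t) <= e).
  { intros e he. destruct (exp_decay_small ka (e / (k * M + M + 1)) hka) as [t3 ht3].
    { apply Rdiv_lt_0_compat; lra. }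
    exists (Rmax (t2 + 1) t3). split; [generalize (Rmax_l (t2 + 1) t3); lra|]. intros t ht.
    specialize (ht3 t ltac:(generalize (Rmax_r (t2 + 1) t3); lra)).
    apply Rle_trans with ((k * M + M + 1) * (e / (k * M + M + 1))); [|right; field; lra].
    generalize (exp_pos (- ka * t)); intros. apply Rmult_le_compat; lra. }
  (* Convergence of a positive function gives only [l >= 0]; the value zero has to be excluded
     through the velocity. *)
  assert (hl : 0 < l).
  { destruct (Rtotal_order 0 l) as [|[h0|hneg]]; auto; exfalso.
    - (* if [l = 0] then [z' -> 1], and [z] is not bounded *)
      destruct (hsmall (/ 2) ltac:(lra)) as (t3 & h23 & ht3).
      assert (hg : / 2 * t3 - z t3 >= / 2 * (t3 + 2 * k) - z (t3 + 2 * k)).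
      { apply Rle_ge. enough (z t3 - / 2 * t3 <= z (t3 + 2 * k) - / 2 * (t3 + 2 * k)) by lra.
        apply (derive_nonneg_le (fun r => z r - / 2 * r) (fun r => vfield c a b (z r) (x r) (y r) - / 2)); [lra| |].
        - intros r hr. destruct (H r ltac:(lra)) as ((_ & _ & _ & hdz) & _).
          auto_derive; [ex_der|]. rw_derive. field.
        - intros r hr. destruct (H r ltac:(lra)) as (((p1 & p2 & p3) & _) & _).
          destruct (hd r ltac:(lra)) as (_ & _ & _ & he). specialize (ht3 r ltac:(lra)).
          rewrite <- h0 in he. replace ((z r - 0) / z r) with 1 in he by (field; lra).
          generalize (exp_pos (- ka * r)); intros.
          assert (0 <= k * M * exp (- ka * r)) by nra.
          apply Rabs_le_between in he. lra. }
      destruct (H t3 ltac:(lra)) as (((_ & _ & p3) & _) & _).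
      destruct (H (t3 + 2 * k) ltac:(lra)) as (_ & _ & hk3). lra.
    - destruct (hsmall (- l) ltac:(lra)) as (t3 & h23 & ht3).
      destruct (H t3 ltac:(lra)) as (((_ & _ & p3) & _) & _).
      specialize (hz t3 h23). specialize (ht3 t3 ltac:(lra)).
      generalize (exp_pos (- ka * t3)); intros. assert (0 <= M * exp (- ka * t3)) by nra.
      apply Rabs_le_between in hz. lra. }
  split; [exists l; auto|].
  assert (hratio : is_lim (fun t => x t / y t) p_infty 1).
  { apply (is_lim_of_exp_bound _ 1 M ka t2); auto. intros t ht.
    destruct (hd t ht) as (h1 & h3 & _). rewrite Rabs_right; lra. }
  destruct (hsmall (l / 2) ltac:(lra)) as (t3 & h23 & ht3).
  assert (hzlow : forall t, t3 <= t -> l / 2 <= z t).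
  { intros t ht. specialize (ht3 t ht). specialize (hz t ltac:(lra)).
    generalize (exp_pos (- ka * t)); intros. assert (0 <= M * exp (- ka * t)) by nra.
    apply Rabs_le_between in hz. lra. }
  set (p := fun t => x t * y t * z t).
  assert (hp : forall t, t0 < t -> 0 < p t).
  { intros t ht. destruct (H t ht) as (((p1 & p2 & p3) & _) & _). unfold p.
    repeat apply Rmult_lt_0_compat; auto. }
  set (q' := fun t => (x t ^ 2 + y t ^ 2 + z t ^ 2) / 2 / p t - / l).
  assert (hq : forall t, t0 < t -> is_derive (fun t => ln (p t) - t / l) t (q' t)).
  { intros t ht. assert (h : is_derive p t ((x t ^ 2 + y t ^ 2 + z t ^ 2) / 2))
      by (apply (is_derive_prod a b c); auto; apply H; auto).
    specialize (hp t ht). unfold q'. clearbody p. auto_derive; [ex_der|].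
    rw_derive. field. lra. }
  set (E := M * / l + k * M + 2 * (k * M) / l^2).
  assert (hli : 0 < / l) by (apply Rinv_0_lt_compat; auto).
  assert (hli2 : 0 < / l^2) by (apply Rinv_0_lt_compat, pow_lt; auto).
  assert (hE : 0 <= E).
  { unfold E. assert (0 <= M * / l) by nra. assert (0 <= 2 * (k * M) / l^2) by (apply Rmult_le_pos; lra). lra. }
  assert (hq' : forall t, t3 <= t -> Rabs (q' t) <= E * exp (- ka * t)).
  { intros t ht. destruct (H t ltac:(lra)) as (((p1 & p2 & p3) & _) & h4 & h5).
    destruct (hd t ltac:(lra)) as (hr & hr1 & hy & _). specialize (hz t ltac:(lra)).
    specialize (hzlow t ht). specialize (hp t ltac:(lra)).
    set (e := exp (- ka * t)) in *. assert (he : 0 < e) by apply exp_pos.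
    set (r := x t / y t) in *.
    assert (eq : q' t = (r - 1)^2 / r * / (2 * z t) + z t / (2 * r) * / y t ^ 2 - (z t - l) * / (z t * l)).
    { unfold q', p, r. field. lra. }
    rewrite eq.
    assert (hri : 0 < / r <= 1).
    { split; [apply Rinv_0_lt_compat; lra|]. rewrite <- Rinv_1. apply Rinv_le_contravar; lra. }
    assert (b1 : 0 <= (r - 1)^2 / r * / (2 * z t) <= M * / l * e).
    { assert (0 < / (2 * z t) <= / l) by (split; [apply Rinv_0_lt_compat; lra|apply Rinv_le_contravar; lra]).
      assert (0 <= (r - 1)^2 / r <= M * e).
      { unfold Rdiv. assert (0 <= (r - 1)^2 <= r - 1) by nra. split; nra. }
      split; [apply Rmult_le_pos; lra|].
      replace (M * / l * e) with (M * e * / l) by ring. apply Rmult_le_compat; lra. }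
    assert (b2 : 0 <= z t / (2 * r) * / y t ^ 2 <= k * M * e).
    { assert (0 < / y t ^ 2) by (apply Rinv_0_lt_compat, pow_lt; auto).
      assert (0 <= z t / (2 * r) <= k).
      { replace (z t / (2 * r)) with (z t * / r / 2) by (field; lra). nra. }
      split; [apply Rmult_le_pos; lra|].
      rewrite Rmult_assoc. apply Rmult_le_compat; lra. }
    assert (b3 : Rabs ((z t - l) * / (z t * l)) <= 2 * (k * M) / l^2 * e).
    { rewrite Rabs_mult. assert (0 < / (z t * l) <= 2 * / l^2).
      { split; [apply Rinv_0_lt_compat; nra|].
        replace (2 * / l^2) with (/ (l / 2 * l)) by (field; lra). apply Rinv_le_contravar; nra. }
      rewrite (Rabs_right (/ (z t * l))) by lra.
      replace (2 * (k * M) / l^2 * e) with (k * M * e * (2 * / l^2)) by (field; lra).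
      apply Rmult_le_compat; auto using Rabs_pos; lra. }
    apply Rabs_le_between in b3. apply Rabs_le_between. unfold E. lra. }
  destruct (limit_of_derive_bound (fun t => ln (p t) - t / l) q'
    (fun t => E / ka * exp (- ka * t)) (fun t => E * exp (- ka * t)) t3) as [v hv].
  - intros t ht. apply hq. lra.
  - intros t ht. auto_derive; auto. field. lra.
  - intros t ht. apply Rmult_le_pos; [|left; apply exp_pos]. apply Rmult_le_pos; auto.
    left; apply Rinv_0_lt_compat; auto.
  - auto.
  - set (B := Rabs v + E / ka).
    assert (hpB : forall t, t3 <= t -> exp (- B) * exp (/ (2 * l) * t) ^ 2 <= p t <= exp B * exp (/ (2 * l) * t)^2).
    { intros t ht. specialize (hv t ht). specialize (hp t ltac:(lra)).
      assert (exp (- ka * t) <= 1).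
      { rewrite <- exp_0. destruct (Req_dec (- ka * t) 0) as [->|]; [lra|].
        left. apply exp_increasing. nra. }
      assert (0 <= E / ka) by (apply Rmult_le_pos; auto; left; apply Rinv_0_lt_compat; auto).
      assert (E / ka * exp (- ka * t) <= E / ka) by nra.
      generalize (Rle_abs v) (Rabs_maj2 v); intros.
      apply Rabs_le_between in hv.
      rewrite <- (exp_ln (p t)) by auto. 
      simpl. rewrite Rmult_1_r, <- !exp_plus.
      replace (/ (2 * l) * t + / (2 * l) * t) with (t / l) by (field; lra).
      assert (mono : forall u w, u <= w -> exp u <= exp w).
      { intros u w [h| ->]; [left; apply exp_increasing; auto|lra]. }
      split; apply mono; unfold B; lra. }
    (* Both squares are [p] times [/ z], which lies in [[/ k, 2 / l]], times a factor between 1/2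
       and 2; hence the constants. *)
    assert (bounds : forall h, (forall t, t3 <= t -> 0 < h t /\ / (2 * k) * p t <= h t ^ 2 <= 4 / l * p t) ->
       grows_exponentially h).
    { intros h hh.
      exists (/ (2 * l)), (sqrt (/ (2 * k) * exp (- B))), (sqrt (4 / l * exp B)).
      assert (c1 : 0 < / (2 * k) * exp (- B)) by (apply Rmult_lt_0_compat; auto using exp_pos).
      assert (h4l : 0 < 4 / l) by (apply Rdiv_lt_0_compat; lra).
      assert (c2 : 0 < 4 / l * exp B) by (apply Rmult_lt_0_compat; auto using exp_pos).
      split; [apply Rinv_0_lt_compat; lra|]. split; [apply sqrt_lt_R0; auto|].
      exists t3. intros t ht. destruct (hh t ltac:(lra)) as [q1 q2].
      destruct (hpB t ltac:(lra)) as [q3 q4].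
      apply two_sided_sqrt; auto using exp_pos.
      rewrite !Rmult_assoc. split.
      - apply Rle_trans with (2 := proj1 q2). apply Rmult_le_compat_l; auto. left; auto.
      - apply Rle_trans with (1 := proj2 q2). apply Rmult_le_compat_l; auto. left; auto. }
    assert (cmp : forall t, t3 <= t -> 1 <= x t / y t <= 2 /\ l / 2 <= z t <= k /\ 0 < p t /\ 0 < x t /\ 0 < y t).
    { intros t ht. destruct (H t ltac:(lra)) as (((p1 & p2 & p3) & _) & h4 & h5).
      repeat split; try apply hd; auto; try lra. apply hp; lra. }
    assert (inv : forall t, t3 <= t -> / k <= / z t <= 2 / l).
    { intros t ht. destruct (cmp t ht) as (_ & h & _). split; [apply Rinv_le_contravar; lra|].
      replace (2 / l) with (/ (l / 2)) by (field; lra). apply Rinv_le_contravar; lra. }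
    assert (hki : 0 < / k) by (apply Rinv_0_lt_compat; auto).
    split; [|split; [|exact hratio]]; apply bounds; intros t ht;
      destruct (cmp t ht) as (h1 & h3 & h4 & h5 & h6); destruct (inv t ht) as [i1 i2]; split; auto.
    + replace (x t ^ 2) with ((x t / y t) * / z t * p t) by (unfold p; field; lra).
      replace (/ (2 * k)) with (/ k / 2) by (field; lra).
      split; apply Rmult_le_compat_r; try lra.
      * apply Rle_trans with (1 * / k); [lra|]. apply Rmult_le_compat; lra.
      * replace (4 / l) with (2 * (2 / l)) by (field; lra). apply Rmult_le_compat; lra.
    + replace (y t ^ 2) with (/ (x t / y t) * / z t * p t) by (unfold p; field; lra).
      assert (/ 2 <= / (x t / y t) <= 1).
      { split; [apply Rinv_le_contravar; lra|]. rewrite <- Rinv_1. apply Rinv_le_contravar; lra. }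
      replace (/ (2 * k)) with (/ 2 * / k) by (field; lra).
      split; apply Rmult_le_compat_r; try lra.
      * apply Rmult_le_compat; lra.
      * apply Rle_trans with (1 * (2 / l)); [apply Rmult_le_compat; lra|].
        unfold Rdiv. lra.
Qed.

(** * Completeness of the end *)

Lemma continuous_Rplus (g h : R -> R) s :
  continuous g s -> continuous h s -> continuous (fun x => g x + h x) s.
Proof. apply (continuous_plus g h). Qed.

Lemma continuous_Rmult (g h : R -> R) s :
  continuous g s -> continuous h s -> continuous (fun x => g x * h x) s.
Proof. apply (continuous_mult g h). Qed.

Lemma continuous_Ropp (g : R -> R) s :
  continuous g s -> continuous (fun x => - g x) s.
Proof. apply (continuous_opp g). Qed.

Lemma continuous_Rsq (g : R -> R) s :
  continuous g s -> continuous (fun x => g x ^ 2) s.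
Proof.
  intros h. apply (continuous_ext (fun x => g x * g x)).
  - intros x. change (@eq R (g x * g x) (g x ^ 2)). ring.
  - apply continuous_Rmult; auto.
Qed.

Lemma continuous_coordinates (g : R -> C) s :
  continuous (U := C_R_NormedModule) g s ->
  continuous (fun x => fst (g x)) s /\ continuous (fun x => snd (g x)) s.
Proof.
  intros h. split.
  - apply (continuous_comp (V := prod_UniformSpace R_UniformSpace R_UniformSpace) g fst); auto.
    apply continuous_fst.
  - apply (continuous_comp (V := prod_UniformSpace R_UniformSpace R_UniformSpace) g snd); auto.
    apply continuous_snd.
Qed.

Lemma continuous_omega_sq (A A' : R -> I3 -> I3 -> C) (j k : I3) (s : R) :
  (forall j k, continuous (U := C_R_NormedModule) (fun x => A x j k) s) ->
  (forall j k, continuous (U := C_R_NormedModule) (fun x => A' x j k) s) ->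
  continuous (fun x => Cmod (omega (A x) (A' x) j k) ^ 2) s.
Proof.
  intros hA hA'.
  apply (continuous_ext (fun x => fst (omega (A x) (A' x) j k) ^ 2 + snd (omega (A x) (A' x) j k) ^ 2)).
  { intros x; symmetry; apply Cmod2_alt. }
  assert (h1 := fun j k => continuous_coordinates _ _ (hA j k)).
  assert (h2 := fun j k => continuous_coordinates _ _ (hA' j k)).
  unfold omega, sum3C, Cconj, Cplus, Cmult. simpl fst; simpl snd.
  apply continuous_Rplus; apply continuous_Rsq;
    repeat first [apply continuous_Rplus | apply continuous_Rmult | apply continuous_Ropp
      | apply h1 | apply h2].
Qed.

(** Makes the speed integrable on compact intervals, which the comparison of [RInt] requires. *)
Lemma continuous_speed (f : I3 -> R -> R) (r r' : R -> R) (A A' : R -> I3 -> I3 -> C) (s : R) :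
  (forall i, continuous (f i) (r s)) -> continuous r s -> continuous r' s ->
  (forall j k, continuous (U := C_R_NormedModule) (fun x => A x j k) s) ->
  (forall j k, continuous (U := C_R_NormedModule) (fun x => A' x j k) s) ->
  continuous (fun s => speed f (r s) (r' s) (A s) (A' s)) s.
Proof.
  intros hf hr hr' hA hA'. unfold speed.
  apply (continuous_comp (fun s => r' s ^ 2 + sum3 (fun i => f i (r s) ^ 2 * g_norm2 i (A s) (A' s))) sqrt).
  - unfold sum3, g_norm2.
    assert (hi : forall i, continuous (fun s => f i (r s) ^ 2 *
      (4 * Cmod (omega (A s) (A' s) (next i) (next (next i))) ^ 2)) s).
    { intros i. apply continuous_Rmult.
      - apply continuous_Rsq. apply (continuous_comp r (f i)); auto.
      - apply continuous_Rmult; [apply continuous_const|apply continuous_omega_sq; auto]. }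
    apply continuous_Rplus; [apply continuous_Rsq; auto|].
    apply continuous_Rplus; [apply continuous_Rplus|]; apply hi.
  - apply continuous_sqrt.
Qed.

Lemma speed_ge (f : I3 -> R -> R) (r r' : R) (A A' : I3 -> I3 -> C) :
  Rabs r' <= speed f r r' A A'.
Proof.
  unfold speed. rewrite <- sqrt_Rsqr_abs. apply sqrt_le_1_alt.
  unfold Rsqr, sum3, g_norm2.
  assert (h : forall i, 0 <= f i r ^ 2 * (4 * Cmod (omega A A' (next i) (next (next i))) ^ 2)).
  { intros i. apply Rmult_le_pos; [apply pow2_ge_0|].
    generalize (pow2_ge_0 (Cmod (omega A A' (next i) (next (next i))))); lra. }
  generalize (h i1) (h i2) (h i3). lra.
Qed.

(** The length is at least the integral of [r'], that is [r b - r 0], and the radial distance to the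
    end is infinite. *)
Lemma complete_end_of_infinite (f : I3 -> R -> R) (a : Rbar) :
  (forall t, in_interval a p_infty t -> forall i, continuous (f i) t) ->
  complete_end f a p_infty.
Proof.
  intros hf r r' A A' H hlim.
  set (S := fun s => speed f (r s) (r' s) (A s) (A' s)).
  assert (hS : forall s, 0 <= s -> continuous S s).
  { intros s hs. destruct (H s hs) as (hin & _ & hr & hr' & hA).
    apply continuous_speed; auto.
    - apply (ex_derive_continuous r). eexists; exact hr.
    - intros j k. destruct (hA j k) as [h _].
      apply (ex_derive_continuous (K := R_AbsRing) (V := C_R_NormedModule) (fun x => A x j k)).
      eexists; exact h.
    - intros j k. apply hA. }
  apply (is_lim_le_p_loc (fun b => r b - r 0)).
  - exists 0. intros b hb.
    assert (hint : is_RInt r' 0 b (r b - r 0)).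
    { apply (is_RInt_derive r r').
      - intros s hs. rewrite Rmin_left in hs by lra. apply H; lra.
      - intros s hs. rewrite Rmin_left in hs by lra. apply H; lra. }
    rewrite <- (is_RInt_unique _ _ _ _ hint).
    apply RInt_le; [lra|eexists; exact hint| |].
    + apply (ex_RInt_continuous (V := R_CompleteNormedModule)). intros s hs.
      rewrite Rmin_left in hs by lra. apply hS; lra.
    + intros s hs. apply Rle_trans with (1 := Rle_abs _). apply speed_ge.
  - apply is_lim_spec. intros M. apply is_lim_spec in hlim.
    destruct (hlim (M + r 0)) as [N hN]. exists N. intros b hb. specialize (hN b hb). simpl in *. lra.
Qed.

Definition identity3 (j k : I3) : C :=
  match j, k with i1, i1 | i2, i2 | i3, i3 => RtoC 1 | _, _ => RtoC 0 end.

Lemma SU3_identity3 : SU3 identity3.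
Proof.
  unfold SU3, sum3C, det3, identity3, RtoC, Cconj. split; [|split].
  - intros []; simpl; unfold Cmult, Cplus; simpl; f_equal; ring.
  - intros [] [] h; try congruence; simpl; unfold Cmult, Cplus; simpl; f_equal; ring.
  - unfold sum3C; simpl; unfold Cmult, Cplus, Cminus, Copp; simpl; f_equal; ring.
Qed.

(* The radial curve [T - (T - t0) exp (- s)] has length [T - t0]. *)
Lemma incomplete_end_of_finite (f : I3 -> R -> R) (a : Rbar) (T : R) :
  Rbar_lt a T -> ~ complete_end f a T.
Proof.
  intros haT hc. destruct (in_interval_inhabited a T haT) as [t0 ht0].
  assert (h0T : t0 < T) by apply ht0.
  set (r := fun s => T - (T - t0) * exp (- s)).
  set (r' := fun s => (T - t0) * exp (- s)).
  assert (hr : forall s, is_derive r s (r' s)).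
  { intros s. unfold r, r'. auto_derive; auto. ring. }
  assert (hr' : forall s, continuous r' s).
  { intros s. apply (ex_derive_continuous r'). unfold r'. auto_derive. auto. }
  assert (hlim := hc r r' (fun _ => identity3) (fun _ _ _ => RtoC 0)).
  assert (hL : is_lim (fun b => RInt (fun s => speed f (r s) (r' s) identity3 (fun _ _ => RtoC 0)) 0 b)
    p_infty p_infty).
  { apply hlim.
    - intros s hs. split; [|split; [|split; [|split]]]; auto.
      + assert (0 < exp (- s) <= 1).
        { split; [apply exp_pos|]. rewrite <- exp_0. destruct (Req_dec s 0) as [->|].
          - rewrite Ropp_0; lra.
          - left; apply exp_increasing; lra. }
        unfold r. split.
        * apply Rbar_lt_le_trans with t0; [apply ht0|]. simpl. nra.
        * simpl. assert (0 < (T - t0) * exp (- s)) by (apply Rmult_lt_0_compat; lra). lra.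
      + apply SU3_identity3.
      + intros j k. split.
        * apply (is_derive_const (K := R_AbsRing) (V := C_R_NormedModule)).
        * apply continuous_const.
    - apply is_lim_spec. intros eps.
      destruct (exp_decay_small 1 (eps / (T - t0 + 1)) ltac:(lra)) as [t3 ht3].
      { apply Rdiv_lt_0_compat; [apply cond_pos|lra]. }
      exists t3. intros s hs. specialize (ht3 s ltac:(lra)).
      replace (- (1) * s) with (- s) in ht3 by ring.
      unfold r. replace (T - (T - t0) * exp (- s) - T) with (- ((T - t0) * exp (- s))) by ring.
      generalize (exp_pos (- s)) (cond_pos eps); intros.
      rewrite Rabs_Ropp, Rabs_right by nra.
      apply Rle_lt_trans with ((T - t0) * (eps / (T - t0 + 1))); [apply Rmult_le_compat_l; lra|].
      apply Rlt_le_trans with ((T - t0 + 1) * (eps / (T - t0 + 1))); [|right; field; lra].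
      apply Rmult_lt_compat_r; [apply Rdiv_lt_0_compat|]; lra. }
  apply is_lim_spec in hL. destruct (hL (T - t0)) as [N hN].
  set (b := Rmax 0 N + 1).
  assert (hb : 0 < b /\ N < b) by (unfold b; generalize (Rmax_l 0 N) (Rmax_r 0 N); lra).
  specialize (hN b ltac:(lra)).
  assert (hint : is_RInt r' 0 b (r b - r 0)).
  { apply (is_RInt_derive r r'); auto. }
  rewrite (RInt_ext _ r') in hN.
  - rewrite (is_RInt_unique _ _ _ _ hint) in hN. unfold r in hN. rewrite Ropp_0, exp_0 in hN.
    assert (0 < (T - t0) * exp (- b)) by (apply Rmult_lt_0_compat; [lra|apply exp_pos]). lra.
  - intros s _.
    (* The curve does not move along the orbit, so its speed is [r'] alone. *)
    assert (h0 : forall i, g_norm2 i identity3 (fun _ _ => RtoC 0) = 0).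
    { intros i. unfold g_norm2, omega, sum3C. rewrite !Cmult_0_r, !Cplus_0_r, Cmod_0. ring. }
    unfold speed, sum3. rewrite !h0.
    replace (r' s ^ 2 + (f i1 (r s) ^ 2 * 0 + f i2 (r s) ^ 2 * 0 + f i3 (r s) ^ 2 * 0))
      with (Rsqr (r' s)) by (unfold Rsqr; ring).
    apply sqrt_Rsqr. unfold r'. apply Rmult_le_pos; [lra|left; apply exp_pos].
Qed.

(** * The trichotomy *)

Lemma eventual_order (c : I3 -> R) (f : I3 -> R -> R) (a T : Rbar) (t0 : R) :
  (forall t, in_interval a T t -> forall i, 0 < f i t /\ is_derive (f i) t (field c i (fun j => f j t))) ->
  in_interval a T t0 ->
  exists i j k t1, distinct3 i j k /\ in_interval a T t1 /\
    forall t, in_interval a T t -> t1 <= t -> f k t <= f j t <= f i t.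
Proof.
  intros H h0.
  assert (ho : forall i j k, distinct3 i j k -> forall t, in_interval a T t ->
    ode_at (c i) (c j) (c k) (f i) (f j) (f k) t).
  { intros i j k hd t ht. apply ode_at_perm; auto. }
  assert (d123 : distinct3 i1 i2 i3) by (repeat split; discriminate).
  assert (d231 : distinct3 i2 i3 i1) by (repeat split; discriminate).
  assert (d312 : distinct3 i3 i1 i2) by (repeat split; discriminate).
  destruct (order_eventual _ _ _ _ _ _ a T t0 (ho _ _ _ d123) h0) as (s1 & hs1 & _ & o1).
  destruct (order_eventual _ _ _ _ _ _ a T s1 (ho _ _ _ d231) hs1) as (s2 & hs2 & le12 & o2).
  destruct (order_eventual _ _ _ _ _ _ a T s2 (ho _ _ _ d312) hs2) as (s3 & hs3 & le23 & o3).
  assert (pick : forall i j k, distinct3 i j k ->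
    (forall t, in_interval a T t -> s3 <= t -> f k t <= f j t <= f i t) ->
    exists i j k t1, distinct3 i j k /\ in_interval a T t1 /\
    forall t, in_interval a T t -> t1 <= t -> f k t <= f j t <= f i t).
  { intros i j k hd h. exists i, j, k, s3. auto. }
  (* Of the eight patterns, the first and the last are cyclic and force the three functions to be
     equal, so any order serves there. *)
  destruct o1 as [o1|o1], o2 as [o2|o2], o3 as [o3|o3].
  - apply (pick i1 i2 i3); [repeat split; discriminate|]. intros t ht hle.
    generalize (o1 t ht ltac:(lra)) (o2 t ht ltac:(lra)) (o3 t ht ltac:(lra)); lra.
  - apply (pick i1 i2 i3); [repeat split; discriminate|]. intros t ht hle.
    generalize (o1 t ht ltac:(lra)) (o2 t ht ltac:(lra)) (o3 t ht ltac:(lra)); lra.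
  - apply (pick i3 i1 i2); [repeat split; discriminate|]. intros t ht hle.
    generalize (o1 t ht ltac:(lra)) (o2 t ht ltac:(lra)) (o3 t ht ltac:(lra)); lra.
  - apply (pick i1 i3 i2); [repeat split; discriminate|]. intros t ht hle.
    generalize (o1 t ht ltac:(lra)) (o2 t ht ltac:(lra)) (o3 t ht ltac:(lra)); lra.
  - apply (pick i2 i3 i1); [repeat split; discriminate|]. intros t ht hle.
    generalize (o1 t ht ltac:(lra)) (o2 t ht ltac:(lra)) (o3 t ht ltac:(lra)); lra.
  - apply (pick i2 i1 i3); [repeat split; discriminate|]. intros t ht hle.
    generalize (o1 t ht ltac:(lra)) (o2 t ht ltac:(lra)) (o3 t ht ltac:(lra)); lra.
  - apply (pick i3 i2 i1); [repeat split; discriminate|]. intros t ht hle.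
    generalize (o1 t ht ltac:(lra)) (o2 t ht ltac:(lra)) (o3 t ht ltac:(lra)); lra.
  - apply (pick i1 i3 i2); [repeat split; discriminate|]. intros t ht hle.
    generalize (o1 t ht ltac:(lra)) (o2 t ht ltac:(lra)) (o3 t ht ltac:(lra)); lra.
Qed.

Lemma distinct3_cover i j k l : distinct3 i j k -> l = i \/ l = j \/ l = k.
Proof.
  intros (h1 & h2 & h3). destruct i, j, k, l; try (exfalso; congruence); auto.
Qed.

Lemma at_left_intro (t1 T : R) (P : R -> Prop) : t1 < T ->
  (forall t, t1 < t < T -> P t) -> at_left T P.
Proof.
  intros h H. unfold at_left, within.
  apply (locally_interval _ T t1 p_infty); [exact h|exact I|].
  intros y hy _ hyT. apply H. auto.
Qed.

Lemma finite_time_case (f : I3 -> R -> R) (u : R -> R) (a : Rbar) (T : R) (c : I3 -> R) (i j k : I3) (t1 : R) :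
  forward_maximal f u a T -> sum3 c = 0 ->
  (forall t, in_interval a T t ->
     (forall i, 0 < f i t /\ is_derive (f i) t (field c i (fun j => f j t))) /\
     u t = drift3 c (fun j => f j t)) ->
  distinct3 i j k -> in_interval a T t1 ->
  (forall t, in_interval a T t -> t1 <= t -> f k t <= f j t <= f i t) ->
  finite_time_end f a T.
Proof.
  intros hmax hc H hd ht1 hord.
  assert (haT : Rbar_lt a T) by (apply Rbar_lt_trans with t1; apply ht1).
  split; [apply incomplete_end_of_finite; auto|].
  exists T. split; auto. exists k.
  assert (hin : forall t, t1 <= t < T -> in_interval a T t).
  { intros t ht. split; [|simpl; lra].
    apply Rbar_lt_le_trans with t1; [apply ht1|simpl; lra]. }
  assert (hT : t1 < T) by apply ht1.
  assert (hode : forall t, t1 <= t < T ->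
    ode_at (c i) (c j) (c k) (f i) (f j) (f k) t /\ f k t <= f j t <= f i t).
  { intros t ht. split; [apply ode_at_perm; auto; apply H; auto|apply hord; auto; lra]. }
  assert (hs : c i + c j + c k = 0) by (rewrite <- (sum3_perm c i j k hd); auto).
  (* Otherwise all three functions would stay in one box [[m, M]] up to [T], which [leaves_boxes]
     forbids. *)
  assert (hinf : forall m s, 0 < m -> t1 <= s < T -> exists t, s <= t < T /\ f k t < m).
  { intros m s hm hsT. apply NNPP. intros hn.
    assert (hlow : forall t, s <= t < T -> m <= f k t).
    { intros t ht. destruct (Rle_lt_dec m (f k t)); auto. exfalso. apply hn. exists t; auto. }
    destruct (finite_time_bound (c i) (c j) (c k) (f i) (f j) (f k) s T m) as [M hM]; auto; try lra.
    { intros t ht. destruct (hode t ltac:(lra)). split; [|split]; auto. }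
    assert (hmM : m <= M).
    { generalize (hM s ltac:(lra)) (hlow s ltac:(lra)). destruct (hode s ltac:(lra)). lra. }
    destruct (leaves_boxes f u a T c m M haT hmax hc H ltac:(lra)) as (d & hd0 & hleave).
    set (t := Rmax s (T - d / 2)).
    assert (ht : s <= t < T /\ T - d < t).
    { unfold t, Rmax. destruct Rle_dec; lra. }
    apply (hleave t); [apply hin; lra|lra|].
    intros l. generalize (hM t ltac:(lra)) (hlow t ltac:(lra)).
    destruct (hode t ltac:(lra)) as [_ ho].
    destruct (distinct3_cover i j k l hd) as [->|[->| ->]]; lra. }
  assert (hrate := smallest_vanishing_rate _ _ _ _ _ _ t1 T hode hinf).
  set (C := Rabs (c i) + Rabs (c j) + Rabs (c k)) in *.
  assert (hC : 0 <= C) by (unfold C; generalize (Rabs_pos (c i)) (Rabs_pos (c j)) (Rabs_pos (c k)); lra).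
  assert (hz : forall t, t1 <= t < T -> 0 < f k t) by (intros t ht; apply H; auto).
  split; [|split].
  - apply (at_left_intro t1); auto. intros t ht l. destruct (hode t ltac:(lra)) as [_ ho].
    destruct (distinct3_cover i j k l hd) as [->|[->| ->]]; lra.
  - intros P [e he].
    (* Within [d] of [T] the rate gives [z^2 <= C d < e^2]; the [+ 1] covers [C = 0]. *)
    set (d := e * e / (C + 1)).
    assert (hd0 : 0 < d).
    { unfold d. apply Rdiv_lt_0_compat; [|lra]. apply Rmult_lt_0_compat; apply cond_pos. }
    apply (at_left_intro (Rmax t1 (T - d))).
    { unfold Rmax; destruct Rle_dec; lra. }
    intros t ht. apply he.
    assert (ht' : t1 <= t < T /\ T - d < t).
    { generalize (Rmax_l t1 (T - d)) (Rmax_r t1 (T - d)); lra. }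
    specialize (hrate t ltac:(lra)). specialize (hz t ltac:(lra)).
    assert (f k t < e).
    { assert (C * (T - t) <= C * d) by (apply Rmult_le_compat_l; lra).
      assert (C * d < (C + 1) * d) by (apply Rmult_lt_compat_r; lra).
      assert ((C + 1) * d = e * e) by (unfold d; field; lra).
      generalize (cond_pos e); intros. nra. }
    unfold ball; simpl; unfold AbsRing_ball, abs, minus, plus, opp; simpl.
    rewrite Ropp_0, Rplus_0_r, Rabs_right; lra.
  - exists (sqrt C). apply (at_left_intro t1); auto. intros t ht.
    specialize (hrate t ltac:(lra)). specialize (hz t ltac:(lra)).
    rewrite Rabs_right by lra. rewrite <- sqrt_mult_alt by auto.
    rewrite <- (sqrt_Rsqr (f k t)) by lra. apply sqrt_le_1_alt. unfold Rsqr. lra.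
Qed.

(** * Conical rates: attaining them and showing them optimal *)

Lemma Rpower_decay (q e : R) : q < 0 -> 0 < e -> exists t3, forall t, t3 <= t -> Rpower t q <= e.
Proof.
  intros hq he. exists (exp (ln e / q)). intros t ht.
  assert (h0 : 0 < exp (ln e / q)) by apply exp_pos.
  assert (hl : ln e / q <= ln t).
  { rewrite <- (ln_exp (ln e / q)). destruct ht as [ht| <-]; [left; apply ln_increasing|]; lra. }
  unfold Rpower. apply Rle_trans with (exp (ln e)); [|rewrite exp_ln; lra].
  assert (q * ln t <= ln e).
  { replace (ln e) with (q * (ln e / q)) by (field; lra).
    apply Rmult_le_compat_neg_l; lra. }
  destruct H as [H| ->]; [left; apply exp_increasing; auto|lra].
Qed.

Lemma AC_of_symbols (f : I3 -> R -> R) (T : Rbar) (nu c : R) :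
  nu < 0 -> T = p_infty ->
  (forall i m, symbol m (1 + nu) (fun s => f i (s + c) - s / 2)) -> AC_with_rate f T nu.
Proof.
  intros h1 h2 H. split; [|split]; auto. exists c. intros i m. apply symbol_Derive_n, H.
Qed.

Lemma AC_pointwise (f : I3 -> R -> R) (T : Rbar) (nu : R) :
  AC_with_rate f T nu -> exists c, forall i, exists K, 0 <= K /\
    near_infinity (fun t => Rabs (f i (t + c) - t / 2) <= K * Rpower t (1 + nu)).
Proof.
  intros (_ & _ & c & H). exists c. intros i. destruct (H i 0%nat) as [K hK].
  exists (Rabs K). split; [apply Rabs_pos|].
  apply (near_infinity_imp _ _) with (2 := hK). intros t [_ h]. simpl in h.
  rewrite Rminus_0_r in h. apply Rle_trans with (1 := h).
  apply Rmult_le_compat_r; [left; apply exp_pos|apply Rle_abs].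
Qed.

(** One translation serves all three functions, so it cancels in differences, and [1 + nu < 0] makes
    what is left tend to zero. *)
Lemma AC_differences_vanish (f : I3 -> R -> R) (T : Rbar) (nu : R) :
  AC_with_rate f T nu -> nu < -1 ->
  forall i j e, 0 < e -> exists t3, forall t, t3 <= t -> Rabs (f i t - f j t) <= e.
Proof.
  intros hac hnu i j e he. destruct (AC_pointwise f T nu hac) as [c H].
  destruct (H i) as (Ki & hKi & hi), (H j) as (Kj & hKj & hj).
  destruct (Rpower_decay (1 + nu) (e / (Ki + Kj + 1)) ltac:(lra)) as [t3 ht3].
  { apply Rdiv_lt_0_compat; lra. }
  destruct (near_infinity_and _ _ hi hj) as [N hN].
  exists (Rmax (N + 1) t3 + c). intros t ht.
  assert (ht' : N < t - c /\ t3 <= t - c) by (generalize (Rmax_l (N + 1) t3) (Rmax_r (N + 1) t3); lra).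
  destruct (hN (t - c) ltac:(lra)) as [b1 b2]. specialize (ht3 (t - c) ltac:(lra)).
  replace (t - c + c) with t in b1, b2 by ring.
  assert (0 < Rpower (t - c) (1 + nu)) by apply exp_pos.
  assert ((Ki + Kj + 1) * Rpower (t - c) (1 + nu) <= e).
  { replace e with ((Ki + Kj + 1) * (e / (Ki + Kj + 1))) by (field; lra).
    apply Rmult_le_compat_l; lra. }
  apply Rabs_le_between in b1. apply Rabs_le_between in b2. apply Rabs_le_between. lra.
Qed.

Lemma ode_at_shift a b c x y z v t : ode_at a b c x y z (t + v) ->
  ode_at a b c (fun s => x (s + v)) (fun s => y (s + v)) (fun s => z (s + v)) t.
Proof.
  intros (hp & hx & hy & hz).
  assert (sh : forall (h : R -> R) (d : R), is_derive h (t + v) d -> is_derive (fun s => h (s + v)) t d).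
  { intros h d hd. auto_derive; [ex_der|].
    change (Derive (fun x => h x) (t + v)) with (Derive h (t + v)).
    rewrite (Derive_eq h (t + v) d hd). ring. }
  split; [exact hp|]. split; [|split]; apply sh; auto.
Qed.

(** Static means that all [c i] vanish. If they do not, a rate below [-1] would make all differences
    tend to zero, forcing [c i <= c j] around the cycle; the constants would be equal, and zero
    because their sum is. *)
Lemma conical_case (f : I3 -> R -> R) (u : R -> R) (a : Rbar) (c : I3 -> R) (d K t2 : R) :
  sum3 c = 0 ->
  (forall t, in_interval a p_infty t ->
     (forall i, 0 < f i t /\ is_derive (f i) t (field c i (fun j => f j t))) /\
     (forall i, tau f i t = c i + u t * f i t ^ 2) /\
     u t = drift3 c (fun j => f j t)) ->
  in_interval a p_infty t2 -> 0 < d -> 0 < K -> 1 <= t2 -> (forall i, linear_bounds d K t2 (f i)) ->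
  asymptotically_conical f u a p_infty.
Proof.
  intros hc H ht2 hd hK h2 hlin.
  assert (hin : forall t, t2 <= t -> in_interval a p_infty t).
  { intros t ht. split; [|exact I]. apply Rbar_lt_le_trans with t2; [apply ht2|exact ht]. }
  assert (hode : forall i j k, distinct3 i j k -> forall t, t2 <= t ->
    ode_at (c i) (c j) (c k) (f i) (f j) (f k) t).
  { intros i j k hdi t ht. apply ode_at_perm; auto. apply H; auto. }
  assert (d123 : distinct3 i1 i2 i3) by (repeat split; discriminate).
  assert (d231 : distinct3 i2 i3 i1) by (repeat split; discriminate).
  assert (d312 : distinct3 i3 i1 i2) by (repeat split; discriminate).
  destruct (classic (forall i, c i = 0)) as [h0|hn].
  - left. split.
    { intros t ht. destruct (H t ht) as (_ & h3 & h4).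
      assert (hu : u t = 0).
      { rewrite h4. unfold drift3, drift. rewrite !h0. unfold Rdiv. ring. }
      split; auto. intros i. rewrite h3, hu, h0. ring. }
    assert (hode0 : forall i j k, distinct3 i j k -> forall t, t2 <= t ->
      ode_at 0 0 0 (f i) (f j) (f k) t).
    { intros i j k hdi t ht. generalize (hode i j k hdi t ht). rewrite !h0; auto. }
    destruct (static_difference_decay _ _ _ d K t2 hd hK h2 (hode0 _ _ _ d123)) as (A1 & hA1 & q1); auto.
    destruct (static_difference_decay _ _ _ d K t2 hd hK h2 (hode0 _ _ _ d231)) as (A2 & hA2 & q2); auto.
    destruct (static_difference_decay _ _ _ d K t2 hd hK h2 (hode0 _ _ _ d312)) as (A3 & hA3 & q3); auto.
    destruct (static_asymptotics (f i1) (f i2) (f i3) d K t2 (A1 + A2 + A3)) as (l & B & hB & q); auto; try lra.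
    { intros t ht.
      assert (ht3 : 0 < / t^3) by (apply Rinv_0_lt_compat, pow_lt; lra).
      specialize (q1 t ht). specialize (q2 t ht). specialize (q3 t ht). unfold Rdiv in *.
      assert (0 <= A1 * / t^3) by (apply Rmult_le_pos; lra).
      assert (0 <= A2 * / t^3) by (apply Rmult_le_pos; lra).
      assert (0 <= A3 * / t^3) by (apply Rmult_le_pos; lra).
      repeat split; lra. }
    assert (hall : forall i t, t2 <= t -> Rabs (f i t - t / 2 - l) <= B / t^3).
    { intros i t ht. destruct (q t ht) as (r1 & r2 & r3). destruct i; auto. }
    (* Translating by [- 2 l] removes the limit [l] of [f i t - t / 2]. For large [s] the shifted
       time is at least [s / 2], whence the factor 8. *)
    assert (hsym : forall i, symbol 0 (-3) (fun s => f i (s + - (2 * l)) - s / 2)).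
    { intros i. split; [|exact I]. exists (8 * B).
      apply (near_infinity_ge (t2 + 4 * Rabs l + 1)). intros s hs.
      generalize (Rle_abs l) (Rabs_maj2 l) (Rabs_pos l); intros.
      specialize (hall i (s + - (2 * l)) ltac:(lra)).
      replace (f i (s + - (2 * l)) - (s + - (2 * l)) / 2 - l) with (f i (s + - (2 * l)) - s / 2) in hall by field.
      apply Rle_trans with (1 := hall).
      replace (-3) with (Ropp (INR 3)) by (simpl; ring).
      rewrite Rpower_Ropp, Rpower_pow by lra.
      replace (8 * B * / s^3) with (B * / (s / 2)^3) by (field; lra).
      unfold Rdiv at 1. apply Rmult_le_compat_l; auto.
      apply Rinv_le_contravar; [apply pow_lt; lra|]. apply pow_incr; lra. }
    assert (hodes : near_infinity (ode_at 0 0 0 (fun s => f i1 (s + - (2 * l))) (fun s => f i2 (s + - (2 * l)))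
       (fun s => f i3 (s + - (2 * l))))).
    { apply (near_infinity_ge (t2 + 2 * l)). intros t ht. apply ode_at_shift. apply hode0; auto. lra. }
    assert (hz : forall (m : nat) (e : R), In e (0 :: 0 :: 0 :: nil) -> symbol m (-3) (fun _ => e)).
    { intros m e he. assert (e = 0) as -> by (simpl in he; intuition congruence). apply symbol_zero. }
    apply (AC_of_symbols f p_infty (-4) (- (2 * l))); auto; [lra|].
    intros i m. apply (symbol_eq_order _ (-3)); [ring|].
    destruct (symbol_bootstrap (-3) 0 0 0 _ _ _ ltac:(lra) hz hodes (hsym i1) (hsym i2) (hsym i3) m)
      as (r1 & r2 & r3). destruct i; auto.
  - right.
    assert (hns : ~ static f u a p_infty).
    { intros hst. apply hn. intros i. destruct (hst t2 ht2) as [hta hu].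
      destruct (H t2 ht2) as (_ & h3 & _). specialize (h3 i). rewrite hta, hu in h3. lra. }
    split; auto.
    assert (hdb : forall i j k, distinct3 i j k -> exists A, 0 <= A /\ forall t, t2 <= t -> Rabs (f i t - f j t) <= A).
    { intros i j k hdi. apply (difference_bounded (c i) (c j) (c k) (f i) (f j) (f k) d K t2); auto. }
    destruct (hdb _ _ _ d123) as (A1 & hA1 & q1).
    destruct (hdb _ _ _ d231) as (A2 & hA2 & q2).
    destruct (hdb _ _ _ d312) as (A3 & hA3 & q3).
    set (A := A1 + A2 + A3).
    assert (hA : forall t, t2 <= t -> Rabs (f i1 t - f i2 t) <= A /\ Rabs (f i2 t - f i3 t) <= A /\ Rabs (f i3 t - f i1 t) <= A).
    { intros t ht. specialize (q1 t ht). specialize (q2 t ht). specialize (q3 t ht). unfold A. lra. }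
    assert (hB : forall i, symbol 0 0 (fun s => f i s - s / 2)).
    { assert (W : forall i, (exists B, forall t, t2 <= t -> Rabs (f i t - t / 2) <= B) ->
        symbol 0 0 (fun s => f i s - s / 2)).
      { intros i [B hB]. split; [|exact I]. exists B. apply (near_infinity_ge t2). intros t ht.
        rewrite Rpower_O by lra. rewrite Rmult_1_r; auto. }
      assert (hA0 : 0 <= A) by (unfold A; lra).
      unfold sum3 in hc.
      intros []; apply W.
      - apply (asymptotically_half_linear (c i1) (c i2) (c i3) (f i1) (f i2) (f i3) d K t2 A); auto; try lra.
      - apply (asymptotically_half_linear (c i2) (c i3) (c i1) (f i2) (f i3) (f i1) d K t2 A); auto; try lra.
        intros t ht. specialize (hA t ht). tauto.
      - apply (asymptotically_half_linear (c i3) (c i1) (c i2) (f i3) (f i1) (f i2) d K t2 A); auto; try lra.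
        intros t ht. specialize (hA t ht). tauto. }
    split.
    (* At rate [-1] an error [O(1)] is allowed, so no translation has to be adjusted. *)
    + apply (AC_of_symbols f p_infty (-1) 0); auto; [lra|].
      intros i m. apply (symbol_eq_order _ 0); [ring|].
      apply (symbol_ext _ _ (fun s => f i s - s / 2)).
      { apply (near_infinity_ge 0). intros t _. rewrite Rplus_0_r; auto. }
      destruct (symbol_bootstrap 0 (c i1) (c i2) (c i3) (f i1) (f i2) (f i3)) with (m := m)
        as (r1 & r2 & r3); auto; try lra.
      * intros n e _. apply symbol_const.
      * apply (near_infinity_ge t2). apply hode; auto.
      * destruct i; auto.
    + intros nu hnu. destruct (Rle_lt_dec (-1) nu) as [|hlt]; auto. exfalso. apply hn.
      assert (hv := AC_differences_vanish f p_infty nu hnu hlt).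
      assert (hle : forall i j k, distinct3 i j k -> c i <= c j).
      { intros i j k hdi. destruct (hdb i j k hdi) as (A' & hA' & hq).
        apply (differences_vanish_le (c i) (c j) (c k) (f i) (f j) (f k) d K t2 A'); auto. }
      assert (e1 := hle i1 i2 i3 d123). assert (e2 := hle i2 i3 i1 d231). assert (e3 := hle i3 i1 i2 d312).
      unfold sum3 in hc. intros []; lra.
Qed.

Lemma conical_not_exponential (f : I3 -> R -> R) (u : R -> R) (a T : Rbar) :
  ~ (asymptotically_conical f u a T /\ exponential_end f a T).
Proof.
  intros [hac (_ & _ & i & j & k & _ & _ & _ & (l & _ & hl) & _)].
  assert (h : exists nu, nu <= -1 /\ AC_with_rate f T nu).
  { destruct hac as [[_ h]|(_ & h & _)]; [exists (-4)|exists (-1)]; split; auto; lra. }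
  destruct h as (nu & hnu & h). destruct (AC_pointwise f T nu h) as [c hc].
  destruct (hc k) as (K & hK & hk). apply is_lim_spec in hl. destruct (hl (mkposreal 1 Rlt_0_1)) as [N hN].
  destruct (near_infinity_and _ _ hk (near_infinity_ge 1 (fun t => 1 <= t) (fun t ht => ht))) as [N' hN'].
  (* At [t + c] the function is below [l + 1] by its limit and at least [t / 2 - K] by the conical
     rate; [t > 2 (K + l + 1)] makes these incompatible. *)
  set (t := Rmax N' (Rmax (N - c) (2 * (K + l + 1))) + 1).
  assert (ht : N' < t /\ N - c < t /\ 2 * (K + l + 1) < t).
  { unfold t. generalize (Rmax_l N' (Rmax (N - c) (2 * (K + l + 1)))) (Rmax_r N' (Rmax (N - c) (2 * (K + l + 1))))
     (Rmax_l (N - c) (2 * (K + l + 1))) (Rmax_r (N - c) (2 * (K + l + 1))). lra. }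
  destruct (hN' t ltac:(lra)) as [b1 b2]. specialize (hN (t + c) ltac:(lra)). simpl in hN.
  assert (Rpower t (1 + nu) <= 1).
  { apply Rle_trans with (Rpower t 0); [apply Rle_Rpower; lra|rewrite Rpower_O; lra]. }
  assert (K * Rpower t (1 + nu) <= K * 1) by (apply Rmult_le_compat_l; auto).
  apply Rabs_le_between in b1. apply Rabs_def2 in hN. lra.
Qed.

Theorem theorem6 (f : I3 -> R -> R) (u : R -> R) (a T : Rbar)
  (hsol : steady_soliton f u a T) (hmax : forward_maximal f u a T) :
  (asymptotically_conical f u a T \/ exponential_end f a T \/ finite_time_end f a T) /\
  ~ (asymptotically_conical f u a T /\ exponential_end f a T) /\
  ~ (asymptotically_conical f u a T /\ finite_time_end f a T) /\
  ~ (exponential_end f a T /\ finite_time_end f a T).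
Proof.
  split; [|split; [apply conical_not_exponential|split]].
  - destruct (first_order_system f u a T hsol) as (c & hc & H).
    destruct (in_interval_inhabited a T (proj1 hsol)) as [t0 ht0].
    destruct (eventual_order c f a T t0) as (i & j & k & t1 & hd & ht1 & hord); auto.
    { intros t ht. apply H; auto. }
    destruct T as [T| |].
    + right; right. apply (finite_time_case f u a T c i j k t1); auto.
      intros t ht. destruct (H t ht) as (h1 & _ & h2). auto.
    + assert (hs : c i + c j + c k = 0) by (rewrite <- (sum3_perm c i j k hd); auto).
      assert (hin : forall t, t1 < t -> in_interval a p_infty t).
      { intros t ht. split; [|exact I]. apply Rbar_lt_trans with t1; [apply ht1|exact ht]. }
      assert (hode : forall t, t1 < t ->
        ode_at (c i) (c j) (c k) (f i) (f j) (f k) t /\ f k t <= f j t <= f i t).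
      { intros t ht. split; [apply ode_at_perm; auto; apply H; auto|apply hord; auto; lra]. }
      destruct (classic (exists s, t1 < s /\ Rabs (c i) + Rabs (c j) + Rabs (c k) < f k s))
        as [(s & hs1 & hs2)|hn].
      * left.
        destruct (linear_growth _ _ _ _ _ _ t1 s hode hs1 hs2) as (d & K & t2 & hd0 & hK & h2 & h12 & hb).
        apply (conical_case f u a c d K t2); auto.
        intros l t ht. specialize (hb t ht). destruct (hode t ltac:(lra)) as [_ ho].
        destruct (distinct3_cover i j k l hd) as [->|[->| ->]]; lra.
      * right; left. split; [reflexivity|]. split.
        { apply complete_end_of_infinite. intros t ht l. apply (ex_derive_continuous (f l)).
          apply (proj2 hsol t ht). }
        set (C := Rabs (c i) + Rabs (c j) + Rabs (c k)).
        assert (htr : trapped (c i) (c j) (c k) C t1 (f i) (f j) (f k)).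
        { intros t ht. destruct (hode t ht) as [h1 h3]. repeat split; try apply h1; try lra.
          destruct (Rle_lt_dec (f k t) C); auto. exfalso. apply hn. exists t; auto. }
        assert (hC : 0 < C).
        { destruct (htr (t1 + 1) ltac:(lra)) as (((_ & _ & p) & _) & _ & h3). lra. }
        destruct (exponential_asymptotics _ _ _ C t1 _ _ _ hs hC (Rle_refl C) htr) as (h1 & h3 & h4 & h5).
        exists i, j, k. destruct hd as (n1 & n2 & n3). tauto.
    + destruct ht0 as [_ []].
  - intros [hac (_ & T' & hT & _)].
    destruct hac as [[_ (_ & h & _)]|(_ & (_ & h & _) & _)]; congruence.
  - intros [(h & _) (_ & T' & hT & _)]. congruence.
Qed.
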